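(* For every $\alpha\in(0,1/4]$ and every $\gamma\ge 4\alpha$, the random variable $Z_\alpha^{-\gamma}$ is a generalized gamma convolution (GGC).
   Context: For $\alpha\in(0,1)$, $Z_\alpha$ denotes a positive $\alpha$-stable random variable normalized by $\mathbb{E}[e^{-\lambda Z_\alpha}]=e^{-\lambda^\alpha}$ for all $\lambda\ge 0$. A positive random variable $X$ is called a generalized gamma convolution (GGC) if there exist $a\ge 0$ and a completely monotone function $\varphi$ on $(0,\infty)$ such that $$\mathbb{E}[e^{-\lambda X}]=\exp\Big(-\Big[a\lambda+\int_0^\infty(1-e^{-\lambda x})\frac{\varphi(x)}{x}\,dx\Big]\Big),\qquad \lambda\ge 0.$$ A function $\varphi$ on $(0,\infty)$ is completely monotone if it is smooth and $(-1)^n\varphi^{(n)}\ge 0$ for all $n\ge 0$. *)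

(* Defs.v *)
From mathcomp Require Import all_boot all_order all_algebra.
From mathcomp Require Import all_classical all_reals all_analysis.

Set Implicit Arguments.
Unset Strict Implicit.
Unset Printing Implicit Defensive.

Import Order.TTheory GRing.Theory Num.Theory.
Import numFieldNormedType.Exports.

Local Open Scope classical_set_scope.
Local Open Scope ring_scope.

Definition completely_monotone (R : realType) (phi : R -> R) : Prop :=
  (forall (n : nat) (x : R), 0 < x -> derivable (derive1n n phi) x 1) /\
  (forall (n : nat) (x : R), 0 < x -> 0 <= (-1) ^+ n * derive1n n phi x).

Definition positive_rv (R : realType) (d : measure_display)
    (T : measurableType d) (P : probability T R) (X : T -> R) : Prop :=
  measurable_fun [set: T] X /\ {ae P, forall w, 0 < X w}.

(* The Laplace transform determines the law, so the normalization also encodes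
   alpha-stability of Z. *)
Definition positive_stable (R : realType) (d : measure_display)
    (T : measurableType d) (P : probability T R) (alpha : R) (Z : T -> R)
    : Prop :=
  positive_rv P Z /\
  forall lambda : R, 0 <= lambda ->
    ('E_P[fun w => expR (- lambda * Z w)] = (expR (- (lambda `^ alpha)))%:E)%E.

(* The Levy integral is valued in [0, +oo]. Its finiteness is forced by the
   identity: expeR -oo = 0, whereas E[exp(- lambda X)] > 0. *)
Definition GGC (R : realType) (d : measure_display)
    (T : measurableType d) (P : probability T R) (X : T -> R) : Prop :=
  positive_rv P X /\
  exists (a : R) (phi : R -> R),
    [/\ 0 <= a, completely_monotone phi &
      forall lambda : R, 0 <= lambda ->
        ('E_P[fun w => expR (- lambda * X w)] =
        expeR (- ((a * lambda)%:E +
          \int[@lebesgue_measure R]_(x in `]0%R, +oo[)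
            ((1 - expR (- lambda * x)) * (phi x / x))%:E)))%E].

(* Main.v *)
Require Import Defs.
From mathcomp Require Import all_boot all_order all_algebra.
From mathcomp Require Import all_classical all_reals all_analysis.
From mathcomp Require Import polyrcf measurable_realfun ring lra zify.

Set Implicit Arguments.
Unset Strict Implicit.
Unset Printing Implicit Defensive.

Import Order.TTheory GRing.Theory Num.Theory.
Import numFieldNormedType.Exports.

Local Open Scope classical_set_scope.
Local Open Scope ring_scope.

(* With [q = gamma / alpha >= 4], the variable [X = Z^-gamma] satisfies
   [E X^s = Gamma(1+qs) / Gamma(1+gamma s)
          = Gamma(1+s) * (Gamma(1+qs) / (Gamma(1+s) Gamma(1+gamma s)))],
   so that X is a mixture of exponential laws whose rates have the Mellin transform
   in parentheses. By Gauss's product formula the latter is a limit of products of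
   factors [(1+s/y) / ((1+s/x)(1+s/x'))] with [x < x' <= y], where [y] runs through
   the integers and the multiples of [1/gamma], and [x, x'] through the multiples of
   [1/q]. Each factor is the limit of the generating functions of log-concave weights
   on a geometric progression of rates [t_i = c E^i], and log-concavity is stable
   under convolution.

   For log-concave weights [p_i], the zeros of the rational function
   [sum_i p_i t_i / (t_i + l)] interlace with its poles, and their position
   relative to the poles is monotone in [i]. Hence, up to a factor [E], this Laplace
   transform equals [prod_i (1 + l/t_i)^(-w_i)] with [w_i >= 0] and [sum_i w_i = 1],
   which is the transform of a finite gamma convolution. As [E] tends to 1 the
   moments of [X^(1/q)] converge, therefore so do the Laplace transforms, and the
   Levy densities [sum_i w_i exp(-t_i x) / x] converge along a subsequence. *)

(** * Limits of gamma convolutions *)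

(** The constant 4 is two kinds of numerator factors times two poles each. A factor with a single
    pole, [(1 - b z) / (1 - a z)] with [0 < b < a], has coefficients [1, a - b, (a - b) a, ...],
    which are not log-concave; a second pole [a' >= b] repairs this. Hence each integer and each
    multiple of 1/gamma has to use up two multiples of 1/q.

    The moments of X itself are out of reach of an exponential series: the k-th one grows roughly
    like the power [q - gamma = q (1 - alpha) >= 3] of k!. Those of [X^(1/q) = Z^(-alpha)] are
    [k! / Gamma(1 + alpha k)], so that the series of [E exp(u X^(1/q))] converges for every u. The
    Laplace transform of X is recovered by testing [y = X^(1/q)] against [exp(- l y^q)].

    All finite gamma convolutions have total weight 1, whence bounds on their densities and on every
    derivative, whatever the rates are. Rates escaping to 0 could still leave a constant in the
    limiting exponent; this is excluded because the exponent of X vanishes at 0, X being finite. *)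

Lemma expR_taylor1 (R : realType) (u : R) :
  `|expR u - 1 - u| <= u ^+ 2 * expR `|u|.
Proof.
have h1 := expR_ge1Dx u; have h2 := expR_ge1Dx (- u).
have e0 := expR_gt0 u.
have h3 : (1 - u) * expR u <= 1.
  apply: (le_trans (ler_wpM2r (ltW e0) h2)).
  by rewrite mulrC expRxMexpNx_1.
rewrite ger0_norm; last by lra.
(* This is [h3] rearranged; bounding [expR u - 1] in the same way produces the second factor [u]. *)
have h4 : expR u - 1 - u <= u * (expR u - 1) by lra.
apply: (le_trans h4); rewrite expr2 -mulrA.
have [u0|u0] := leP 0 u.
  by rewrite ler_wpM2l // ger0_norm//; lra.
rewrite ler_nM2l// ltr0_norm//; apply: (@le_trans _ _ u); last by lra.
by rewrite -subr_ge0 -{1}(mulr1 u) -mulrBr mulr_le0 //; lra.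
Qed.

(** [(x * t) ^+ k] over the factorial of [k] is one term of the series of [expR (x * t)]. Since the
    bound is free of [t], weighted sums over arbitrary rates inherit it. *)
Lemma exprM_expRN_le (R : realType) (k : nat) (t x : R) : 0 <= t -> 0 < x ->
  t ^+ k * expR (- (x * t)) <= k`!%:R / x ^+ k.
Proof.
move=> t0 x0; rewrite expRN ler_pdivrMr ?expR_gt0// mulrAC ler_pdivlMr ?exprn_gt0//.
rewrite -exprMn mulrC -ler_pdivrMl ?ltr0n ?fact_gt0// mulrC.
have xt0 : 0 <= x * t by rewrite mulr_ge0// ltW.
rewrite (mulrC t); case: k => [|k].
  by rewrite expr0 fact0; have := expR_ge1Dx (x * t); lra.
by have := expR_ge1Dxn k xt0; lra.
Qed.

(** The image of an ultrafilter is an ultrafilter, and it lives on the compact segment [[- C, C]]. A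
    single ultrafilter thus gives limits to all bounded sequences at once, with no diagonal
    extraction. *)
Lemma ultra_cvg_bounded (R : realType) (T : Type) (U : set_system T) (u : T -> R)
  (C : R) : UltraFilter U -> (forall n, `|u n| <= C) -> exists l : R, u n @[n --> U] --> l.
Proof.
move=> UU uC.
have UF : UltraFilter (u n @[n --> U]).
  split; first exact: fmap_proper_filter.
  move=> G GF sG; apply/seteqP; split => // A GA.
  have [//|UnA] := in_ultra_setVsetC (u @^-1` A) UU.
  have GnA : G (~` A) by exact: sG.
  by have /filter_ex[x []] : G (A `&` ~` A) by exact: filterI.
have UuC : (u n @[n --> U]) `[- C, C]%classic.
  apply: (@filterS _ U _ setT); last exact: filterT.
  by move=> n _ /=; rewrite in_itv/= -ler_norml.
have := @segment_compact R (- C) C; rewrite compact_ultra.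
by move=> /(_ _ UF UuC) [l [_ ul]]; exists l.
Qed.

Section CompletelyMonotoneLimit.
Variables (R : realType) (T : Type) (U : set_system T).
Hypothesis UU : UltraFilter U.
Variables (N : T -> nat) (w t : T -> nat -> R).
Hypothesis w0 : forall n i, 0 <= w n i.
Hypothesis t0 : forall n i, 0 < t n i.
Hypothesis w1 : forall n, \sum_(i < N n) w n i = 1.

(** The [k]-th derivative in [x] of the sum of the [w n i * expR (- (x * t n i))]. *)
Let S k (x : R) n := \sum_(i < N n) w n i * ((- t n i) ^+ k * expR (- (x * t n i))).

Let norm_S_le n (c : R) (f : R -> R) :
  (forall t : R, 0 < t -> `|f t| <= c) -> `|\sum_(i < N n) w n i * f (t n i)| <= c.
Proof.
move=> fc; apply: (le_trans (ler_norm_sum _ _ _)).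
rewrite -[leRHS]mul1r -(w1 n) mulr_suml ler_sum// => i _.
by rewrite normrM ger0_norm// ler_wpM2l// fc.
Qed.

Let S_bounded k (x : R) n : 0 < x -> `|S k x n| <= k`!%:R / x ^+ k.
Proof.
move=> x0; apply: (@norm_S_le n _ (fun t => (- t) ^+ k * expR (- (x * t)))).
move=> s s0; rewrite normrM normrX normrN (gtr0_norm s0) ger0_norm ?expR_ge0//.
by rewrite exprM_expRN_le// ltW.
Qed.

(** As [h] is at most [x / 2] in absolute value, half of the decay of [expR (- (x * s))] pays for
    the growth of the remainder and the other half absorbs the powers of [s]. The bound does not
    depend on [n], so it passes to the limit. *)
Let S_taylor k (x h : R) n : 0 < x -> `|h| <= x / 2 ->
  `|S k (x + h) n - S k x n - h * S k.+1 x n|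
    <= h ^+ 2 * (k.+2`!%:R / (x / 2) ^+ k.+2).
Proof.
move=> x0 hx.
rewrite /S mulr_sumr -!sumrB.
pose f (t : R) := (- t) ^+ k * expR (- (x * t)) *
    (expR (- (h * t)) - 1 - (- (h * t))).
rewrite (eq_bigr (fun i : 'I_(N n) => w n i * f (t n i))); last first.
  by move=> i _; rewrite /f mulrDl opprD expRD exprS; ring.
apply: (@norm_S_le n _ f) => s s0.
rewrite /f !normrM normrX normrN (gtr0_norm s0) (ger0_norm (expR_ge0 _)).
apply: (@le_trans _ _ (h ^+ 2 * (s ^+ k.+2 * expR (- (x / 2 * s))))); last first.
  by rewrite ler_wpM2l ?sqr_ge0// exprM_expRN_le ?divr_gt0// ltW.
have := expR_taylor1 (- (h * s)).
rewrite normrN normrM (gtr0_norm s0) => H.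
apply: (@le_trans _ _ (s ^+ k * expR (- (x * s)) * ((- (h * s)) ^+ 2 * expR (`|h| * s)))).
  by rewrite ler_wpM2l// mulr_ge0 ?expR_ge0// exprn_ge0// ltW.
have -> : s ^+ k * expR (- (x * s)) * ((- (h * s)) ^+ 2 * expR (`|h| * s)) =
    h ^+ 2 * (s ^+ k.+2 * (expR (- (x * s)) * expR (`|h| * s))).
  by rewrite sqrrN exprMn !exprS expr0; ring.
rewrite !ler_wpM2l ?sqr_ge0 ?exprn_ge0 ?(ltW s0)//.
by rewrite -expRD ler_expR; nra.
Qed.

(** Limits along one ultrafilter exist for all orders and all points simultaneously; the Taylor
    bound, uniform in [n], shows that the limits are still successive derivatives of one another. *)
Lemma cm_ultra_limit : exists phi : nat -> R -> R,
  (forall k (x : R), 0 < x -> S k x n @[n --> U] --> phi k x) /\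
  (forall k (x : R), 0 < x -> is_derive x 1 (phi k) (phi k.+1 x)).
Proof.
have cvgS k (x : R) : exists l : R, 0 < x -> S k x n @[n --> U] --> l.
  have [x0|_] := boolP (0 < x); last by exists 0.
  have [l] := ultra_cvg_bounded UU (fun n => S_bounded k n x0).
  by move=> H; exists l.
pose phi k (x : R) : R := xget 0 [set l | 0 < x -> S k x n @[n --> U] --> l].
have Sphi k (x : R) : 0 < x -> S k x n @[n --> U] --> phi k x.
  move=> x0; have [l Hl] := cvgS k x.
  by apply: (xgetI 0 (P := [set l : R | 0 < x -> S k x n @[n --> U] --> l]) Hl).
exists phi; split => // k x x0.
pose C : R := k.+2`!%:R / (x / 2) ^+ k.+2.
have C0 : 0 <= C by rewrite divr_ge0 ?exprn_ge0 ?divr_ge0 ?(ltW x0).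
have bound (h : R) : `|h| <= x / 2 ->
    `|phi k (x + h) - phi k x - h * phi k.+1 x| <= h ^+ 2 * C.
  move=> hx; have xh0 : 0 < x + h by move: hx; rewrite ler_norml; lra.
  have c1 : (fun n => S k (x + h) n - S k x n - h * S k.+1 x n) @ U -->
      phi k (x + h) - phi k x - h * phi k.+1 x.
    apply: cvgB; first by apply: cvgB; exact: Sphi.
    by apply: cvgM; [exact: cvg_cst|exact: Sphi].
  have cl : closed [set y : R | y <= h ^+ 2 * C] by exact: closed_le.
  have nU : \forall n \near U, `|S k (x + h) n - S k x n - h * S k.+1 x n| <= h ^+ 2 * C.
    by apply: (@filterS _ U _ setT); [move=> n _; exact: S_taylor|exact: filterT].
  by apply: (@closed_cvg _ _ U _ _ _ cl nU); exact: cvg_norm.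
have key : h^-1 *: ((phi k \o shift x) (h *: 1) - phi k x) @[h --> 0^'] -->
    phi k.+1 x.
  apply/cvgrPdist_le => e e0; near=> h.
  have h0 : h != 0 by near: h; exact: nbhs_dnbhs_neq.
  have hx : `|h| <= x / 2.
    by near: h; apply: dnbhs0_le; rewrite divr_gt0.
  have he : `|h| <= e / (C + 1).
    by near: h; apply: dnbhs0_le; rewrite divr_gt0// ltr_wpDl.
  rewrite /= /GRing.scale/= mulr1 (addrC h).
  rewrite -[X in X - _](mulKf h0) -mulrBr normrM normfV ler_pdivrMl ?normr_gt0//.
  rewrite distrC; apply: (le_trans (bound h hx)).
  rewrite -[h ^+ 2]ger0_norm ?sqr_ge0// normrX expr2 -mulrA ler_wpM2l//.
  move: he; rewrite ler_pdivlMr ?ltr_wpDl// => he.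
  by apply: le_trans he; rewrite ler_wpM2l//; lra.
have dk : derivable (phi k) x 1 by apply/cvg_ex; exists (phi k.+1 x).
by apply: DeriveDef => //; exact/cvg_lim.
Unshelve. all: by end_near. Qed.
End CompletelyMonotoneLimit.

(** * Tonelli's theorem on rectangles and Frullani's integral *)

Lemma fubini_tonelli_on (d1 d2 : measure_display) (T1 : measurableType d1)
    (T2 : measurableType d2) (R : realType)
    (m1 : {sigma_finite_measure set T1 -> \bar R})
    (m2 : {sigma_finite_measure set T2 -> \bar R}) (D1 : set T1) (D2 : set T2)
    (f : T1 * T2 -> \bar R) :
  measurable D1 -> measurable D2 -> @measurable_fun _ _ (T1 * T2)%type (\bar R) (D1 `*` D2) f ->
  (forall x y, D1 x -> D2 y -> (0 <= f (x, y))%E) ->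
  (\int[m1]_(x in D1) \int[m2]_(y in D2) f (x, y) =
   \int[m2]_(y in D2) \int[m1]_(x in D1) f (x, y))%E.
Proof.
move=> mD1 mD2 mf f0.
pose g := f \_ (D1 `*` D2).
have mg : @measurable_fun _ _ (T1 * T2)%type (\bar R) setT g.
  by apply/(measurable_restrictT _ _).1 => //; exact: measurableX.
have g0 z : (0 <= g z)%E.
  rewrite /g patchE; case: ifPn => //; case: z => x y.
  by rewrite inE => -[/= ? ?]; exact: f0.
have E1 : (\int[m1]_(x in D1) \int[m2]_(y in D2) f (x, y) =
    \int[m1]_x \int[m2]_y g (x, y))%E.
  rewrite [LHS]integral_mkcond; apply: eq_integral => x _.
  rewrite patchE; case: ifPn => [xD|xD].
    rewrite [LHS]integral_mkcond; apply: eq_integral => y _.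
    by rewrite /g !patchE in_setX xD.
  rewrite (eq_integral (cst 0%E)) ?integral0// => y _.
  by rewrite /g patchE in_setX (negbTE xD).
have E2 : (\int[m2]_(y in D2) \int[m1]_(x in D1) f (x, y) =
    \int[m2]_y \int[m1]_x g (x, y))%E.
  rewrite [LHS]integral_mkcond; apply: eq_integral => y _.
  rewrite patchE; case: ifPn => [yD|yD].
    rewrite [LHS]integral_mkcond; apply: eq_integral => x _.
    by rewrite /g !patchE in_setX yD andbT.
  rewrite (eq_integral (cst 0%E)) ?integral0// => x _.
  by rewrite /g patchE in_setX (negbTE yD) andbF.
by rewrite E1 E2; exact: fubini_tonelli.
Qed.

Lemma is_derive_expRN (R : realType) (c x : R) :
  is_derive x 1 (fun x => expR (- (x * c))) (- c * expR (- (x * c))).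
Proof.
apply: is_derive_eq; rewrite !scaler0 add0r/= /GRing.scale/= mulr1; ring.
Qed.

Lemma cvg_expRN (R : realType) (c : R) : 0 < c ->
  expR (- (x * c)) @[x --> +oo] --> (0 : R).
Proof.
move=> c0.
have h : x * c @[x --> +oo%R] --> +oo%R by apply: gt0_cvgMly => //; exact: cvg_id.
exact: (cvg_comp _ _ h (@cvgr_expR R)).
Qed.

Lemma integral_expRN (R : realType) (c : R) : 0 < c ->
  (\int[@lebesgue_measure R]_(x in `]0%R, +oo[) (expR (- (x * c)))%:E = (c^-1)%:E)%E.
Proof.
move=> c0.
have cE : continuous (fun x : R => expR (- (x * c))).
  by move=> x; apply: differentiable_continuous; apply/derivable1_diffP;
    case: (is_derive_expRN c x).
rewrite integral_itv_obnd_cbnd; last first.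
  apply/measurable_EFinP; apply: measurable_funTS.
  exact: continuous_measurable_fun.
rewrite (@ge0_continuous_FTC2y _ _ (fun x => - c^-1 * expR (- (x * c))) 0 0).
- by rewrite mul0r oppr0 expR0 mulr1 sub0e EFinN oppeK.
- by move=> x _; exact: expR_ge0.
- exact: continuous_subspaceT.
- rewrite -(mulr0 (- c^-1)).
  by apply: cvgM; [exact: cvg_cst|exact: cvg_expRN].
- by move=> x _; apply: derivableM; [exact: derivable_cst|case: (is_derive_expRN c x)].
- apply: cvg_at_right_filter; apply: cvgM; first exact: cvg_cst.
  exact: cE.
- move=> x _; rewrite derive1E deriveM; [|exact: derivable_cst|by case: (is_derive_expRN c x)].
  have [_ ->] := is_derive_expRN c x.
  rewrite derive_cst /GRing.scale/= mulr0 addr0.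
  by rewrite mulrA mulrNN mulVf ?mul1r// gt_eqF.
Qed.

Lemma is_derive_continuous (R : realType) (F : R -> R) (x df : R) :
  is_derive x 1 F df -> {for x, continuous F}.
Proof.
by case=> dF _; apply: differentiable_continuous; exact/derivable1_diffP.
Qed.

Lemma continuous_FTC2_is_derive (R : realType) (F f : R -> R) (a b : R) : a < b ->
  (forall x, a <= x <= b -> is_derive x 1 F (f x)) ->
  (forall x, a <= x <= b -> {for x, continuous f}) ->
  (\int[@lebesgue_measure R]_(x in `[a, b]) (f x)%:E = (F b - F a)%:E)%E.
Proof.
move=> ab dF cf.
have cF x : a <= x <= b -> {for x, continuous F}.
  by move=> xab; exact: is_derive_continuous (dF _ xab).
rewrite (@continuous_FTC2 _ _ F _ _ ab) ?EFinB//.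
- by apply: continuous_in_subspaceT => x; rewrite inE/= in_itv/=; exact: cf.
- split.
  + by move=> x; rewrite in_itv/= => /andP[? ?]; case: (dF x _) => //; rewrite !ltW.
  + by apply: cvg_at_right_filter; apply: cF; rewrite lexx ltW.
  + by apply: cvg_at_left_filter; apply: cF; rewrite lexx ltW.
- move=> x; rewrite in_itv/= => /andP[? ?]; rewrite derive1E.
  by case: (dF x _) => //; rewrite !ltW.
Qed.

Lemma integral_expRN_segment (R : realType) (x t m l : R) : 0 < x -> m < l ->
  (\int[@lebesgue_measure R]_(u in `[m, l]) (expR (- (x * (u + t))))%:E =
   ((expR (- (m * x)) - expR (- (l * x))) / x * expR (- (x * t)))%:E)%E.
Proof.
move=> x0 ml; have xn0 : x != 0 by rewrite gt_eqF.
pose f (u : R) : R := expR (- (x * (u + t))); pose F (u : R) : R := - x^-1 * f u.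
have df (u : R) : is_derive u 1 f (- x * f u).
  by apply: is_derive_eq; rewrite /GRing.scale/= /f; ring.
have dF (u : R) : m <= u <= l -> is_derive u 1 F (f u).
  by move=> _; apply: is_derive_eq; rewrite /GRing.scale/=; field; exact: xn0.
have cf (u : R) : m <= u <= l -> {for u, continuous f}.
  by move=> _; exact: is_derive_continuous (df u).
rewrite (continuous_FTC2_is_derive ml dF cf) /F /f.
by rewrite !mulrDr !opprD !expRD (mulrC x m) (mulrC x l); congr EFin; ring.
Qed.

Lemma integral_invD_segment (R : realType) (t m l : R) : 0 < t -> 0 < m -> m < l ->
  (\int[@lebesgue_measure R]_(u in `[m, l]) ((u + t)^-1)%:E =
   (ln ((l + t) / (m + t)))%:E)%E.
Proof.
move=> t0 m0 ml.
have pos (u : R) : m <= u <= l -> 0 < u + t by move=> /andP[? _]; lra.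
have dF (u : R) : m <= u <= l -> is_derive u 1 (fun u : R => ln (u + t)) (u + t)^-1.
  move=> /pos ut; rewrite -[_^-1]mulr1.
  apply: (@is_derive1_comp _ (@ln R) (fun u => u + t)); first exact: is_derive1_ln.
  by apply: is_derive_eq; rewrite addr0.
have cf (u : R) : m <= u <= l -> {for u, continuous (fun u : R => (u + t)^-1)}.
  move=> /pos ut; apply: cvgV; first by rewrite gt_eqF.
  by apply: cvgD; [exact: cvg_id|exact: cvg_cst].
rewrite (continuous_FTC2_is_derive ml dF cf).
by rewrite ln_div// posrE pos// lexx ltW.
Qed.

Lemma measurable_expRN_prod (R : realType) (t : R) (D : set (R * R)) :
  @measurable_fun _ _ (R * R)%type (\bar R) D
    (fun z : R * R => (expR (- (z.1 * (z.2 + t))))%:E).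
Proof.
apply: measurable_funTS; apply/measurable_EFinP; apply: measurableT_comp => //.
apply: measurableT_comp => //; apply: measurable_funM => //.
by apply: measurable_funD => //; exact: measurable_snd.
Qed.

(** The quotient by [x] is the integral of [expR (- (x * u))] over [u] in [[m, l]]; exchanging the
    integrals leaves that of [1 / (u + t)]. *)
Lemma frullani_expR (R : realType) (l m t : R) : 0 < m -> m < l -> 0 < t ->
  (\int[@lebesgue_measure R]_(x in `]0%R, +oo[)
     ((expR (- (m * x)) - expR (- (l * x))) / x * expR (- (x * t)))%:E =
   (ln ((l + t) / (m + t)))%:E)%E.
Proof.
move=> m0 ml t0.
transitivity (\int[@lebesgue_measure R]_(x in `]0%R, +oo[)
    \int[@lebesgue_measure R]_(u in `[m, l]) (expR (- (x * (u + t))))%:E)%E.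
  apply: eq_integral => x; rewrite inE/= in_itv/= andbT => x0.
  by rewrite integral_expRN_segment.
have /= -> := @fubini_tonelli_on _ _ _ _ _ (@lebesgue_measure R)
    (@lebesgue_measure R) `]0%R, +oo[%classic `[m, l]%classic _
    (measurable_itv _) (measurable_itv _) (@measurable_expRN_prod R t _).
  2: by move=> x y _ _; rewrite lee_fin expR_ge0.
rewrite -integral_invD_segment//; apply: eq_integral => u.
rewrite inE/= in_itv/= => /andP[mu _]; rewrite integral_expRN//; lra.
Qed.

Lemma derive1n_is_derive (R : realType) (phi : nat -> R -> R) (D : set R) :
  open D -> (forall k x, D x -> is_derive x 1 (phi k) (phi k.+1 x)) ->
  forall n x, D x -> derive1n n (phi 0) x = phi n x.
Proof.
move=> oD dphi; elim=> // n IH x Dx; rewrite derive1nS derive1E.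
have [_ <-] := dphi n x Dx; apply: near_eq_derive => //.
by near=> y; apply: IH; near: y; exact: open_nbhs_nbhs.
Unshelve. all: by end_near. Qed.

(** [derive1n] iterates a derivative of functions on the whole line, while [phi k] is controlled for
    positive arguments only; the half-line being open, the two agree near each of its points. *)
Lemma cm_of_derive_sequence (R : realType) (phi : nat -> R -> R) :
  (forall k (x : R), 0 < x -> is_derive x 1 (phi k) (phi k.+1 x)) ->
  (forall k (x : R), 0 < x -> 0 <= (-1) ^+ k * phi k x) ->
  completely_monotone (phi 0).
Proof.
move=> dphi sphi.
have oD : open [set x : R | 0 < x] by exact: open_gt.
have E := derive1n_is_derive oD dphi.
split=> n x x0; last by rewrite E// sphi.
have [dx _] := dphi n x x0.
apply: near_eq_derivable dx => //.
by near=> y; rewrite E//=; near: y; exact: (open_nbhs_nbhs (conj oD x0)).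
Unshelve. all: by end_near. Qed.

Lemma positive_rat_enum (R : realType) : exists q : nat -> R,
  (forall j, 0 < q j) /\ forall a b : R, 0 <= a -> a < b -> exists j, a < q j < b.
Proof.
pose q j : R := if unpickle j is Some r then if 0 < r :> rat then ratr r else 1 else 1.
exists q; split=> [j|a b a0 ab].
  by rewrite /q; case: unpickle => // r; case: ifPn => // r0; rewrite ltr0q.
have [r rab] := rat_in_itvoo ab; exists (pickle r); rewrite /q pickleK.
have r0 : 0 < r.
  by rewrite -(@ltr0q R) (le_lt_trans a0)//; move: rab; rewrite in_itv/= => /andP[].
by rewrite r0; move: rab; rewrite in_itv/=.
Qed.

(* Monotonicity upgrades convergence on a countable dense set to convergence
   everywhere, so an ultrafilter limit is a genuine subsequential limit. *)
Lemma ultra_nonincreasing_subseq (R : realType) (U : set_system nat)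
    (f : nat -> R -> R) (g : R -> R) :
  UltraFilter U -> \oo `<=` U ->
  (forall n x y, 0 < x -> x <= y -> f n y <= f n x) ->
  (forall x, 0 < x -> f n x @[n --> U] --> g x) ->
  (forall x, 0 < x -> {for x, continuous g}) ->
  exists s : nat -> nat, (forall m, (m <= s m)%N) /\
    forall x, 0 < x -> f (s m) x @[m --> \oo] --> g x.
Proof.
move=> UU oU fmono fg cg.
have [q [q0 qd]] := positive_rat_enum R.
(* Both conditions define members of [U], as only finitely many points of the dense set are tested
   at stage [m]; their intersection is therefore not empty. *)
have ex m : exists n, (m <= n)%N /\
    forall j, (j <= m)%N -> `|g (q j) - f n (q j)| <= m.+1%:R^-1.
  have H1 : U [set n | (m <= n)%N] by apply: oU; exact: nbhs_infty_ge.
  have H2 : U [set n | forall j : 'I_m.+1, `|g (q j) - f n (q j)| <= m.+1%:R^-1].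
    apply: filter_forall => j.
    by have /cvgrPdist_le := fg _ (q0 j); apply; rewrite invr_gt0 ltr0n.
  have [n [/= h1 h2]] := filter_ex (filterI H1 H2 : U _).
  exists n; split => // j jm; have jm1 : (j < m.+1)%N by [].
  exact: (h2 (Ordinal jm1)).
have [s hs] := choice ex.
exists s; split=> [m|x x0]; first by case: (hs m).
have fq j : f (s m) (q j) @[m --> \oo] --> g (q j).
  apply/cvgrPdist_le => e e0; near=> m.
  apply: (le_trans (proj2 (hs m) j _)); first by near: m; exact: nbhs_infty_ge.
  by rewrite ltW//; near: m; exact: (near_infty_natSinv_lt (PosNum e0)).
apply/cvgrPdist_le => e e0.
have e2 : 0 < e / 2 by rewrite divr_gt0.
have /cvgrPdist_lt/(_ _ e2) : g y @[y --> x] --> g x by exact: cg.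
move=> /nbhs_ballP[d /= d0 hd].
(* Two points of the dense set enclose [x], so closely that [g] there differs from [g x] by less
   than [e / 2]; monotonicity traps [f (s m) x] between the values at these points. *)
have [j1 /andP[j1a j1b]] : exists j, Num.max 0 (x - d) < q j < x.
  by apply: qd; rewrite ?le_max ?lexx// gt_max x0/= ltrBlDr ltrDl.
have [j2 /andP[j2a j2b]] : exists j, x < q j < x + d.
  by apply: qd; rewrite ?ltW// ltrDl.
have g1 : `|g x - g (q j1)| < e / 2.
  apply: hd; rewrite /ball/= ger0_norm ?subr_ge0 ?ltW//.
  by move: j1a; rewrite gt_max => /andP[_]; lra.
have g2 : `|g x - g (q j2)| < e / 2.
  by apply: hd; rewrite /ball/= ltr0_norm ?subr_lt0//; lra.
near=> m.
have f1 : `|g (q j1) - f (s m) (q j1)| < e / 2.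
  by near: m; have /cvgrPdist_lt := fq j1; exact.
have f2 : `|g (q j2) - f (s m) (q j2)| < e / 2.
  by near: m; have /cvgrPdist_lt := fq j2; exact.
have m1 := fmono (s m) _ _ (q0 j1) (ltW j1b).
have m2 := fmono (s m) _ _ x0 (ltW j2a).
move: g1 g2 f1 f2; rewrite !ltr_norml ler_norml.
by move=> /andP[? ?] /andP[? ?] /andP[? ?] /andP[? ?]; apply/andP; split; lra.
Unshelve. all: by end_near. Qed.

(** * Limits of Lévy densities *)

Section LevyMeasureLimit.
Variables (R : realType) (N : nat -> nat) (w t : nat -> nat -> R).
Hypothesis w0 : forall n i, 0 <= w n i.
Hypothesis t0 : forall n i, 0 < t n i.
Hypothesis w1 : forall n, \sum_(i < N n) w n i = 1.

Let mu := @lebesgue_measure R.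
Let S n (x : R) := \sum_(i < N n) w n i * expR (- (x * t n i)).
Let k (m l x : R) := (expR (- (m * x)) - expR (- (l * x))) / x.

Let k_ge0 (m l x : R) : m <= l -> 0 < x -> 0 <= k m l x.
Proof.
move=> ml x0; rewrite divr_ge0 ?(ltW x0)// subr_ge0 ler_expR lerN2.
by rewrite ler_wpM2r// ltW.
Qed.

(** The inequality [1 - expR (- y) <= y] at [y = (l - m) * x] cancels the singularity [1 / x]. For
    [0 < m] the right-hand side is integrable on the half-line and serves as the dominating
    function. *)
Let k_le (m l x : R) : m <= l -> 0 < x -> k m l x <= (l - m) * expR (- (x * m)).
Proof.
move=> ml x0; rewrite ler_pdivrMr//.
have -> : - (l * x) = - (m * x) + - ((l - m) * x) by ring.
rewrite expRD (mulrC x m); have := expR_ge1Dx (- ((l - m) * x)).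
by have := expR_gt0 (- (m * x)); nra.
Qed.

Let measurable_k (m l : R) : measurable_fun (`]0%R, +oo[%classic : set R) (k m l).
Proof.
apply: measurable_funM; last first.
  apply: open_continuous_measurable_fun => [|x]; first exact: interval_open.
  rewrite inE/= in_itv/= andbT => x0.
  by apply: cvgV; [rewrite gt_eqF|exact: cvg_id].
apply: measurable_funTS.
by apply: measurable_funB; apply: measurableT_comp => //; apply: measurableT_comp => //;
  exact: measurable_funM.
Qed.

Let S_ge0 n (x : R) : 0 <= S n x.
Proof. by apply: sumr_ge0 => i _; rewrite mulr_ge0// expR_ge0. Qed.

Let S_le1 n (x : R) : 0 < x -> S n x <= 1.
Proof.
move=> x0; rewrite -(w1 n) ler_sum// => i _; rewrite ler_piMr//.
by rewrite expR_le1 oppr_le0 mulr_ge0// ltW.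
Qed.

Let integral_kS n (m l : R) : 0 < m -> m < l ->
  (\int[mu]_(x in `]0%R, +oo[) (k m l x * S n x)%:E =
   (\sum_(i < N n) w n i * ln (1 + l / t n i)
    - \sum_(i < N n) w n i * ln (1 + m / t n i))%:E)%E.
Proof.
move=> m0 ml.
rewrite (eq_integral (fun x : measurableTypeR R => (\sum_(i < N n)
    (w n i)%:E * (k m l x * expR (- (x * t n i)))%:E)%E)); last first.
  move=> x _; rewrite /S mulr_sumr -sumEFin; apply: eq_bigr => i _.
  by rewrite -EFinM mulrCA.
have mE (i : 'I_(N n)) : measurable_fun (`]0%R, +oo[%classic : set R)
    (fun x : R => (k m l x * expR (- (x * t n i)))%:E).
  apply/measurable_EFinP; apply: measurable_funM => //.
  apply: measurableT_comp => //; apply: measurableT_comp => //.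
  exact: measurable_funM.
have kE0 (i : 'I_(N n)) x : `]0%R, +oo[%classic x ->
    (0 <= (k m l x * expR (- (x * t n i)))%:E)%E.
  rewrite /= in_itv/= andbT => x0.
  by rewrite lee_fin mulr_ge0 ?expR_ge0// k_ge0// ltW.
rewrite ge0_integral_sum//; last 2 first.
  by move=> i; apply: measurable_funeM; exact: mE.
  by move=> i x x0; rewrite mule_ge0 ?lee_fin//; exact: kE0.
rewrite -sumrB -sumEFin; apply: eq_bigr => i _.
rewrite ge0_integralZl_EFin//; last 2 first.
  by move=> x x0; exact: (kE0 i).
  exact: mE.
have l0 := lt_trans m0 ml; have ti := t0 n i.
rewrite frullani_expR// -mulrBr -ln_div ?posrE ?addr_gt0 ?divr_gt0//.
by rewrite -EFinM; congr (_ * ln _)%:E; field; rewrite !gt_eqF//= addr_gt0.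
Qed.

(* By Frullani's formula [S n x / x] integrates [expR (- m x) - expR (- l x)] to the
   difference of the exponents at l and m, and m tends to 0 after the limit in n. *)
Lemma levy_density_limit (A : R -> R) :
  (forall l, 0 < l -> \sum_(i < N n) w n i * ln (1 + l / t n i) @[n --> \oo] --> A l) ->
  A l @[l --> 0^'+] --> 0 ->
  exists phi : R -> R, completely_monotone phi /\
    forall l, 0 < l -> (\int[mu]_(x in `]0%R, +oo[)
      ((1 - expR (- l * x)) * (phi x / x))%:E = (A l)%:E)%E.
Proof.
move=> cA A0.
(* An ultrafilter finer than convergence to infinity supplies the candidate density together with
   its derivatives. *)
have [U [UU oU]] := ultraFilterLemma (@eventually_filter : ProperFilter \oo).
have [phi [cphi dphi]] := cm_ultra_limit UU w0 t0 w1.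
have phis j (x : R) : 0 < x -> 0 <= (-1) ^+ j * phi j x.
  move=> x0.
  have c1 : (-1) ^+ j * (\sum_(i < N n) w n i * ((- t n i) ^+ j * expR (- (x * t n i))))
      @[n --> U] --> (-1) ^+ j * phi j x.
    by apply: cvgM; [exact: cvg_cst|exact: cphi].
  have cl : closed [set y : R | 0 <= y] by exact: closed_ge.
  apply: (@closed_cvg _ _ U _ _ _ cl _ _ c1).
  apply: (@filterS _ U _ setT); last exact: filterT.
  move=> n _ /=; rewrite mulr_sumr sumr_ge0// => i _.
  rewrite mulrCA mulr_ge0// mulrA -exprMn mulN1r opprK.
  by rewrite mulr_ge0 ?expR_ge0 ?exprn_ge0// ltW.
have cS (x : R) : 0 < x -> S n x @[n --> U] --> phi 0%N x.
  move=> x0; have := cphi 0%N x x0; rewrite /S.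
  by under eq_fun do under eq_bigr do rewrite expr0 mul1r.
have phi0 (x : R) : 0 < x -> 0 <= phi 0%N x.
  by move=> x0; have := phis 0%N x x0; rewrite expr0 mul1r.
have cont (x : R) : 0 < x -> {for x, continuous (phi 0%N)}.
  by move=> x0; exact: is_derive_continuous (dphi 0%N x x0).
have Smono n (x y : R) : 0 < x -> x <= y -> S n y <= S n x.
  move=> x0 xy; rewrite ler_sum// => i _; rewrite ler_wpM2l// ler_expR lerN2.
  by rewrite ler_wpM2r// ltW.
(* Dominated convergence is a statement about sequences, hence the return from [U] to a sequence of
   indices. *)
have [s [sm Ss]] := ultra_nonincreasing_subseq UU oU Smono cS cont.
have s_oo : s m @[m --> \oo] --> \oo.
  move=> B [M _ HM]; exists M => // m Mm; apply: HM => /=.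
  exact: leq_trans Mm (sm m).
exists (phi 0%N); split; first exact: cm_of_derive_sequence.
have mphi : measurable_fun (`]0%R, +oo[%classic : set R) (phi 0%N).
  apply: open_continuous_measurable_fun => [|x]; first exact: interval_open.
  by rewrite inE/= in_itv/= andbT; exact: cont.
have diff (m l : R) : 0 < m -> m < l ->
    (\int[mu]_(x in `]0%R, +oo[) (k m l x * phi 0%N x)%:E = (A l - A m)%:E)%E.
  move=> m0 ml; have l0 := lt_trans m0 ml.
  have mS n (D : set R) : measurable_fun D (S n).
    apply: measurable_funTS; apply: measurable_sum => i.
    apply: measurable_funM => //; apply: measurableT_comp => //.
    by apply: measurableT_comp => //; exact: measurable_funM.
  have mf1 j : measurable_fun (`]0%R, +oo[%classic : set R)
      (fun x => (k m l x * S (s j) x)%:E).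
    by apply/measurable_EFinP; apply: measurable_funM.
  have mf2 : measurable_fun (`]0%R, +oo[%classic : set R)
      (fun x => (k m l x * phi 0%N x)%:E).
    by apply/measurable_EFinP; apply: measurable_funM.
  have cf : {ae mu, forall x, `]0%R, +oo[%classic x ->
      (k m l x * S (s j) x)%:E @[j --> \oo] --> (k m l x * phi 0%N x)%:E}.
    apply: aeW => x; rewrite /= in_itv/= andbT => x0.
    apply: cvg_EFin; first exact: nearW.
    by apply: cvgM; [exact: cvg_cst|exact: Ss].
  have ig : mu.-integrable `]0%R, +oo[ (fun x => ((l - m) * expR (- (x * m)))%:E).
    have mE : measurable_fun (`]0%R, +oo[%classic : set R) (fun x => expR (- (x * m))).
      apply: measurable_funTS.
      apply: measurableT_comp => //; apply: measurableT_comp => //.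
      exact: measurable_funM.
    apply/integrableP; split.
      by apply/measurable_EFinP; apply: measurable_funM.
    rewrite (eq_integral (fun x : measurableTypeR R =>
        ((l - m)%:E * (expR (- (x * m)))%:E)%E)); last first.
      by move=> x _; rewrite gee0_abs ?EFinM// lee_fin mulr_ge0 ?expR_ge0// subr_ge0 ltW.
    rewrite ge0_integralZl_EFin//; first by rewrite integral_expRN// -EFinM ltry.
    - exact/measurable_EFinP.
    - by rewrite subr_ge0 ltW.
  have dom : {ae mu, forall x j, `]0%R, +oo[%classic x ->
      (`|(k m l x * S (s j) x)%:E| <= ((l - m) * expR (- (x * m)))%:E)%E}.
    apply: aeW => x j; rewrite /= in_itv/= andbT => x0.
    rewrite lee_fin ger0_norm; last by rewrite mulr_ge0// k_ge0// ltW.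
    apply: (le_trans _ (k_le (ltW ml) x0)).
    by rewrite ler_piMr ?S_le1// k_ge0// ltW.
  have [_ _ H] := @dominated_convergence _ _ _ mu _ (measurable_itv _) _ _ _ mf1 mf2 cf ig dom.
  have H2 : (\int[mu]_(x in `]0%R, +oo[) (k m l x * S (s j) x)%:E)%E @[j --> \oo]
      --> (A l - A m)%:E.
    under eq_fun do rewrite integral_kS//.
    apply: cvg_EFin; first exact: nearW.
    exact: (cvg_comp _ _ s_oo (cvgB (cA l l0) (cA m m0))).
  exact: (cvg_unique _ H H2).
move=> l l0.
(* The shift to [n.+2] keeps [m n] strictly below [l], as [diff] demands. *)
pose m n : R := l / n.+2%:R.
have m0 n : 0 < m n by rewrite divr_gt0.
have ml n : m n < l by rewrite ltr_pdivrMr// ltr_pMr// ltr1n.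
have mono n1 n2 : (n1 <= n2)%N -> m n2 <= m n1.
  by move=> n12; rewrite ler_pM2l// lef_pV2 ?posrE// ler_nat.
have mcvg0 : m n @[n --> \oo] --> 0.
  rewrite -(mulr0 l); apply: cvgM; first exact: cvg_cst.
  by have := @cvg_harmonic R; rewrite -cvg_shiftS.
have lhs : (\int[mu]_(x in `]0%R, +oo[) (k (m n) l x * phi 0%N x)%:E)%E @[n --> \oo]
    --> (A l)%:E.
  under eq_fun do rewrite diff//.
  apply: cvg_EFin; first exact: nearW.
  rewrite -[X in _ --> X]subr0; apply: cvgB; first exact: cvg_cst.
  by have /cvg_at_rightP := A0; apply; split.
have mg n : measurable_fun (`]0%R, +oo[%classic : set R)
    (fun x => (k (m n) l x * phi 0%N x)%:E).
  by apply/measurable_EFinP; apply: measurable_funM.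
have g0 n x : `]0%R, +oo[%classic x -> (0 <= (k (m n) l x * phi 0%N x)%:E)%E.
  rewrite /= in_itv/= andbT => x0; rewrite lee_fin; apply: mulr_ge0; last exact: phi0.
  by apply: k_ge0 => //; exact: ltW.
(* Lowering [m] raises the kernel, so this second limit is a monotone one. *)
have gmono x : `]0%R, +oo[%classic x ->
    {homo (fun n => (k (m n) l x * phi 0%N x)%:E) : n1 n2 / (n1 <= n2)%N >-> (n1 <= n2)%E}.
  rewrite /= in_itv/= andbT => x0 n1 n2 n12; rewrite lee_fin ler_wpM2r ?phi0//.
  rewrite ler_pM2r ?invr_gt0// lerB// ler_expR lerN2 ler_wpM2r ?mono//.
  exact: ltW.
have rhs := @cvg_monotone_convergence _ _ _ mu _ (measurable_itv _) _ mg g0 gmono.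
rewrite -(cvg_unique _ rhs lhs)//; apply: eq_integral => x.
rewrite inE/= in_itv/= andbT => x0; apply/esym/cvg_lim => //.
apply: cvg_EFin; first exact: nearW.
rewrite mulrA mulrAC mulNr /k.
apply: cvgM; last exact: cvg_cst.
apply: cvgM; last exact: cvg_cst.
apply: cvgB; last exact: cvg_cst.
have mx0 : - (m n * x) @[n --> \oo] --> - (0 * x).
  by apply: cvgN; apply: cvgM; [exact: mcvg0|exact: cvg_cst].
rewrite mul0r oppr0 in mx0.
rewrite -(@expR0 R).
exact: (continuous_cvg _ (@continuous_expR R 0) mx0).
Qed.
End LevyMeasureLimit.

(** * Log-concave mixtures of exponential laws *)

Section PartialFractions.
Variables (R : realType) (N : nat) (p t : nat -> R).
Hypothesis p0 : forall i, (i <= N)%N -> 0 < p i.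
Hypothesis t0 : forall i, 0 < t i.
Hypothesis tS : forall i j, (i < j)%N -> t i < t j.

(** The numerator of [F] over the common denominator of its terms: the zeros of [F] become roots of
    a polynomial and can be counted by degree. *)
Let Q : {poly R} := \sum_(i < N.+1) (p i * t i) *:
  \prod_(j < N.+1 | j != i) ((t j)%:P - 'X).
Let F (s : R) := \sum_(i < N.+1) p i * t i / (t i - s).

Let Qt (i : 'I_N.+1) : Q.[t i] = p i * t i * \prod_(j < N.+1 | j != i) (t j - t i).
Proof.
rewrite /Q horner_sum (bigD1 i)//= [X in _ + X]big1 ?addr0 => [|j ji].
  by rewrite hornerZ horner_prod; congr (_ * _); apply: eq_bigr => j _; rewrite !hornerE.
rewrite hornerZ horner_prod (bigD1 i) 1?eq_sym//=.
by rewrite hornerD hornerN hornerC hornerX subrr mul0r mulr0.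
Qed.

Let QF s : (forall i : 'I_N.+1, s != t i) -> Q.[s] = F s * \prod_(j < N.+1) (t j - s).
Proof.
move=> st; rewrite /Q horner_sum /F mulr_suml; apply: eq_bigr => i _.
rewrite hornerZ horner_prod [X in _ = _ * X](bigD1 i)//= mulrA divfK; last by rewrite subr_eq0 eq_sym.
congr (_ * _); apply: eq_bigr => j _.
by rewrite hornerD hornerN hornerC hornerX.
Qed.

(** At a node only one summand of [Q] survives. Every third node lies on the same side of [t i] and
    of [t i.+1], so the two products differ in sign only through the factor joining these two
    nodes. *)
Let sign_change (i : nat) : (i < N)%N -> Q.[t i] * Q.[t i.+1] < 0.
Proof.
move=> iN.
have i1 : (i < N.+1)%N by exact: ltnW.
pose a := Ordinal i1; pose b : 'I_N.+1 := Ordinal (iN : (i.+1 < N.+1)%N).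
have ab : a != b by rewrite -val_eqE/= neq_ltn ltnSn.
rewrite (Qt a) (Qt b) (bigD1 b) 1?eq_sym//= [X in _ * (_ * X)](bigD1 a)//=.
set A := \prod_(j < _ | _) _; set B := \prod_(j < _ | _) _.
have AB : 0 < A * B.
  rewrite /A /B [X in _ * X](eq_bigl (fun j => (j != a) && (j != b))); last first.
    by move=> j; rewrite andbC.
  rewrite -big_split/=; apply: prodr_gt0 => j /andP[ja jb].
  have [jlt|jgt|jeq] := ltngtP j i.
  - have h1 := tS jlt; have h2 := tS (ltn_trans jlt (ltnSn i)); nra.
  - have jgt1 : (i.+1 < j)%N by rewrite ltn_neqAle jgt andbT eq_sym -val_eqE/= in jb *.
    have h1 := tS jgt; have h2 := tS jgt1; nra.
  - by move: ja; rewrite -val_eqE/= jeq eqxx.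
have pa : 0 < p i * t i by rewrite mulr_gt0// p0// ltnW.
have pb : 0 < p i.+1 * t i.+1 by rewrite mulr_gt0// p0.
have h := tS (ltnSn i).
have -> : p i * t i * ((t i.+1 - t i) * A) * (p i.+1 * t i.+1 * ((t i - t i.+1) * B)) =
  - ((p i * t i) * (p i.+1 * t i.+1) * (A * B) * (t i.+1 - t i) ^+ 2) by ring.
rewrite oppr_lt0; apply: mulr_gt0; last by rewrite exprn_gt0// subr_gt0.
by apply: mulr_gt0; [exact: mulr_gt0|exact: AB].
Qed.

Let root_between i : (i < N)%N -> exists b, t i < b < t i.+1 /\ root Q b.
Proof.
move=> iN; have h := sign_change iN; have hlt := tS (ltnSn i).
have [b bi rb] := poly_ivtoo (ltW hlt) h.
by exists b; split=> //; move: bi; rewrite in_itv.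
Qed.

Let size_Q : (size Q <= N.+1)%N.
Proof.
apply: (leq_trans (size_sum _ _ _)); apply/bigmax_leqP => i _.
apply: (leq_trans (size_scale_leq _ _)).
apply: (leq_trans (size_poly_prod_leq _ _)).
rewrite (eq_bigr (fun=> 2%N)); last first.
  by move=> j _; rewrite -opprB size_polyN size_XsubC.
rewrite sum_nat_const muln2 -addnn -addSn addnK.
by rewrite cardC1 card_ord.
Qed.

(** The intermediate value theorem puts a root of [Q] in each of the [N] gaps, and the degree of [Q]
    is at most [N]: these are all the roots, which factors [Q] completely. *)
Lemma partial_fraction_roots : exists b : nat -> R,
  [/\ forall i, (i < N)%N -> t i < b i < t i.+1,
      forall i, (i < N)%N -> F (b i) = 0 &
      forall l, 0 < l -> F (- l) / \sum_(i < N.+1) p i =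
        \prod_(i < N) (1 + l / b i) / \prod_(i < N.+1) (1 + l / t i)].
Proof.
have ex i : exists b, (i < N)%N -> t i < b < t i.+1 /\ root Q b.
  have [iN|_] := boolP (i < N)%N; last by exists 0.
  by have [b] := root_between iN; exists b.
have [b hb] := choice ex.
have bt i : (i < N)%N -> t i < b i < t i.+1 by move=> /hb[].
have bnt i (j : 'I_N.+1) : (i < N)%N -> b i != t j.
  move=> /bt /andP[h1 h2]; have [ji|ij] := leqP j i.
    rewrite gt_eqF//; move: ji; rewrite leq_eqVlt => /predU1P[->//|/tS h].
    exact: lt_trans h h1.
  rewrite lt_eqF//; move: ij; rewrite leq_eqVlt => /predU1P[<-//|/tS h].
  exact: lt_trans h2 h.
have bpos i : (i < N)%N -> 0 < b i.
  by move=> /bt /andP[h1 _]; exact: lt_trans h1.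
have bmono i j : (i < j)%N -> (j < N)%N -> b i < b j.
  move=> ij jN; have /andP[_ h1] := bt _ (ltn_trans ij jN).
  have /andP[h2 _] := bt _ jN; apply: (lt_trans h1); apply: le_lt_trans h2.
  by move: ij; rewrite leq_eqVlt => /predU1P[<-//|/tS/ltW].
exists b; split => // [i iN|l l0].
  have [_ /eqP rb] := hb i iN.
  have := @QF (b i) (fun j => bnt i j iN); rewrite rb => /esym/eqP.
  rewrite mulf_eq0 => /orP[/eqP//|/prodf_eq0[j _]].
  by rewrite subr_eq0 eq_sym (negbTE (bnt _ _ _)).
pose rs := [seq b i | i <- iota 0 N].
have srs : size rs = N by rewrite size_map size_iota.
have urs : uniq rs.
  rewrite map_inj_in_uniq ?iota_uniq// => i j; rewrite !mem_iota !add0n /= => iN jN bij.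
  have [ij|ji|//] := ltngtP i j.
  - by have := bmono _ _ ij jN; rewrite bij ltxx.
  - by have := bmono _ _ ji iN; rewrite bij ltxx.
have ars : all (root Q) rs.
  apply/allP => x /mapP[i]; rewrite mem_iota add0n /= => iN xE.
  by rewrite xE; case: (hb i iN).
have Q0 : Q.[0] = (\sum_(i < N.+1) p i) * \prod_(j < N.+1) t j.
  rewrite QF; last by move=> i; rewrite lt_eqF.
  congr (_ * _); last by apply: eq_bigr => j _; rewrite subr0.
  by apply: eq_bigr => i _; rewrite subr0 mulfK// gt_eqF.
have Qn0 : Q != 0.
  apply/eqP => Qz; move: Q0; rewrite Qz horner0 => /esym/eqP.
  rewrite mulf_eq0 => /orP[|/prodf_eq0[j _]]; last by rewrite gt_eqF.
  rewrite gt_eqF// big_ord_recl ltr_pwDl ?p0// sumr_ge0// => i _.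
  by rewrite ltW// p0//; case: i.
(* [size_Q] bounds the degree from above and the number of distinct roots bounds it from below. *)
have sQ : size Q = (size rs).+1.
  apply/eqP; rewrite eqn_leq srs size_Q/=.
  by have := max_poly_roots Qn0 ars urs; rewrite srs.
have fQ := all_roots_prod_XsubC sQ ars (etrans (uniq_rootsE _) urs).
have lc0 : lead_coef Q != 0 by rewrite lead_coef_eq0.
have Qe x : Q.[x] = lead_coef Q * \prod_(i < N) (x - b i).
  rewrite {1}fQ hornerZ horner_prod big_map; congr (_ * _).
  rewrite -(big_mkord xpredT (fun i => x - b i)) /index_iota subn0.
  by apply: eq_bigr => i _; rewrite hornerXsubC.
have lF : F (- l) * \prod_(j < N.+1) (t j + l) = Q.[- l].
  rewrite QF; last by move=> i; rewrite lt_eqF// (lt_trans _ (t0 i))// oppr_lt0.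
  by congr (_ * _); apply: eq_bigr => j _; rewrite opprK.
(* Comparing the values of [Q] at [- l] and at 0 eliminates the leading coefficient. *)
have E1 : F (- l) * \prod_(j < N.+1) (t j + l) * \prod_(i < N) b i =
   (\sum_(i < N.+1) p i) * \prod_(j < N.+1) t j * \prod_(i < N) (l + b i).
  rewrite lF -Q0 !Qe -!mulrA; congr (_ * _); rewrite -!big_split/=.
  by apply: eq_bigr => i _; ring.
have p1 : \sum_(i < N.+1) p i != 0.
  rewrite gt_eqF// big_ord_recl ltr_pwDl ?p0// sumr_ge0// => i _.
  by rewrite ltW// p0//; case: i.
have tl0 : \prod_(j < N.+1) (t j + l) != 0.
  by apply/prodf_neq0 => j _; rewrite gt_eqF// addr_gt0.
have tt0 : \prod_(j < N.+1) t j != 0.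
  by apply/prodf_neq0 => j _; rewrite gt_eqF.
have bb0 : \prod_(j < N) b j != 0.
  by apply/prodf_neq0 => j _; rewrite gt_eqF// bpos.
have -> : \prod_(i < N) (1 + l / b i) = \prod_(i < N) (l + b i) / \prod_(i < N) b i.
  rewrite -prodf_div; apply: eq_bigr => i _.
  by field; rewrite gt_eqF// bpos.
have -> : \prod_(i < N.+1) (1 + l / t i) =
    \prod_(i < N.+1) (t i + l) / \prod_(i < N.+1) t i.
  rewrite -prodf_div; apply: eq_bigr => i _.
  by field; rewrite gt_eqF.
apply: (mulIf (mulf_neq0 (mulf_neq0 p1 tl0) bb0)).
transitivity (F (- l) * \prod_(j < N.+1) (t j + l) * \prod_(i < N) b i).
  by field; rewrite p1.
by rewrite E1; field; rewrite ?tl0 ?bb0 ?tt0.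
Qed.

End PartialFractions.

(** Mean value theorem for [ln (1 + l * expR (- y))] between [ln s] and [ln t]; the derivative, up
    to sign, is [l / (expR y + l)], which decreases in [y]. In the coordinate [y] a geometric
    progression has constant step. *)
Lemma ln1D_div_diff (R : realType) (l s t : R) : 0 < l -> 0 < s -> s < t ->
  (ln t - ln s) * (l / (t + l)) <= ln (1 + l / s) - ln (1 + l / t)
    <= (ln t - ln s) * (l / (s + l)).
Proof.
move=> l0 s0 st; have t0 := lt_trans s0 st.
have lst : ln s < ln t by rewrite ltr_ln.
pose K (y : R) : R := ln (1 + l * expR (- y)).
pose dK (y : R) : R := - (l / (expR y + l)).
have pos (y : R) : 0 < 1 + l * expR (- y).
  by rewrite addr_gt0// mulr_gt0// expR_gt0.
have dKK (y : R) : is_derive y 1 K (dK y).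
  have -> : dK y = (1 + l * expR (- y))^-1 * (- (l * expR (- y))).
    rewrite /dK expRN; have e0 := expR_gt0 y; field.
    by rewrite !gt_eqF// addr_gt0.
  apply: (@is_derive1_comp _ (@ln R) (fun y => 1 + l * expR (- y))).
    exact: is_derive1_ln.
  by apply: is_derive_eq; rewrite /GRing.scale/=; ring.
have cK (y : R) : {for y, continuous K}.
  by apply: differentiable_continuous; apply/derivable1_diffP; case: (dKK y).
have [c] := @MVT R K dK _ _ lst (fun y _ => dKK y) (continuous_subspaceT cK).
rewrite in_itv/= /K !expRN !lnK ?posrE// => /andP[c1 c2] E.
have -> : ln (1 + l / s) - ln (1 + l / t) = (ln t - ln s) * (l / (expR c + l)).
  by rewrite -opprB E /dK mulNr opprK mulrC.
have ec1 : s < expR c by rewrite -(@lnK R s) ?posrE// ltr_expR.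
have ec2 : expR c < t by rewrite -(@lnK R t) ?posrE// ltr_expR.
have d0 : 0 < ln t - ln s by rewrite subr_gt0.
rewrite !ler_pM2l// !lef_pV2 ?posrE ?addr_gt0 ?expR_gt0// !lerD2r.
by rewrite !ltW.
Qed.

Lemma abel_telescope (R : comNzRingType) (n : nat) (d K : nat -> R) :
  \sum_(i < n.+1) (d i.+1 - d i) * K i =
  d n.+1 * K n - d 0%N * K 0%N + \sum_(i < n) d i.+1 * (K i - K i.+1).
Proof.
elim: n => [|n IH]; first by rewrite big_ord_recl !big_ord0 !addr0 mulrBl.
rewrite big_ord_recr/= IH [in RHS]big_ord_recr/= mulrBl mulrBr.
by ring.
Qed.

Section ThorinApproximation.
Variables (R : realType) (N : nat) (p : nat -> R) (c E : R).
Hypothesis c0 : 0 < c.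
Hypothesis E1 : 1 < E.
Hypothesis p0 : forall i, (i <= N)%N -> 0 < p i.
Hypothesis pTP : forall a b, (a <= b)%N -> (b < N)%N -> p a * p b.+1 <= p a.+1 * p b.

Let t (i : nat) : R := c * E ^+ i.

Let E0 : 0 < E. Proof. exact: lt_trans E1. Qed.

Let t0 i : 0 < t i. Proof. by rewrite mulr_gt0// exprn_gt0. Qed.

Let tS i j : (i < j)%N -> t i < t j.
Proof. by move=> ij; rewrite ltr_pM2l// ltr_eXn2l. Qed.

Let t_lt i j : (t i < t j) = (i < j)%N.
Proof. by rewrite ltr_pM2l// ltr_eXn2l. Qed.

Let F (s : R) := \sum_(i < N.+1) p i * t i / (t i - s).

(** No pole lies strictly between [t i] and [t i.+1], so each denominator keeps its sign there and
    each summand increases. *)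
Let F_increasing i s s' : (i < N)%N -> t i < s -> s < s' -> s' < t i.+1 -> F s < F s'.
Proof.
move=> iN is1 ss si; apply: ltr_sum; first by apply/hasP; exists ord0 => //; rewrite mem_index_enum.
move=> j _; have ptj : 0 < p j * t j by rewrite mulr_gt0// p0// -ltnS.
rewrite ltr_pM2l//; have [ji|ij] := leqP j i.
  have tji : t j <= t i by rewrite leNgt t_lt -leqNgt.
  by rewrite ltf_nV2 ?negrE; lra.
have tij : t i.+1 <= t j by rewrite leNgt t_lt -leqNgt.
by rewrite ltf_pV2 ?posrE; lra.
Qed.

(* Log-concavity: shifting the singularity by one lattice step makes the ratios
   p (k.+1) / p (i.+1) smaller than p k / p i on the positive terms and larger on
   the negative ones. *)
Let F_shift i x : (i.+1 < N)%N -> t i < x -> x < t i.+1 -> F x = 0 -> F (x * E) <= 0.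
Proof.
move=> iN ix xi Fx.
have iN' := ltnW iN.
have x0 : 0 < x by exact: lt_trans ix.
pose g k : R := t k / (t k - x).
have gpos k : (i < k)%N -> 0 < g k.
  move=> ik; rewrite divr_gt0// subr_gt0 (lt_le_trans xi)//.
  by rewrite leNgt t_lt -leqNgt.
have gneg k : (k <= i)%N -> g k < 0.
  move=> ki; rewrite pmulr_rlt0// invr_lt0 subr_lt0 (le_lt_trans _ ix)//.
  by rewrite leNgt t_lt -leqNgt.
have pi0 : 0 < p i by rewrite p0// ltnW.
have pi1 : 0 < p i.+1 by rewrite p0.
(* The term of index [N] in [F x = 0] lies to the right of [x] and is nonnegative; leaving it out
   makes the sum nonpositive. *)
have Fg : \sum_(k < N) p k * g k <= 0.
  move: Fx; rewrite /F big_ord_recr/= => /eqP; rewrite addr_eq0 => /eqP.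
  under eq_bigr do rewrite -mulrA; move=> ->; rewrite oppr_le0 -mulrA.
  by rewrite mulr_ge0 ?ltW ?p0// gpos.
(* The term of index 0 is nonpositive because [t 0] lies to the left of [x * E]; in the others
   [t k.+1 = E * t k], and the factor [E] cancels. *)
have FE : F (x * E) <= \sum_(k < N) p k.+1 * g k.
  rewrite /F big_ord_recl /=.
  have -> : \sum_(k < N) p (bump 0 k) * t (bump 0 k) / (t (bump 0 k) - x * E) =
      \sum_(k < N) p k.+1 * g k.
    apply: eq_bigr => k _; rewrite /bump/= add1n /g /t exprS.
    have tkx : c * E ^+ k - x != 0.
      rewrite subr_eq0; have [ki|ik] := leqP k i.
        by rewrite lt_eqF// (le_lt_trans _ ix)// leNgt t_lt -leqNgt.
      by rewrite gt_eqF// (lt_le_trans xi)// leNgt t_lt -leqNgt.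
    field.
    rewrite tkx/= (_ : _ - _ = (c * E ^+ k - x) * E); last by ring.
    by rewrite mulf_neq0// gt_eqF.
  rewrite gerDr pmulr_rle0 ?mulr_gt0 ?p0// invr_le0 subr_le0.
  rewrite /t expr0 mulr1; have := tS (ltnSn i); rewrite /t.
  have : c <= t i by rewrite ler_peMr ?exprn_ege1 ?ltW.
  by move: ix; rewrite /t; have := E1; nra.
apply: (le_trans FE); rewrite -(pmulr_rle0 _ pi0) mulr_sumr.
apply: (@le_trans _ _ (p i.+1 * \sum_(k < N) p k * g k)); last by rewrite pmulr_rle0.
rewrite mulr_sumr ler_sum// => k _; rewrite [leLHS]mulrA [leRHS]mulrA.
have [ki|ik] := leqP k i.
  rewrite (ler_nM2r (gneg k ki)) mulrC (mulrC (p i)).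
  exact: (pTP ki iN').
rewrite (ler_pM2r (gpos k ik)).
exact: (pTP (ltnW ik) (ltn_ord k)).
Qed.

(* If [b i] is the zero between [t i] and [t i.+1], then [w i] is the increment of
   the relative position [ln (b i / t i) / ln E]. *)
Lemma thorin_approximation : exists w : nat -> R,
  [/\ forall i, 0 <= w i, \sum_(i < N.+1) w i = 1 &
   forall l, 0 < l ->
    `|- ln ((\sum_(i < N.+1) p i * t i / (t i + l)) / \sum_(i < N.+1) p i) -
      \sum_(i < N.+1) w i * ln (1 + l / t i)| <= ln E].
Proof.
have [b [bt Fb bF]] := partial_fraction_roots p0 t0 tS.
have lnE : 0 < ln E by rewrite ln_gt0.
have bpos i : (i < N)%N -> 0 < b i.
  by move=> /bt /andP[h1 _]; exact: lt_trans h1.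
pose dl i : R := (ln (b i) - ln (t i)) / ln E.
have lntS i : ln (t i.+1) - ln (t i) = ln E.
  rewrite -ln_div ?posrE// /t exprS; congr ln; field.
  by rewrite expf_neq0 ?gt_eqF.
have dl0 i : (i < N)%N -> 0 <= dl i.
  move=> iN; have /andP[h _] := bt i iN.
  by rewrite divr_ge0 ?(ltW lnE)// subr_ge0 ler_ln ?posrE ?bpos// ltW.
have dl1 i : (i < N)%N -> dl i <= 1.
  move=> iN; have /andP[_ h] := bt i iN.
  rewrite ler_pdivrMr// mul1r -(lntS i) lerD2r ler_ln ?posrE ?bpos//.
  exact: ltW.
(* If [b i.+1 < b i * E], the growth of [F] between two poles would give
   [F (b i * E) > F (b i.+1) = 0], against [F_shift]. *)
have dlS i : (i.+1 < N)%N -> dl i <= dl i.+1.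
  move=> iN; have iN' := ltnW iN.
  have /andP[h1 h2] := bt i iN'; have /andP[h3 h4] := bt _ iN.
  rewrite ler_pM2r ?invr_gt0//.
  have -> : ln (b i) - ln (t i) = ln (b i * E) - ln (t i.+1).
    rewrite lnM ?posrE ?bpos//; have := lntS i; lra.
  rewrite lerD2r ler_ln ?posrE ?mulr_gt0 ?bpos// leNgt; apply/negP => lt1.
  have := F_shift iN h1 h2 (Fb _ iN').
  rewrite leNgt -(Fb _ iN) => /negP; apply.
  apply: (F_increasing iN h3 lt1).
  by move: h2; rewrite /t [in X in _ -> X]exprS mulrCA [_ * E]mulrC ltr_pM2l.
(* The positions of the [N] zeros, preceded by 0 and followed by 1: this yields [N + 1] increments,
   nonnegative and of sum 1. *)
pose d i : R := if i is j.+1 then (if (j < N)%N then dl j else 1) else 0.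
have dS i : d i <= d i.+1.
  case: i => [|i] /=; first by case: ifPn => // /dl0.
  case: (ltnP i.+1 N) => [h|h]; first by rewrite (ltnW h) dlS.
  by case: ifPn => // /dl1.
exists (fun i => d i.+1 - d i); split => [i||l l0]; first by rewrite subr_ge0.
  have := abel_telescope N d (fun=> 1); under eq_bigr do rewrite mulr1.
  move=> ->; rewrite big1 ?addr0; last by move=> i _; rewrite subrr mulr0.
  by rewrite /= ltnn mul0r subr0 mulr1.
pose K x : R := ln (1 + l / x); pose ka i : R := l / (t i + l).
have posK x : 0 < x -> 0 < 1 + l / x by move=> x0; rewrite addr_gt0// divr_gt0.
have := bF l l0; under eq_bigr do rewrite opprK; move=> ->.
rewrite ln_div ?posrE; last 2 first.
- by apply: prodr_gt0 => i _; rewrite posK// bpos.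
- by apply: prodr_gt0 => i _; rewrite posK.
(* Summation by parts exhibits the gamma exponent as a linear interpolation, on the logarithmic
   scale, of the terms [ln (1 + l / b i)] between neighbouring nodes. *)
rewrite (abel_telescope N d (fun i => ln (1 + l / t i))) /= ltnn mul0r subr0 mul1r.
have lnprod n (f : nat -> R) : (forall i, (i < n)%N -> 0 < f i) ->
    ln (\prod_(i < n) f i) = \sum_(i < n) ln (f i).
  elim: n => [|n IH] f0; first by rewrite !big_ord0 ln1.
  rewrite !big_ord_recr/= lnM ?posrE ?IH ?f0// => [i iN|]; first by rewrite f0// ltnW.
  by apply: prodr_gt0 => i _; apply: f0; exact: (ltnW (ltn_ord i)).
rewrite (lnprod _ (fun i => 1 + l / b i)); last by move=> i iN; rewrite posK// bpos.
rewrite (lnprod _ (fun i => 1 + l / t i)); last by move=> i iN; rewrite posK.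
rewrite [\sum_(i < N.+1) _]big_ord_recr/=.
set T := \sum_(i < N) ln (1 + l / t i); set B := \sum_(i < N) ln (1 + l / b i).
have -> : \sum_(i < N) (if (i < N)%N then dl i else 1) *
    (ln (1 + l / t i) - ln (1 + l / t i.+1)) =
    \sum_(i < N) dl i * (K (t i) - K (t i.+1)).
  by apply: eq_bigr => i _; rewrite ltn_ord.
set D := \sum_(i < N) dl i * _.
have -> : - (B - (T + ln (1 + l / t N))) - (ln (1 + l / t N) + D) =
    \sum_(i < N) (K (t i) - K (b i) - dl i * (K (t i) - K (t i.+1))).
  by rewrite !sumrB -/T -/B -/D; ring.
apply: (le_trans (ler_norm_sum _ _ _)).
(* The interpolation error on one step is at most [ln E] times the variation of the slope [ka]. The
   slopes decrease within [[0, 1]], so the errors telescope to at most [ln E], however large [N]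
   is. *)
apply: (@le_trans _ _ (\sum_(i < N) ln E * (ka i - ka i.+1))).
  apply: ler_sum => i _; have iN := ltn_ord i.
  have /andP[h1 h2] := bt i iN; have bi := bpos _ iN.
  have /andP[x1 x2] := ln1D_div_diff l0 (t0 i) h1.
  have /andP[y1 y2] := ln1D_div_diff l0 (t0 i) (tS (ltnSn i)).
  rewrite lntS in y1 y2.
  have dE : ln (b i) - ln (t i) = dl i * ln E by rewrite divfK// gt_eqF.
  rewrite dE in x1 x2.
  have kb : ka i.+1 <= l / (b i + l).
    rewrite ler_pM2l// lef_pV2 ?posrE ?addr_gt0// lerD2r.
    exact: ltW.
  rewrite -/(K (t i)) -/(K (b i)) -/(K (t i.+1)) -/(ka i) -/(ka i.+1) in x1 x2 y1 y2 *.
  have d0 := dl0 _ iN; have d1 := dl1 _ iN.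
  have dE0 : 0 <= dl i * ln E by rewrite mulr_ge0// ltW.
  have x1' : dl i * ln E * ka i.+1 <= K (t i) - K (b i).
    by apply: le_trans x1; rewrite ler_wpM2l.
  have ky1 := ler_wpM2l d0 y1; have ky2 := ler_wpM2l d0 y2.
  have kk : 0 <= ln E * (ka i - ka i.+1).
    by rewrite mulrBr; lra.
  have kd : dl i * (ln E * (ka i - ka i.+1)) <= ln E * (ka i - ka i.+1).
    by rewrite ler_piMl.
  rewrite ler_norml; apply/andP; split; lra.
rewrite -mulr_sumr.
have -> : \sum_(i < N) (ka i - ka i.+1) = ka 0%N - ka N.
  by elim: (N) => [|n IH]; rewrite ?big_ord0 ?subrr// big_ord_recr/= IH; ring.
rewrite ler_piMr ?(ltW lnE)//.
have k0 : ka 0%N <= 1 by rewrite ler_pdivrMr ?addr_gt0// mul1r lerDr ltW.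
have kN : 0 <= ka N by rewrite divr_ge0 ?ltW// addr_gt0.
lra.
Qed.
End ThorinApproximation.

(** * Log-concave weights on a geometric lattice *)

(** Total positivity of order 2 of the Toeplitz matrix of [p]. The condition
    [p_i * p_(i+2) <= p_(i+1) ^ 2] alone would allow gaps, as in 1, 0, 0, 1, and would not be stable
    under convolution. *)
Definition tp2 (R : numDomainType) (p : nat -> R) : Prop :=
  (forall i, 0 <= p i) /\
  forall a b d, (a <= b)%N -> p a * p (b + d)%N <= p (a + d)%N * p b.

(** The Cauchy-Binet formula for 2 by 2 determinants: twice the difference of the two sides is a
    double sum of products of two minors, and under the hypotheses both minors have the same sign at
    each pair of indices. *)
Lemma cauchy_binet2_le (R : realDomainType) (n : nat) (a a' b b' : 'I_n -> R) :
  (forall i j : 'I_n, (i < j)%N -> a i * a' j <= a j * a' i) ->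
  (forall i j : 'I_n, (i < j)%N -> b i * b' j <= b j * b' i) ->
  (\sum_i a' i * b i) * (\sum_i a i * b' i) <=
  (\sum_i a i * b i) * (\sum_i a' i * b' i).
Proof.
move=> ha hb; rewrite -subr_ge0 -(pmulr_rge0 _ (ltr0n R 2)).
have -> : 2%:R * ((\sum_i a i * b i) * (\sum_i a' i * b' i) -
    (\sum_i a' i * b i) * (\sum_i a i * b' i)) =
  \sum_i \sum_j (a i * a' j - a j * a' i) * (b i * b' j - b j * b' i).
  have sumM (f g : 'I_n -> R) : (\sum_i f i) * (\sum_i g i) = \sum_i \sum_j f i * g j.
    by rewrite mulr_suml; apply: eq_bigr => i _; rewrite mulr_sumr.
  have sumM' (f g : 'I_n -> R) : (\sum_i f i) * (\sum_i g i) = \sum_i \sum_j f j * g i.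
    by rewrite mulrC sumM; apply: eq_bigr => i _; apply: eq_bigr => j _; rewrite mulrC.
  have E1 := sumM (fun i => a i * b i) (fun i => a' i * b' i).
  have E2 := sumM' (fun i => a i * b i) (fun i => a' i * b' i).
  have E3 := sumM (fun i => a' i * b i) (fun i => a i * b' i).
  have E4 := sumM' (fun i => a' i * b i) (fun i => a i * b' i).
  transitivity (\sum_i \sum_j (a i * b i) * (a' j * b' j) +
     \sum_i \sum_j (a j * b j) * (a' i * b' i) -
     (\sum_i \sum_j (a' i * b i) * (a j * b' j) +
     \sum_i \sum_j (a' j * b j) * (a i * b' i))).
    by rewrite -E1 -E2 -E3 -E4; ring.
  rewrite -!big_split/= -sumrB; apply: eq_bigr => i _.
  rewrite -!big_split/= -sumrB; apply: eq_bigr => j _; ring.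
apply: sumr_ge0 => i _; apply: sumr_ge0 => j _.
have [ij|ji|/ord_inj ->] := ltngtP i j.
- by rewrite mulr_le0// subr_le0 ?ha ?hb.
- by rewrite mulr_ge0// subr_ge0 ?ha ?hb.
- by rewrite !subrr mul0r.
Qed.

Lemma tp2_shift (R : realDomainType) (p : {poly R}) (e x y : nat) :
  tp2 (fun i => p`_i) -> (x <= y)%N ->
  ('X^e * p)`_x * p`_y <= ('X^e * p)`_y * p`_x.
Proof.
move=> [p0 pT] xy; rewrite !coefXnM; have [xe|ex] := ltnP x e.
  by rewrite mul0r; case: ifP => _; rewrite ?mul0r// mulr_ge0.
rewrite ltnNge (leq_trans ex xy)/=.
have := pT _ _ e (leq_sub2r e xy); rewrite !subnK ?(leq_trans ex xy)//.
by rewrite mulrC [X in _ <= X]mulrC [X in X <= _]mulrC.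
Qed.

(** After multiplying [p] or [q] by powers of the variable, all four coefficients of the product
    become coefficients of the same index [n]. They form a 2 by 2 product of matrices, to which
    Cauchy-Binet applies. *)
Lemma tp2M (R : realDomainType) (p q : {poly R}) :
  tp2 (fun i => p`_i) -> tp2 (fun i => q`_i) -> tp2 (fun i => (p * q)`_i).
Proof.
move=> tp tq; have [p0 pT] := tp; have [q0 qT] := tq.
split=> [i|a b d ab].
  by rewrite coefM sumr_ge0// => j _; rewrite mulr_ge0.
pose n := (b + d)%N.
pose P := 'X^(b - a) * p; pose Q := 'X^d * q.
have cadd (r : {poly R}) i e : ('X^e * r)`_(i + e) = r`_i.
  by rewrite coefXnM ltnNge leq_addl/= addnK.
have Eb : (p * q)`_b = (p * Q)`_n by rewrite /Q mulrCA cadd.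
have Ead : (p * q)`_(a + d) = (P * q)`_n.
  by rewrite /P -mulrA -(cadd _ _ (b - a)%N) addnAC subnKC.
have Ea : (p * q)`_a = (P * Q)`_n.
  have -> : P * Q = 'X^(b - a) * ('X^d * (p * q)) by rewrite /P /Q; ring.
  by rewrite (_ : n = (a + d + (b - a))%N) ?cadd// addnAC subnKC.
rewrite Eb Ead Ea -/n !coefMr [leRHS]mulrC.
apply: (@cauchy_binet2_le _ _ (fun j : 'I_n.+1 => p`_(n - j)) (fun j => P`_(n - j))
  (fun j => Q`_j) (fun j => q`_j)) => i j ij.
- rewrite mulrC [leRHS]mulrC /P; apply: tp2_shift => //.
  by rewrite leq_sub2l// ltnW.
- rewrite /Q; apply: tp2_shift => //.
  exact: ltnW.
Qed.

(** For positive terms the condition says that the ratios [u i.+1 / u i] decrease. Truncation is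
    harmless: in each minor the largest index [b + d] sits on the smaller side, so that this side
    vanishes first. *)
Lemma tp2_truncated (R : realFieldType) (u : nat -> R) (n : nat) :
  (forall i, 0 < u i) -> (forall i, u i * u i.+2 <= u i.+1 ^+ 2) ->
  tp2 (fun i => (\poly_(i < n) u i)`_i).
Proof.
move=> u0 uc.
pose r i := u i.+1 / u i.
have rmono i j : (i <= j)%N -> r j <= r i.
  move=> /subnKC <-; elim: (j - i)%N => [|k IH]; first by rewrite addn0.
  apply: le_trans IH; rewrite addnS /r ler_pdivrMr// mulrAC ler_pdivlMr//.
  by rewrite mulrC -expr2 uc.
have uT a b d : (a <= b)%N -> u a * u (b + d)%N <= u (a + d)%N * u b.
  move=> ab; elim: d => [|d IH]; first by rewrite !addn0.
  have us i : u i.+1 = u i * r i by rewrite /r mulrC divfK// gt_eqF.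
  rewrite !addnS !us [leLHS]mulrA [leRHS]mulrAC.
  apply: ler_pM => //; first by rewrite mulr_ge0// ltW.
    by rewrite divr_ge0// ltW.
  by apply: rmono; rewrite leq_add2r.
split=> [i|a b d ab]; rewrite !coef_poly.
  by case: ifP => // _; exact: ltW.
have [h|h] := ltnP (b + d) n.
  rewrite (leq_ltn_trans _ h) ?(leq_trans ab) ?leq_addr//.
  rewrite (leq_ltn_trans _ h) ?leq_add2r//.
  by rewrite (leq_ltn_trans _ h) ?leq_addr// uT.
by rewrite mulr0; case: ifP => _; case: ifP => _; rewrite ?mul0r ?mulr0// mulr_ge0 ?ltW.
Qed.

(** A zero at [i] would make the product of the first and the last coefficient nonpositive, by the
    minor with [a = 0] and [b = i]. Strict positivity is what the interlacing argument needs. *)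
Lemma tp2_gt0 (R : realFieldType) (p : {poly R}) :
  tp2 (fun i => p`_i) -> 0 < p`_0 -> forall i, (i < size p)%N -> 0 < p`_i.
Proof.
move=> [p0 pT] p00 i isz.
have pn0 : p != 0 by apply: contraTneq p00 => ->; rewrite coef0 ltxx.
have ln : 0 < p`_(size p).-1.
  by rewrite lt_def p0 andbT -lead_coefE lead_coef_eq0.
have il : (i <= (size p).-1)%N by rewrite -ltnS prednK// (leq_ltn_trans _ isz).
have := pT 0%N i ((size p).-1 - i)%N isT; rewrite subnKC// => h.
rewrite lt_def p0 andbT; apply/eqP => pi0.
by move: h; rewrite pi0 mulr0 leNgt mulr_gt0.
Qed.

(** The coefficient of [z ^ i] in [(1 - b z) / ((1 - a z) (1 - a' z))], read off its partial
    fractions. *)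
Definition ratio_coef (R : fieldType) (a a' b : R) (i : nat) : R :=
  ((a - b) * a ^+ i - (a' - b) * a' ^+ i) / (a - a').

Section RatioCoef.
Variables (R : realType) (a a' b : R).
Hypotheses (b0 : 0 < b) (ba' : b <= a') (a'a : a' < a) (a1 : a < 1).

Let a'0 : 0 < a'. Proof. exact: lt_le_trans ba'. Qed.
Let a0 : 0 < a. Proof. exact: lt_trans a'a. Qed.
Let aa' : 0 < a - a'. Proof. by rewrite subr_gt0. Qed.

Lemma ratio_coef0 : ratio_coef a a' b 0 = 1.
Proof. by rewrite /ratio_coef !expr0; field; rewrite gt_eqF. Qed.

Lemma ratio_coef_gt0 i : 0 < ratio_coef a a' b i.
Proof.
rewrite divr_gt0// subr_gt0.
apply: (@le_lt_trans _ _ ((a' - b) * a ^+ i)).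
  by rewrite ler_wpM2l ?subr_ge0// lerXn2r ?nnegrE ?ltW.
by rewrite ltr_pM2r ?exprn_gt0// ltrD2r.
Qed.

(** The defect is exactly [(a - b) * (a' - b) * (a * a') ^ i]; its sign is where [b <= a']
    enters. *)
Lemma ratio_coef_logconcave i :
  ratio_coef a a' b i * ratio_coef a a' b i.+2 <= ratio_coef a a' b i.+1 ^+ 2.
Proof.
rewrite -subr_ge0 /ratio_coef !(exprS a) !(exprS a').
have aa : a - a' != 0 by rewrite gt_eqF.
have -> : (((a - b) * (a * a ^+ i) - (a' - b) * (a' * a' ^+ i)) / (a - a')) ^+ 2 -
    ((a - b) * a ^+ i - (a' - b) * a' ^+ i) / (a - a') *
    (((a - b) * (a * (a * a ^+ i)) - (a' - b) * (a' * (a' * a' ^+ i))) / (a - a')) =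
    (a - b) * (a' - b) * (a ^+ i * a' ^+ i) by field.
have ba : b <= a by exact: ltW (le_lt_trans ba' a'a).
by rewrite !mulr_ge0 ?exprn_ge0 ?subr_ge0 ?(ltW a0) ?(ltW a'0).
Qed.

Lemma cvg_ratio_coef (z : R) : 0 <= z <= 1 ->
  (\poly_(i < M) ratio_coef a a' b i).[z] @[M --> \oo] -->
    (1 - b * z) / ((1 - a * z) * (1 - a' * z)).
Proof.
move=> /andP[z0 z1].
have az1 : a * z < 1 by apply: le_lt_trans a1; rewrite ler_piMr// ltW.
have a'z1 : a' * z < 1.
  by apply: le_lt_trans (lt_trans a'a a1); rewrite ler_piMr// ltW.
have az0 : 0 <= a * z by rewrite mulr_ge0// ltW.
have a'z0 : 0 <= a' * z by rewrite mulr_ge0// ltW.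
have geo (x : R) : x < 1 -> forall M, \sum_(i < M) x ^+ i = (1 - x ^+ M) / (1 - x).
  move=> x1; elim=> [|M IH]; first by rewrite big_ord0 expr0 subrr mul0r.
  by rewrite big_ord_recr/= IH exprS; field; rewrite subr_eq0 gt_eqF.
have E M : (\poly_(i < M) ratio_coef a a' b i).[z] =
    ((a - b) * ((1 - (a * z) ^+ M) / (1 - a * z)) -
     (a' - b) * ((1 - (a' * z) ^+ M) / (1 - a' * z))) / (a - a').
  rewrite horner_poly -!geo// !mulr_sumr -sumrB mulr_suml.
  by apply: eq_bigr => i _; rewrite !exprMn /ratio_coef; field; rewrite gt_eqF.
have -> : (1 - b * z) / ((1 - a * z) * (1 - a' * z)) =
  ((a - b) * ((1 - 0) / (1 - a * z)) - (a' - b) * ((1 - 0) / (1 - a' * z))) / (a - a').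
  by field; rewrite !gt_eqF// subr_gt0.
under eq_fun do rewrite E.
apply: cvgM; last exact: cvg_cst.
have c (x : R) : 0 <= x -> x < 1 -> (1 - x ^+ M) / (1 - x) @[M --> \oo] --> (1 - 0) / (1 - x).
  move=> x0 x1; apply: cvgM; last exact: cvg_cst.
  apply: cvgB; first exact: cvg_cst.
  by apply: cvg_expr; rewrite ger0_norm.
by apply: cvgB; apply: cvgM; first [exact: cvg_cst|exact: c].
Qed.
End RatioCoef.

(** * Lattice weights with a prescribed Mellin transform *)

Section LatticeApproximation.
Variables (R : realType) (n : nat) (x x' y : nat -> R).
Hypothesis x0 : forall j, 0 < x j.
Hypothesis xx' : forall j, x j < x' j.
Hypothesis x'y : forall j, x' j <= y j.

Let rho (h u : R) := expR (- (h * u)).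

Let P h M := \prod_(j < n) \poly_(i < M) ratio_coef (rho h (x j)) (rho h (x' j)) (rho h (y j)) i.

Let rho_hyp h j : 0 < h -> [/\ 0 < rho h (y j), rho h (y j) <= rho h (x' j),
   rho h (x' j) < rho h (x j) & rho h (x j) < 1].
Proof.
move=> h0; split; first exact: expR_gt0.
- by rewrite ler_expR lerN2 ler_pM2l.
- by rewrite ltr_expR ltrN2 ltr_pM2l.
- by rewrite expR_lt1 oppr_lt0 mulr_gt0.
Qed.

Let P_tp2 h M : 0 < h -> tp2 (fun i => (P h M)`_i).
Proof.
move=> h0; rewrite /P; elim/big_ind: _ => [|p q|j _]; [|exact: tp2M|].
  split=> [i|c c' d cc]; first by rewrite coef1 ler0n.
  rewrite !coef1; case: c' d cc => [|c'] d /=; last by rewrite mulr0 mulr_ge0.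
  by rewrite leqn0 => /eqP ->; rewrite mulrC.
have [h1 h2 h3 h4] := rho_hyp j h0; apply: tp2_truncated => i.
- exact: ratio_coef_gt0.
- exact: ratio_coef_logconcave.
Qed.

Let P_coef0 h M : 0 < h -> (0 < M)%N -> (P h M)`_0 = 1.
Proof.
move=> h0 M0; rewrite -horner_coef0 /P horner_prod big1// => j _.
have [h1 h2 h3 h4] := rho_hyp j h0.
by rewrite horner_coef0 coef_poly M0 ratio_coef0.
Qed.

(** The generating function without truncation, at [rho h s]. As [1 - rho h u] is equivalent to
    [h * u] when [h] tends to 0, dividing by [G h 0] gives the rational factors in the limit. *)
Let G h s := \prod_(j < n) ((1 - rho h (y j + s)) /
  ((1 - rho h (x j + s)) * (1 - rho h (x' j + s)))).

Let cvg_prod_ord (T : Type) (F : set_system T) (FF : Filter F) (f : nat -> T -> R) (l : nat -> R) :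
  (forall j, (j < n)%N -> f j t @[t --> F] --> l j) ->
  \prod_(j < n) f j t @[t --> F] --> \prod_(j < n) l j.
Proof.
elim: n => [|k IH] fl.
  by under eq_fun do rewrite big_ord0; rewrite big_ord0; exact: cvg_cst.
under eq_fun do rewrite big_ord_recr/=; rewrite big_ord_recr/=.
by apply: cvgM; [apply: IH => j jk; apply: fl; exact: ltnW|exact: fl].
Qed.

Let cvg_P h s : 0 < h -> 0 <= s -> (P h M).[rho h s] @[M --> \oo] --> G h s.
Proof.
move=> h0 s0; rewrite /P /G; under eq_fun do rewrite horner_prod.
apply: (@cvg_prod_ord _ _ _
  (fun j M => (\poly_(i < M) ratio_coef (rho h (x j)) (rho h (x' j)) (rho h (y j)) i).[rho h s])
  (fun j => (1 - rho h (y j + s)) /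
    ((1 - rho h (x j + s)) * (1 - rho h (x' j + s))))) => j _.
have [h1 h2 h3 h4] := rho_hyp j h0.
have r (u : R) : rho h (u + s) = rho h u * rho h s by rewrite /rho mulrDr opprD expRD.
rewrite !r; apply: cvg_ratio_coef => //.
by rewrite expR_ge0/= expR_le1 oppr_le0 mulr_ge0// ltW.
Qed.

(** [1 - expR (- (h * v))] lies between [h * v / (1 + h * v)] and [h * v], both bounds coming from
    [1 + x <= expR x]. *)
Let cvg_rho_ratio s u : 0 <= s -> 0 < u ->
  (1 - rho h (u + s)) / (1 - rho h u) @[h --> 0^'+] --> 1 + s / u.
Proof.
move=> s0 u0.
have c (v : R) : 0 < v -> (1 - rho h v) / h @[h --> 0^'+] --> v.
  move=> v0.
  have h1 : v / (1 + h * v) @[h --> 0^'+] --> v / (1 + 0 * v).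
    apply: cvgM; first exact: cvg_cst.
    apply: cvgV; first by rewrite mul0r addr0 oner_neq0.
    apply: cvgD; first exact: cvg_cst.
    by apply: cvgM; [exact: cvg_at_right_filter cvg_id|exact: cvg_cst].
  rewrite mul0r addr0 divr1 in h1.
  apply: (squeeze_cvgr _ h1 (cvg_cst v)).
  near=> h; have h0 : 0 < h by [].
  have e1 := expR_ge1Dx (- (h * v)); have e2 := expR_ge1Dx (h * v).
  have hv : 0 < 1 + h * v by rewrite addr_gt0// mulr_gt0.
  have e0 := expR_gt0 (- (h * v)).
  have e3 := expRxMexpNx_1 (h * v).
  apply/andP; split.
    rewrite ler_pdivlMr// mulrAC ler_pdivrMr// /rho.
    have : (1 + h * v) * expR (- (h * v)) <= 1.
      by apply: (le_trans (ler_wpM2r (ltW e0) e2)); rewrite e3.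
    lra.
  by rewrite ler_pdivrMr// /rho; lra.
have us : 0 < u + s by rewrite ltr_wpDr.
have -> : 1 + s / u = (u + s) / u by field; rewrite gt_eqF.
have h2 : ((1 - rho h (u + s)) / h) / ((1 - rho h u) / h) @[h --> 0^'+] --> (u + s) / u.
  by apply: cvgM; [exact: c|apply: cvgV; [rewrite gt_eqF|exact: c]].
apply: cvg_trans h2; apply: near_eq_cvg; near=> h.
have h0 : 0 < h by [].
have r1 : rho h u < 1 by rewrite expR_lt1 oppr_lt0 mulr_gt0.
by field; rewrite !gt_eqF// subr_gt0.
Unshelve. all: by end_near. Qed.

Let cvg_G s : 0 <= s -> G h s / G h 0 @[h --> 0^'+] -->
  \prod_(j < n) ((1 + s / y j) / ((1 + s / x j) * (1 + s / x' j))).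
Proof.
move=> s0.
have x'0 j : 0 < x' j by exact: lt_trans (xx' j).
have y0 j : 0 < y j by exact: lt_le_trans (x'y j).
have pos u : 0 < u -> 0 < 1 + s / u by move=> u0; rewrite ltr_wpDr// divr_ge0// ltW.
under eq_fun do rewrite /G -prodf_div.
apply: (@cvg_prod_ord _ _ _
  (fun j h => (1 - rho h (y j + s)) / ((1 - rho h (x j + s)) * (1 - rho h (x' j + s))) /
  ((1 - rho h (y j + 0)) / ((1 - rho h (x j + 0)) * (1 - rho h (x' j + 0)))))
  (fun j => (1 + s / y j) / ((1 + s / x j) * (1 + s / x' j)))) => j _.
have h2 : ((1 - rho h (y j + s)) / (1 - rho h (y j))) /
    (((1 - rho h (x j + s)) / (1 - rho h (x j))) *
     ((1 - rho h (x' j + s)) / (1 - rho h (x' j)))) @[h --> 0^'+] -->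
    (1 + s / y j) / ((1 + s / x j) * (1 + s / x' j)).
  apply: cvgM; first exact: cvg_rho_ratio.
  apply: cvgV; first by rewrite mulf_neq0// gt_eqF// pos.
  by apply: cvgM; exact: cvg_rho_ratio.
apply: cvg_trans h2; apply: near_eq_cvg; near=> h.
have h0 : 0 < h by [].
have r1 u : 0 < u -> 1 - rho h u != 0.
  by move=> u0; rewrite gt_eqF// subr_gt0 expR_lt1 oppr_lt0 mulr_gt0.
rewrite !addr0; field.
by rewrite !r1// ltr_wpDr.
Unshelve. all: by end_near. Qed.

(** With [E = expR h], the quotient [p.[expR (- (h * s))] / p.[1]] is the moment of order [- s] of a
    random rate on the lattice of the powers of [E]. The mesh [h] is chosen first, then the
    truncation [M], which depends on it; finitely many exponents allow a common choice. *)
Lemma lattice_approximation (K : nat) (s : nat -> R) (e : R) :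
  (forall k, 0 <= s k) -> 0 < e -> exists (h : R) (p : {poly R}),
  [/\ 0 < h, h <= e, tp2 (fun i => p`_i), 0 < p`_0 &
   forall k, (k <= K)%N ->
     `|p.[expR (- (h * s k))] / p.[1] -
       \prod_(j < n) ((1 + s k / y j) / ((1 + s k / x j) * (1 + s k / x' j)))| <= e].
Proof.
move=> s0 e0; have e2 : 0 < e / 2 by rewrite divr_gt0.
have [h [h0 he hG]] : exists h : R, [/\ 0 < h, h <= e & forall k : 'I_K.+1,
   `|\prod_(j < n) ((1 + s k / y j) / ((1 + s k / x j) * (1 + s k / x' j))) -
     G h (s k) / G h 0| <= e / 2].
  suff : \forall h \near 0^'+, [/\ 0 < h, h <= e & forall k : 'I_K.+1,
   `|\prod_(j < n) ((1 + s k / y j) / ((1 + s k / x j) * (1 + s k / x' j))) -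
     G h (s k) / G h 0| <= e / 2] by move=> /filter_ex.
  near=> h; split => //.
    by near: h; exact: nbhs_right_le.
  near: h; apply: filter_forall => k.
  by have /cvgrPdist_le := cvg_G (s0 k); exact.
have G0 : G h 0 != 0.
  apply/prodf_neq0 => j _; rewrite !addr0.
  have x'0 : 0 < x' j by exact: lt_trans (xx' j).
  have y0 : 0 < y j by exact: lt_le_trans (x'y j).
  have r1 u : 0 < u -> 1 - rho h u != 0.
    by move=> u0; rewrite gt_eqF// subr_gt0 expR_lt1 oppr_lt0 mulr_gt0.
  by rewrite mulf_neq0// ?invr_neq0 ?mulf_neq0// r1.
have [M [M0 hM]] : exists M, (0 < M)%N /\ forall k : 'I_K.+1,
    `|G h (s k) / G h 0 - (P h M).[rho h (s k)] / (P h M).[rho h 0]| <= e / 2.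
  suff : \forall M \near \oo, (0 < M)%N /\ forall k : 'I_K.+1,
    `|G h (s k) / G h 0 - (P h M).[rho h (s k)] / (P h M).[rho h 0]| <= e / 2
    by move=> /filter_ex.
  near=> M; split; first by near: M; exact: nbhs_infty_gt.
  near: M; apply: filter_forall => k.
  have : (P h M).[rho h (s k)] / (P h M).[rho h 0] @[M --> \oo] --> G h (s k) / G h 0.
    apply: cvgM; first exact: cvg_P.
    by apply: cvgV => //; exact: cvg_P.
  by move=> /cvgrPdist_le; exact.
exists h, (P h M); split => //; first exact: P_tp2.
  by rewrite P_coef0.
move=> k kK; have kK1 : (k < K.+1)%N by [].
have := hG (Ordinal kK1); have := hM (Ordinal kK1).
have rho0 : rho h 0 = 1 by rewrite /rho mulr0 oppr0 expR0.
rewrite /= rho0 -/(rho h (s k)).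
set u := _ / _; set v := _ / _; set z := \prod_(j < n) _.
by rewrite !ler_norml => /andP[? ?] /andP[? ?]; apply/andP; split; lra.
Unshelve. all: by end_near. Qed.
End LatticeApproximation.

(** Gauss's product for [Gamma (1 + s)], that is [s] times the classical
    [N! N^s / (s (s + 1) ... (s + N))]. *)
Definition gauss_product (R : realType) (s : R) (N : nat) : R :=
  N%:R `^ s / \prod_(j < N) (1 + s / j.+1%:R).

Section LatticeMoments.
Variables (R : realType) (alpha gamma : R).
Hypotheses (alpha0 : 0 < alpha) (alpha4 : alpha <= 1 / 4) (ag : 4 * alpha <= gamma).

Let q := gamma / alpha.
Let gamma0 : 0 < gamma.
Proof. by apply: lt_le_trans ag; rewrite mulr_gt0. Qed.
Let q0 : 0 < q. Proof. exact: divr_gt0. Qed.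
Let q4 : 4 <= q. Proof. by rewrite ler_pdivlMr. Qed.

(* Each pair of consecutive multiples of [1 / q] is matched in turn with an integer
   and with a multiple of [1 / gamma]. The k-th integer comes after 4k multiples of
   [1 / q] because [4 <= q], and [k / gamma] does because [alpha <= 1 / 4]. *)
Let x j : R := (j.*2.+1)%:R / q.
Let x' j : R := (j.*2.+2)%:R / q.
Let y j : R := if odd j then (j./2.+1)%:R / gamma else (j./2.+1)%:R.

Let x0 j : 0 < x j. Proof. by rewrite divr_gt0. Qed.

Let xx' j : x j < x' j. Proof. by rewrite ltr_pM2r ?invr_gt0// ltr_nat. Qed.

Let x'y j : x' j <= y j.
Proof.
rewrite /x' /y ler_pdivrMr//; have jE := odd_double_half j.
have m0 : (0 : R) < (j./2.+1)%:R by rewrite ltr0n.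
case: ifP => oj; rewrite oj in jE.
  have -> : (j.*2.+2)%:R = 4 * (j./2.+1)%:R :> R.
    by rewrite -natrM; congr _%:R; lia.
  have -> : (j./2.+1)%:R / gamma * q = (j./2.+1)%:R / alpha.
    by rewrite /q; field; rewrite !gt_eqF.
  by rewrite ler_pdivlMr//; have := alpha4; nra.
apply: (@le_trans _ _ ((j./2.+1)%:R * 4)); last by rewrite ler_pM2l.
by rewrite -natrM ler_nat; lia.
Qed.

(** The factors of index [2 m] and [2 m + 1] use the values [m + 1] and [(m + 1) / gamma] of [y] and
    four consecutive multiples of [1 / q], so whole blocks reassemble into three complete
    products. *)
Let prod_blocks s N :
  \prod_(j < N.*2) ((1 + s / y j) / ((1 + s / x j) * (1 + s / x' j))) =
  (\prod_(j < N) (1 + s / j.+1%:R)) * (\prod_(j < N) (1 + s * gamma / j.+1%:R)) /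
  \prod_(j < 4 * N) (1 + s * q / j.+1%:R).
Proof.
elim: N => [|N IH]; first by rewrite !big_ord0 mul1r divr1.
have -> : (4 * N.+1 = (4 * N).+4)%N by lia.
have N4E : (N.*2.*2 = 4 * N)%N by lia.
move: (4 * N)%N N4E IH => N4 N4E IH.
rewrite doubleS !big_ord_recr/= IH.
rewrite /y /= odd_double/= doubleK uphalf_double /x /x' !invf_div !mulrA.
rewrite N4E (_ : (N.*2.+1.*2 = N4.+2)%N); last by lia.
rewrite !invfM; ring.
Qed.

(** Its power of exponent [s] collects the prefactors of the three Gauss products at [q s], [s] and
    [gamma s]. On the rates it acts as a dilation: the lattice will start at the inverse of
    [scale]. *)
Let scale N : R := (4 * N)%:R `^ q * N%:R `^ (- (1 + gamma)).

Let scale_gt0 N : (0 < N)%N -> 0 < scale N.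
Proof. by move=> N0; rewrite mulr_gt0// powR_gt0// ltr0n// muln_gt0. Qed.

Let scaled_prod (k N : nat) : (0 < N)%N ->
  scale N `^ (k%:R / q) *
  \prod_(j < N.*2) ((1 + k%:R / q / y j) / ((1 + k%:R / q / x j) * (1 + k%:R / q / x' j))) =
  gauss_product k%:R (4 * N) /
    (gauss_product (k%:R / q) N * gauss_product (k%:R * alpha) N).
Proof.
move=> N0; have N0' : (0 : R) < N%:R by rewrite ltr0n.
have s0 : 0 <= k%:R / q by rewrite divr_ge0// ltW.
have pos (s : R) n : 0 <= s -> \prod_(j < n) (1 + s / j.+1%:R) != 0.
  by move=> s1; apply/prodf_neq0 => j _; rewrite gt_eqF// ltr_wpDr// divr_ge0.
have E1 : k%:R / q * gamma = k%:R * alpha.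
  by rewrite /q; field; rewrite !gt_eqF.
have E2 : k%:R / q * q = k%:R by rewrite divfK// gt_eqF.
rewrite prod_blocks E1 E2 /gauss_product /scale powRM ?powR_ge0//.
rewrite -!powRrM [q * _]mulrC E2.
have -> : - (1 + gamma) * (k%:R / q) = - (k%:R / q) + - (k%:R * alpha) by rewrite -E1; ring.
rewrite powRD ?(gt_eqF N0') ?implybT// !powRN.
have p1 : N%:R `^ (k%:R / q) != 0 by rewrite gt_eqF// powR_gt0.
have p2 : N%:R `^ (k%:R * alpha) != 0 by rewrite gt_eqF// powR_gt0.
by field; rewrite p1 p2 !pos// mulr_ge0// ltW.
Qed.

Lemma lattice_moments (Gam : R -> R) :
  (forall s, 0 <= s -> gauss_product s N @[N --> \oo] --> Gam s) ->
  (forall s, 0 <= s -> Gam s != 0) ->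
  exists (N : nat -> nat) (p : nat -> nat -> R) (c E : nat -> R),
  [/\ (forall n, 0 < c n), (forall n, 1 < E n), (forall n i, (i <= N n)%N -> 0 < p n i) &
    forall n a b, (a <= b)%N -> (b < N n)%N -> p n a * p n b.+1 <= p n a.+1 * p n b] /\
  ln (E n) @[n --> \oo] --> 0 /\
  forall k : nat, (\sum_(i < (N n).+1) p n i * (c n * E n ^+ i) `^ (- (k%:R / q))) /
       (\sum_(i < (N n).+1) p n i) @[n --> \oo] -->
     Gam k%:R / (Gam (k%:R / q) * Gam (k%:R * alpha)).
Proof.
move=> cG G0.
have kq0 (k : nat) : 0 <= k%:R / q by rewrite divr_ge0// ltW.
(* The approximation error is later multiplied by a power of [scale], hence a tolerance divided by a
   bound for all powers with [k <= n]. The summand 1 ensures [S n >= 1], so that the tolerance also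
   forces the mesh below [1 / (n + 1)]. *)
pose S n := 1 + \sum_(k < n.+1) scale n.+1 `^ (k%:R / q).
have S0 n : 0 < S n by rewrite ltr_pwDl// sumr_ge0// => k _; exact: powR_ge0.
have Sk n k : (k <= n)%N -> scale n.+1 `^ (k%:R / q) <= S n.
  move=> kn; have kn1 : (k < n.+1)%N by [].
  rewrite /S (bigD1 (Ordinal kn1))//= addrCA lerDl addr_ge0// sumr_ge0// => i _.
  exact: powR_ge0.
have ex n : exists hp : R * {poly R}, [/\ 0 < hp.1, hp.1 <= n.+1%:R^-1 / S n,
    tp2 (fun i => hp.2`_i), 0 < hp.2`_0 & forall k, (k <= n)%N ->
    `|hp.2.[expR (- (hp.1 * (k%:R / q)))] / hp.2.[1] - \prod_(j < n.+1.*2)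
     ((1 + k%:R / q / y j) / ((1 + k%:R / q / x j) * (1 + k%:R / q / x' j)))|
     <= n.+1%:R^-1 / S n].
  have e0 : 0 < n.+1%:R^-1 / S n by rewrite divr_gt0// invr_gt0.
  have [h [p [? ? ? ? ?]]] := lattice_approximation n.+1.*2 x0 xx' x'y n kq0 e0.
  by exists (h, p).
have [hp Hhp] := choice ex.
pose h n := (hp n).1; pose P n := (hp n).2.
have sP n : ((size (P n)).-1.+1 = size (P n))%N.
  have [_ _ _ h4 _] := Hhp n; rewrite prednK// lt0n size_poly_eq0.
  by apply: contraTneq h4 => E; rewrite -/(P n) E coef0 ltxx.
exists (fun n => (size (P n)).-1), (fun n i => (P n)`_i), (fun n => (scale n.+1)^-1),
  (fun n => expR (h n)).
have h0 n : 0 < h n by case: (Hhp n).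
have Sn1 n : 1 <= S n by rewrite lerDl sumr_ge0// => k _; exact: powR_ge0.
have hle n : h n <= n.+1%:R^-1.
  have [_ h2 _ _ _] := Hhp n; apply: (le_trans h2).
  by rewrite ler_pdivrMr// ler_peMr// invr_ge0.
split; last split.
- split => n.
  + by rewrite invr_gt0 scale_gt0.
  + by rewrite expR_gt1.
  + move=> i; rewrite -ltnS sP => isz.
    by have [_ _ h3 h4 _] := Hhp n; exact: (tp2_gt0 h3 h4).
  + move=> a b ab _; have [_ _ [_ h3] _ _] := Hhp n.
    by have := h3 a b 1%N ab; rewrite !addn1.
- under eq_fun do rewrite expRK.
  apply: (squeeze_cvgr _ (cvg_cst 0) (@cvg_harmonic R)).
  by near=> n; rewrite hle ltW.
move=> k.
have c1 : scale n.+1 `^ (k%:R / q) *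
  \prod_(j < n.+1.*2) ((1 + k%:R / q / y j) / ((1 + k%:R / q / x j) * (1 + k%:R / q / x' j)))
  @[n --> \oo] --> Gam k%:R / (Gam (k%:R / q) * Gam (k%:R * alpha)).
  under eq_fun do rewrite scaled_prod//.
  have shift (f : nat -> R) (l : R) : f n @[n --> \oo] --> l -> f n.+1 @[n --> \oo] --> l.
    by move=> fl; rewrite -(cvg_shiftS f) in fl.
  have ka0 : 0 <= k%:R * alpha by rewrite mulr_ge0// ltW.
  apply: cvgM.
    apply: (shift (fun n => gauss_product k%:R (4 * n))).
    apply: (cvg_comp (fun n => 4 * n)%N (gauss_product k%:R) _ (cG _ (ler0n R k))).
    by move=> B [M _ HM]; exists M => // m /= Mm; apply: HM => /=; lia.
  apply: cvgV; first by rewrite mulf_neq0// G0.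
  by apply: cvgM; apply: shift; exact: cG.
set C := (X in X @ _ --> _) in c1.
set T := (X in X @ _ --> _).
(* The rates are powers of [E n] divided by [scale n.+1], so their power [- k / q] splits off this
   factor. *)
have TE n : T n = scale n.+1 `^ (k%:R / q) *
    ((P n).[expR (- (h n * (k%:R / q)))] / (P n).[1]).
  rewrite /T sP !horner_coef mulrA; congr (_ / _); last first.
    by apply: eq_bigr => i _; rewrite expr1n mulr1.
  rewrite mulr_sumr; apply: eq_bigr => i _; rewrite mulrCA; congr (_ * _).
  have Si0 : 0 <= (scale n.+1)^-1 by rewrite invr_ge0 ltW// scale_gt0.
  rewrite powRM ?exprn_ge0 ?expR_ge0//; congr (_ * _).
    have /powR_inv1 <- : 0 <= scale n.+1 by rewrite ltW// scale_gt0.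
    by rewrite -powRrM mulN1r opprK.
  by rewrite -!expRM_natr -expRM; congr expR; ring.
have TC : T n - C n @[n --> \oo] --> 0.
  apply: norm_cvg0.
  apply: (squeeze_cvgr _ (cvg_cst 0) (@cvg_harmonic R)).
  near=> n; rewrite normr_ge0/= TE /C -mulrBr normrM ger0_norm ?powR_ge0//.
  have kn : (k <= n)%N by near: n; exact: nbhs_infty_ge.
  have [_ _ _ _ h5] := Hhp n.
  apply: (le_trans (ler_wpM2l (powR_ge0 _ _) (h5 k kn))).
  rewrite mulrA ler_pdivrMr// mulrC ler_wpM2l ?invr_ge0//.
  exact: Sk.
have -> : T = (fun n => (T n - C n) + C n) by apply/funext => n; rewrite subrK.
by rewrite -[X in _ --> X]add0r; exact: cvgD.
Unshelve. all: by end_near. Qed.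
End LatticeMoments.

(** * The Gamma function *)

Lemma continuous_powR_gt0 (R : realType) (s x : R) : 0 < x ->
  {for x, continuous (fun x => x `^ s)}.
Proof. by move=> x0; exact: is_derive_continuous (is_derive1_powR s x0). Qed.

Lemma powR_cvg_at_right0 (R : realType) (s : R) : 0 <= s ->
  x `^ s @[x --> 0^'+] --> 0 `^ s.
Proof.
rewrite le_eqVlt => /predU1P[<-|s0].
  by under eq_fun do rewrite powRr0; rewrite powRr0; exact: cvg_cst.
by rewrite (powR0 (lt0r_neq0 s0)); exact: powR_cvg0.
Qed.

Lemma integral_powR_segment (R : realType) (s b : R) : 0 <= s -> 0 < b ->
  (\int[@lebesgue_measure R]_(v in `]0%R, b[) ((s + 1) * v `^ s)%:E =
   (b `^ (s + 1))%:E)%E.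
Proof.
move=> s0 b0.
have s1 : 0 < s + 1 by rewrite ltr_wpDl.
have mf (D : set R) : measurable_fun D (fun v => ((s + 1) * v `^ s)%:E).
  apply: measurable_funTS; apply/measurable_EFinP; exact: measurable_funM.
rewrite integral_itv_bndo_bndc// integral_itv_obnd_cbnd//.
rewrite (@continuous_FTC2 _ _ (fun v => v `^ (s + 1)) _ _ b0).
- by rewrite powR0 ?sube0// gt_eqF.
- apply/continuous_within_itvP => //; split.
  + move=> v; rewrite in_itv/= => /andP[v0 _].
    by apply: cvgM; [exact: cvg_cst|exact: continuous_powR_gt0].
  + by apply: cvgM; [exact: cvg_cst|exact: powR_cvg_at_right0].
  + apply: cvgM; first exact: cvg_cst.
    by apply: cvg_at_left_filter; exact: continuous_powR_gt0.
- split.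
  + by move=> v; rewrite in_itv/= => /andP[v0 _]; case: (is_derive1_powR (s + 1) v0).
  + by apply: powR_cvg_at_right0; exact: ltW.
  + by apply: cvg_at_left_filter; exact: continuous_powR_gt0.
- move=> v; rewrite in_itv/= => /andP[v0 _]; rewrite derive1E.
  by have [_ ->] := is_derive1_powR (s + 1) v0; rewrite addrK.
Qed.

Lemma integral_expRN_tail (R : realType) (c : R) : 0 <= c ->
  (\int[@lebesgue_measure R]_(l in `]c, +oo[) (expR (- l))%:E = (expR (- c))%:E)%E.
Proof.
move=> c0.
have df (u : R) : is_derive u 1 (fun u => - expR (- u)) (expR (- u)).
  by apply: is_derive_eq; rewrite /GRing.scale/=; ring.
have df' (u : R) : is_derive u 1 (fun u => expR (- u)) (- expR (- u)).
  by apply: is_derive_eq; rewrite /GRing.scale/=; ring.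
have cf : continuous (fun u : R => expR (- u)).
  by move=> u; exact: is_derive_continuous (df' u).
rewrite integral_itv_obnd_cbnd; last first.
  apply/measurable_EFinP; apply: measurable_funTS.
  exact: continuous_measurable_fun.
rewrite (@ge0_continuous_FTC2y _ _ (fun u => - expR (- u)) c 0).
- by rewrite sub0e EFinN oppeK.
- by move=> x _; exact: expR_ge0.
- exact: continuous_subspaceT.
- by rewrite -oppr0; apply: cvgN; exact: cvgr_expR.
- by move=> x _; case: (df x).
- by apply: cvg_at_right_filter; apply: cvgN; exact: cf.
- by move=> x _; rewrite derive1E; case: (df x).
Qed.

(* Layer cake: [expR (- v `^ a * z)] is the mass that the standard exponential law
   gives to [l > v `^ a * z]. *)
Lemma integral_powR_expRN (R : realType) (s a z : R) : 0 <= s -> 0 < a -> 0 < z ->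
  (\int[@lebesgue_measure R]_(v in `]0%R, +oo[)
     ((s + 1) * v `^ s * expR (- (v `^ a * z)))%:E =
   \int[@lebesgue_measure R]_(l in `]0%R, +oo[)
     ((l / z) `^ ((s + 1) / a) * expR (- l))%:E)%E.
Proof.
move=> s0 a0 z0; pose mu := @lebesgue_measure R.
have s1 : 0 < s + 1 by rewrite ltr_wpDl.
pose f (w : R * R) : \bar R :=
  (if w.1 `^ a * z < w.2 then (s + 1) * w.1 `^ s * expR (- w.2) else 0)%:E.
have mf (D : set (R * R)) : @measurable_fun _ _ (R * R)%type (\bar R) D f.
  apply: measurable_funTS; apply/measurable_EFinP.
  apply: measurable_fun_ifT => //.
    apply: measurable_fun_ltr; last exact: measurable_snd.
    apply: measurable_funM => //.
    by apply: (measurableT_comp (@measurable_powR R a)).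
  apply: measurable_funM; first apply: measurable_funM => //.
    by apply: (measurableT_comp (@measurable_powR R s)).
  by apply: measurableT_comp => //; apply: measurableT_comp.
transitivity (\int[mu]_(v in `]0%R, +oo[) \int[mu]_(l in `]0%R, +oo[) f (v, l))%E.
  apply: eq_integral => v; rewrite inE/= in_itv/= andbT => v0.
  have c0 : 0 <= v `^ a * z by rewrite mulr_ge0 ?powR_ge0// ltW.
  rewrite EFinM -integral_expRN_tail// -ge0_integralZl_EFin//; last 2 first.
  - apply/measurable_EFinP; apply: measurable_funTS.
    by apply: measurableT_comp => //; apply: measurableT_comp.
  - by rewrite mulr_ge0 ?powR_ge0// ltW.
  rewrite [LHS]integral_mkcond [RHS]integral_mkcond; apply: eq_integral => l _.
  rewrite /f !patchE !mem_setE !in_itv/= !andbT.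
  case: (ltP (v `^ a * z) l) => h; first by rewrite (le_lt_trans c0 h).
  by case: ifP.
have f0 v l : `]0%R, +oo[%classic v -> `]0%R, +oo[%classic l -> (0 <= f (v, l))%E.
  move=> _ _; rewrite /f/= lee_fin; case: ifP => // _.
  by rewrite !mulr_ge0 ?powR_ge0 ?expR_ge0// ltW.
have -> := @fubini_tonelli_on _ _ _ _ _ (@lebesgue_measure R) (@lebesgue_measure R)
  _ _ f (measurable_itv _) (measurable_itv _) (mf _) f0.
apply: eq_integral => l; rewrite inE/= in_itv/= andbT => l0.
(* For fixed [l] the inner domain is [v < th], and the integral of [(s + 1) * v ^ s] over it is the
   power [s + 1] of [th]. *)
pose th := (l / z) `^ a^-1.
have lz0 : 0 < l / z by rewrite divr_gt0.
have th0 : 0 < th by rewrite powR_gt0.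
have thP v : 0 < v -> (v `^ a * z < l) = (v < th).
  move=> v0; rewrite -ltr_pdivlMr//.
  have -> : l / z = th `^ a by rewrite /th -powRrM mulVf ?gt_eqF// powRr1// ltW.
  apply/idP/idP => h; last by rewrite gt0_ltr_powR// nnegrE ltW.
  rewrite ltNge; apply/negP => tv; move: h; rewrite ltNge => /negP; apply.
  by rewrite ge0_ler_powR ?nnegrE// ltW.
transitivity (\int[mu]_(v in `]0%R, th[) ((expR (- l))%:E * ((s + 1) * v `^ s)%:E))%E.
  rewrite [LHS]integral_mkcond [RHS]integral_mkcond; apply: eq_integral => v _.
  rewrite /f !patchE !mem_setE !in_itv/= andbT.
  case: (ltP 0 v) => v0 //=; rewrite thP//; case: ifP => _ //.
  by rewrite mulrC EFinM.
rewrite ge0_integralZl_EFin ?expR_ge0//; last 2 first.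
- by move=> v _; rewrite lee_fin mulr_ge0 ?powR_ge0// ltW.
- apply/measurable_EFinP; apply: measurable_funTS; exact: measurable_funM.
rewrite integral_powR_segment// -EFinM mulrC /th -powRrM.
by rewrite [a^-1 * _]mulrC.
Qed.

(* Gamma(1 + s), so that the values at natural numbers are the factorials. *)
Definition gamma_succ (R : realType) (s : R) : R :=
  fine (\int[@lebesgue_measure R]_(x in `]0%R, +oo[) (x `^ s * expR (- x))%:E)%E.

Section GammaSucc.
Variable R : realType.
Implicit Types s x a : R.
Let mu := @lebesgue_measure R.
Let G s := (\int[mu]_(x in `]0%R, +oo[) (x `^ s * expR (- x))%:E)%E.

Let measurable_Gfun s (D : set R) : measurable_fun D (fun x => (x `^ s * expR (- x))%:E).
Proof.
apply: measurable_funTS; apply/measurable_EFinP; apply: measurable_funM.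
  exact: measurable_powR.
by apply: measurableT_comp => //; apply: measurableT_comp.
Qed.

Let Gfun_ge0 s x : (0 <= (x `^ s * expR (- x))%:E)%E.
Proof. by rewrite lee_fin mulr_ge0 ?powR_ge0 ?expR_ge0. Qed.

Let G_ge0 s : (0 <= G s)%E.
Proof. by apply: integral_ge0 => x _; exact: Gfun_ge0. Qed.

Let G0 : G 0 = 1%E.
Proof.
have := @integral_expRN_tail R 0 (lexx 0); rewrite oppr0 expR0 => <-.
by apply: eq_integral => x _; rewrite powRr0 mul1r.
Qed.

(** The layer cake identity with [a = z = 1] replaces the integration by parts; it holds in the
    extended reals, hence before finiteness is known. *)
Let GS s : 0 <= s -> G (s + 1) = ((s + 1)%:E * G s)%E.
Proof.
move=> s0; rewrite /G -ge0_integralZl_EFin//; last 2 first.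
- exact: measurable_Gfun.
- by rewrite addr_ge0.
have := integral_powR_expRN s0 (ltr01 : 0 < (1 : R)) (ltr01 : 0 < (1 : R)).
rewrite divr1 => E; transitivity (\int[mu]_(l in `]0%R, +oo[)
     ((l / 1) `^ (s + 1) * expR (- l))%:E)%E.
  by apply: eq_integral => x _; rewrite divr1.
rewrite -E; apply: eq_integral => x; rewrite inE/= in_itv/= andbT => x0.
by rewrite powRr1 ?(ltW x0)// mulr1 -mulrA EFinM.
Qed.

(** The right-hand side is the tangent at [a] of the concave power function. With [L = ln (x / a)],
    it follows from the tangent of the exponential at [L * s], evaluated at 0 and at [L] and
    averaged with weights [1 - s] and [s]. *)
Lemma powR_young s x a : 0 <= s <= 1 -> 0 <= x -> 0 < a ->
  x `^ s <= a `^ s * (1 - s + s * (x / a)).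
Proof.
move=> /andP[s0 s1]; rewrite le_eqVlt => /predU1P[<-|x0] a0.
  rewrite mul0r mulr0 addr0; have [->|sn0] := eqVneq s 0.
    by rewrite !powRr0 subr0 mulr1.
  by rewrite powR0// mulr_ge0 ?powR_ge0// subr_ge0.
have xa0 : 0 < x / a by rewrite divr_gt0.
have {1}-> : x = a * (x / a) by field; rewrite gt_eqF.
rewrite powRM ?(ltW a0) ?(ltW xa0)// ler_wpM2l ?powR_ge0//.
pose L := ln (x / a).
have EL : x / a = expR L by rewrite lnK.
rewrite EL -expRM.
have h1 := expR_ge1Dx (- (L * s)); have h2 := expR_ge1Dx (L * (1 - s)).
have e0 := expR_gt0 (L * s).
have E2 : expR L = expR (L * s) * expR (L * (1 - s)) by rewrite -expRD; congr expR; ring.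
have E3 := expRxMexpNx_1 (L * s).
have k1 : expR (L * s) * (1 - L * s) <= 1 by rewrite -[leRHS]E3 ler_pM2l.
have k2 : expR (L * s) * (1 + L * (1 - s)) <= expR L by rewrite E2 ler_pM2l.
have := ler_wpM2l s0 k2; have s1' : 0 <= 1 - s by lra.
by have := ler_wpM2l s1' k1; lra.
Qed.

(** [fine] sends an infinite integral to 0, so finiteness is the point: on [[0, 1]] the power is at
    most [1 + x], and the functional equation does the rest. *)
Lemma gamma_succE s : 0 <= s ->
  (\int[mu]_(x in `]0%R, +oo[) (x `^ s * expR (- x))%:E = (gamma_succ s)%:E)%E.
Proof.
suff fin : forall n s, 0 <= s <= n.+1%:R -> (G s < +oo)%E.
  move=> s0; rewrite /gamma_succ fineK// ge0_fin_numE ?(G_ge0 s)//.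
  apply: (fin (Num.truncn s)); rewrite s0/= ltW//.
  by have /andP[] := truncn_itv s0.
have fin01 t : 0 <= t <= 1 -> (G t < +oo)%E.
  move=> t01; apply: (@le_lt_trans _ _ (G 0 + G 1)%E).
    have -> : (G 0 + G 1 = \int[mu]_(x in `]0%R, +oo[)
        ((x `^ 0 * expR (- x))%:E + (x `^ 1 * expR (- x))%:E))%E.
      by rewrite ge0_integralD//; exact: measurable_Gfun.
    apply: ge0_le_integral => //; first exact: measurable_Gfun.
      by apply: emeasurable_funD; exact: measurable_Gfun.
    move=> x; rewrite /= in_itv/= andbT => x0.
    rewrite -EFinD lee_fin -mulrDl ler_wpM2r ?expR_ge0//.
    have := powR_young t01 (ltW x0) ltr01; rewrite powR1 mul1r divr1 => h.
    rewrite powRr0 powRr1 ?(ltW x0)//; apply: (le_trans h).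
    by move: t01 => /andP[? ?]; nra.
  by have := GS (lexx 0); rewrite add0r G0 => ->; rewrite mule1 -EFinD ltry.
elim=> [|n IH] t /andP[t0 tn]; first by apply: fin01; rewrite t0.
have [t1|t1] := leP t 1; first by apply: fin01; rewrite t0.
have t10 : 0 <= t - 1 by rewrite subr_ge0 ltW.
have -> : G t = ((t - 1 + 1)%:E * G (t - 1))%E by rewrite -GS// subrK.
apply: lte_mul_pinfty => //; first by rewrite lee_fin addr_ge0.
apply: IH; rewrite t10/=.
by move: tn; rewrite [X in _ <= X -> _]mulrSr lerBlDr.
Qed.

Lemma gamma_succ0 : gamma_succ 0 = 1 :> R.
Proof. by apply: EFin_inj; rewrite -gamma_succE// G0. Qed.

Lemma gamma_succS s : 0 <= s -> gamma_succ (s + 1) = (s + 1) * gamma_succ s.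
Proof.
move=> s0; apply: EFin_inj; rewrite EFinM -!gamma_succE ?addr_ge0//.
exact: GS.
Qed.

Lemma gamma_succ_fact n : gamma_succ n%:R = n`!%:R :> R.
Proof.
elim: n => [|n IH]; first by rewrite gamma_succ0 fact0.
by rewrite -natr1 gamma_succS// IH factS natrM natr1.
Qed.

Lemma gamma_succ_prod s n : 0 <= s ->
  gamma_succ (s + n%:R) = \prod_(j < n) (s + j.+1%:R) * gamma_succ s.
Proof.
move=> s0; elim: n => [|n IH]; first by rewrite addr0 big_ord0 mul1r.
rewrite -natr1 addrA gamma_succS ?addr_ge0// IH big_ord_recr/= -natr1 addrA.
by rewrite mulrA [X in X * _]mulrC.
Qed.

(** Only the tail beyond [a] is kept, where the power is at least its value at [a]. The free
    parameter [a] later yields growth faster than any geometric sequence. *)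
Lemma gamma_succ_ge s a : 0 <= s -> 0 < a -> a `^ s * expR (- a) <= gamma_succ s.
Proof.
move=> s0 a0; rewrite -lee_fin -gamma_succE//.
have mE (D : set R) : measurable_fun D (fun x => (expR (- x))%:E).
  apply/measurable_EFinP; apply: measurable_funTS.
  by apply: measurableT_comp => //; apply: measurableT_comp.
have -> : ((a `^ s * expR (- a))%:E =
    \int[mu]_(x in `]a, +oo[) ((a `^ s)%:E * (expR (- x))%:E))%E.
  rewrite ge0_integralZl_EFin ?powR_ge0//; first by rewrite integral_expRN_tail// ltW.
  exact: mE.
apply: (@le_trans _ _ (\int[mu]_(x in `]a, +oo[) (x `^ s * expR (- x))%:E)%E).
  apply: ge0_le_integral => //.
  - by move=> x _; rewrite mule_ge0 ?lee_fin ?powR_ge0 ?expR_ge0.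
  - by apply: measurable_funeM; exact: mE.
  - exact: measurable_Gfun.
  move=> x; rewrite /= in_itv/= andbT => ax.
  rewrite -EFinM lee_fin ler_wpM2r ?expR_ge0//.
  by rewrite ge0_ler_powR ?nnegrE ?(ltW a0) ?(ltW ax)// ltW// (lt_trans a0 ax).
apply: ge0_subset_integral => //; first exact: measurable_Gfun.
by move=> x; rewrite /= !in_itv/= !andbT; exact: lt_trans.
Qed.

Lemma gamma_succ_gt0 s : 0 <= s -> 0 < gamma_succ s.
Proof.
move=> s0; apply: lt_le_trans (gamma_succ_ge s0 ltr01).
by rewrite powR1 mul1r expR_gt0.
Qed.

(* Integrate Young's inequality [x `^ s <= a `^ s * (1 - s + s * x / a)] against
   [x `^ r * expR (- x)]. *)
Lemma gamma_succ_young r s a : 0 <= r -> 0 <= s <= 1 -> 0 < a ->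
  gamma_succ (r + s) <=
    a `^ s * ((1 - s) * gamma_succ r + s / a * gamma_succ (r + 1)).
Proof.
move=> r0 s01 a0; have /andP[s0 s1] := s01.
have s1' : 0 <= 1 - s by rewrite subr_ge0.
have sa : 0 <= s / a by rewrite divr_ge0// ltW.
set A := a `^ s * (1 - s); set B := a `^ s * (s / a).
have A0 : 0 <= A by rewrite mulr_ge0 ?powR_ge0.
have B0 : 0 <= B by rewrite mulr_ge0 ?powR_ge0.
have -> : a `^ s * ((1 - s) * gamma_succ r + s / a * gamma_succ (r + 1)) =
  A * gamma_succ r + B * gamma_succ (r + 1) by rewrite /A /B; ring.
pose g c t (x : R) := (c%:E * (x `^ t * expR (- x))%:E)%E.
have mg c t : measurable_fun (`]0, +oo[%classic : set R) (g c t).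
  by apply: measurable_funeM; exact: measurable_Gfun.
have g0 c t x : 0 <= c -> (0 <= g c t x)%E by move=> c0; apply: mule_ge0.
have intg c t : 0 <= c -> 0 <= t ->
    (\int[mu]_(x in `]0%R, +oo[) g c t x = (c * gamma_succ t)%:E)%E.
  move=> c0 t0; rewrite /g ge0_integralZl_EFin//; last exact: measurable_Gfun.
  by rewrite gamma_succE.
rewrite -lee_fin EFinD -!intg ?addr_ge0// -gamma_succE ?addr_ge0//.
have g1 x : `]0, +oo[%classic x -> (0 <= g A r x)%E by move=> _; exact: g0.
have g2 x : `]0, +oo[%classic x -> (0 <= g B (r + 1)%R x)%E by move=> _; exact: g0.
have <- := @ge0_integralD _ _ _ mu _ (measurable_itv _) _ _ g1 (mg _ _) g2 (mg _ _).
apply: ge0_le_integral => //; first exact: measurable_Gfun.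
  by apply: emeasurable_funD; exact: mg.
move=> x; rewrite /= in_itv/= andbT => x0.
rewrite /g /A /B -!EFinM -EFinD lee_fin !mulrA -mulrDl ler_wpM2r ?expR_ge0//.
have xn0 : x != 0 by rewrite gt_eqF.
rewrite !powRD ?xn0 ?implybT// powRr1 ?(ltW x0)//.
have := ler_wpM2l (powR_ge0 x r) (powR_young s01 (ltW x0) a0).
by move=> h; apply: (le_trans h); rewrite le_eqVlt; apply/orP; left; apply/eqP; ring.
Qed.
End GammaSucc.

(** Gauss's formula is thereby reduced to a ratio tending to 1, namely [Gamma (1 + s + N)] compared
    with [N^s N!]. *)
Lemma gauss_productE (R : realType) (s : R) (N : nat) : 0 <= s ->
  gauss_product s N = gamma_succ s * (N%:R `^ s * N`!%:R / gamma_succ (s + N%:R)).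
Proof.
move=> s0; rewrite gamma_succ_prod// /gauss_product.
have G0 := gamma_succ_gt0 s0.
have P0 : 0 < \prod_(j < N) (s + j.+1%:R) :> R.
  by apply: prodr_gt0 => j _; rewrite ltr_wpDl.
have -> : \prod_(j < N) (1 + s / j.+1%:R) = \prod_(j < N) (s + j.+1%:R) / N`!%:R :> R.
  elim: N {P0} => [|N IH]; first by rewrite !big_ord0 fact0 divr1.
  rewrite !big_ord_recr/= IH factS natrM; field.
  by rewrite pnatr_eq0 -lt0n fact_gt0/= addrC natr1 pnatr_eq0.
by field; rewrite pnatr_eq0 -lt0n fact_gt0 !gt_eqF.
Qed.

(** The Bohr-Mollerup squeeze: Young's inequality is used from [N] up to [N + s], and from [N + s]
    up to [N + 1]. The ratio ends up between [1 - 1 / (N + 1)] and [1 + s / (N + 1)]. *)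
Lemma cvg_gauss_product01 (R : realType) (s : R) : 0 <= s <= 1 ->
  gauss_product s N @[N --> \oo] --> gamma_succ s.
Proof.
move=> s01; have /andP[s0 s1] := s01.
suff cu : N%:R `^ s * N`!%:R / gamma_succ (s + N%:R) @[N --> \oo] --> (1 : R).
  rewrite (_ : gauss_product s = fun N =>
      gamma_succ s * (N%:R `^ s * N`!%:R / gamma_succ (s + N%:R))); last first.
    by apply/funext => N; exact: gauss_productE.
  by rewrite -[X in _ --> X]mulr1; apply: cvgM => //; exact: cvg_cst.
have l1 : 1 - @harmonic R N @[N --> \oo] --> 1 - (0 : R).
  by apply: cvgB; [exact: cvg_cst|exact: cvg_harmonic].
have l2 : 1 + s * @harmonic R N @[N --> \oo] --> 1 + s * 0.
  by apply: cvgD; [exact: cvg_cst|apply: cvgM; [exact: cvg_cst|exact: cvg_harmonic]].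
rewrite subr0 in l1; rewrite mulr0 addr0 in l2.
apply: (squeeze_cvgr _ l1 l2); near=> N.
have N0 : (0 : R) < N%:R by rewrite ltr0n; near: N; exact: nbhs_infty_gt.
have N1 : (0 : R) < N.+1%:R by [].
have G0 : 0 < gamma_succ (s + N%:R) by rewrite gamma_succ_gt0// addr_ge0.
have F0 : (0 : R) < N`!%:R by rewrite ltr0n fact_gt0.
(* At [a = N + 1], the ratio of the two Gamma values involved, the bracket collapses to the
   factorial of [N]; [a = N + s + 1] plays the same role in [lo]. *)
have up := gamma_succ_young (ler0n R N) s01 N1.
rewrite natr1 !gamma_succ_fact factS natrM [X in _ <= _ * X](_ : _ = N`!%:R) in up; last first.
  by field; rewrite gt_eqF.
have a0 : 0 < N%:R + s + 1 by rewrite ltr_wpDl// addr_ge0// ltW.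
have s1' : 0 <= 1 - s <= 1 by apply/andP; split; lra.
have lo := @gamma_succ_young _ (N%:R + s) (1 - s) _ (addr_ge0 (ler0n R N) s0) s1' a0.
rewrite gamma_succS ?addr_ge0// (_ : N%:R + s + (1 - s) = N.+1%:R) in lo; last first.
  by rewrite -natr1; ring.
rewrite gamma_succ_fact factS natrM [X in _ <= _ * X](_ : _ = gamma_succ (N%:R + s)) in lo; last first.
  by field; rewrite gt_eqF.
rewrite [N%:R + s]addrC in up lo a0.
have hE : @harmonic R N = N.+1%:R^-1 by [].
rewrite hE; apply/andP; split.
  rewrite ler_pdivlMr//.
  apply: (@le_trans _ _ ((1 - N.+1%:R^-1) * (N.+1%:R `^ s * N`!%:R))).
    rewrite ler_wpM2l// subr_ge0 invf_le1// ler1n//.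
  rewrite mulrA ler_wpM2r ?(ltW F0)//.
  have -> : 1 - N.+1%:R^-1 = N%:R / N.+1%:R :> R.
    by rewrite -natr1; field; rewrite natr1 gt_eqF.
  rewrite mulrC -ler_pdivlMl ?powR_gt0// -powRN.
  have NE : N%:R = N.+1%:R * (N%:R / N.+1%:R) :> R by field; rewrite gt_eqF.
  have b0 : 0 < N%:R / N.+1%:R :> R by rewrite divr_gt0.
  rewrite [X in _ <= _ * X `^ _]NE powRM ?(ltW b0)// mulrA -powRD; last first.
    by rewrite (gt_eqF N1) implybT.
  rewrite addrC subrr powRr0 mul1r ger1_powR// b0/=.
  by rewrite ler_pdivrMr// mul1r ler_nat.
rewrite ler_pdivrMr//.
rewrite -(ler_pM2l N1) mulrCA.
apply: (@le_trans _ _ (N%:R `^ s * ((s + N%:R + 1) `^ (1 - s) * gamma_succ (s + N%:R)))).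
  by rewrite ler_wpM2l ?powR_ge0.
have -> : N.+1%:R * ((1 + s / N.+1%:R) * gamma_succ (s + N%:R)) =
  (s + N%:R + 1) * gamma_succ (s + N%:R).
  by rewrite -natr1; field; rewrite natr1 gt_eqF.
rewrite mulrA ler_wpM2r ?(ltW G0)//.
apply: (@le_trans _ _ ((s + N%:R + 1) `^ s * (s + N%:R + 1) `^ (1 - s))).
  rewrite ler_wpM2r ?powR_ge0// ge0_ler_powR ?nnegrE ?(ltW a0)//.
  by lra.
have ss : s + (1 - s) = 1 by ring.
by rewrite -powRD ?ss ?powRr1 ?(ltW a0)// (gt_eqF a0) implybT.
Unshelve. all: by end_near. Qed.

(** Raising the exponent from [t - 1] to [t] multiplies the product by [t N / (t + N)], which tends
    to [t] as the functional equation requires; this reduces everything to exponents in [[0, 1]]. *)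
Lemma cvg_gauss_product (R : realType) (s : R) : 0 <= s ->
  gauss_product s N @[N --> \oo] --> gamma_succ s.
Proof.
suff H : forall n (s : R), 0 <= s <= n.+1%:R -> gauss_product s N @[N --> \oo] --> gamma_succ s.
  move=> s0; have /andP[_ h] := truncn_itv s0.
  by have := H (Num.truncn s) s; rewrite s0 (ltW h) => /(_ isT).
elim=> [|n IH] t /andP[t0 tn]; first by apply: cvg_gauss_product01; rewrite t0.
have [t1|t1] := leP t 1; first by apply: cvg_gauss_product01; rewrite t0.
have u0 : 0 <= t - 1 by rewrite subr_ge0 ltW.
have cu : gauss_product (t - 1) N @[N --> \oo] --> gamma_succ (t - 1).
  by apply: IH; rewrite u0/=; move: tn; rewrite [X in _ <= X -> _]mulrSr lerBlDr.
have -> : gamma_succ t = gamma_succ (t - 1) * t.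
  by rewrite -{1}(subrK 1 t) gamma_succS// subrK mulrC.
have c1 : t - t ^+ 2 / (t + N%:R) @[N --> \oo] --> t - 0.
  apply: cvgB; first exact: cvg_cst.
  rewrite -(mulr0 (t ^+ 2)); apply: cvgM; first exact: cvg_cst.
  apply: (squeeze_cvgr _ (cvg_cst 0) (@cvg_harmonic R)).
  near=> N; rewrite invr_ge0 addr_ge0//=.
  have t_gt0 : 0 < t by exact: lt_trans t1.
  by rewrite lef_pV2 ?posrE ?ltr0n ?ltr_pwDl// -natr1 addrC lerD2r ltW.
rewrite subr0 in c1.
rewrite (_ : gauss_product t = fun N =>
  gauss_product (t - 1) N * (t - t ^+ 2 / (t + N%:R))); first exact: cvgM.
apply/funext => N; rewrite !gauss_productE//.
have [->|N0] := posnP N.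
  rewrite !mulr0n !addr0 fact0.
  have G1 : gamma_succ (t - 1) != 0 by rewrite gt_eqF// gamma_succ_gt0.
  have G2 : gamma_succ t != 0 by rewrite gt_eqF// gamma_succ_gt0.
  have t10 : t != 0 by rewrite gt_eqF// (lt_trans ltr01).
  rewrite powR0// !mul0r mulr0 expr2 mulfK// subrr mulr0//.
have Nr0 : (0 : R) < N%:R by rewrite ltr0n.
have GE (r : R) : 1 < r -> gamma_succ r = r * gamma_succ (r - 1).
  by move=> r1; rewrite -{1}(subrK 1 r) gamma_succS ?subrK// subr_ge0 ltW.
rewrite (GE t)// (GE (t + N%:R)); last by rewrite ltr_wpDr.
have -> : t + N%:R - 1 = t - 1 + N%:R by ring.
have G1 : gamma_succ (t - 1 + N%:R) != 0 by rewrite gt_eqF// gamma_succ_gt0// addr_ge0.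
have tN : t + N%:R != 0 by rewrite gt_eqF// ltr_wpDl.
have -> : N%:R `^ t = N%:R `^ (t - 1) * N%:R.
  have := @powRD R N%:R (t - 1) 1.
  by rewrite subrK (gt_eqF Nr0) implybT powRr1 ?(ltW Nr0)// => /(_ isT).
by field; rewrite G1 tN.
Unshelve. all: by end_near. Qed.

(** * The method of moments *)

Lemma segment_unif_continuous (R : realType) (G : R -> R) (a b e : R) :
  continuous G -> 0 < e -> exists2 d : R, 0 < d &
  forall x y, a <= x <= b -> a <= y <= b -> `|x - y| < d -> `|G x - G y| < e.
Proof.
move=> cG e0; apply: contrapT => H.
have ex n : exists xy : R * R, [/\ a <= xy.1 <= b, a <= xy.2 <= b,
    `|xy.1 - xy.2| < n.+1%:R^-1 & e <= `|G xy.1 - G xy.2|].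
  apply: contrapT => Hn; apply: H; exists n.+1%:R^-1; first by rewrite invr_gt0.
  move=> x y xab yab xy; rewrite ltNge; apply/negP => eG.
  by apply: Hn; exists (x, y).
have [u hu] := choice ex.
have bu : bounded_fun (fun n => (u n).1).
  exists (`|a| + `|b|); split; first by rewrite realE addr_ge0.
  move=> M HM n _ /=; have [/andP[h1 h2] _ _ _] := hu n; apply: le_trans (ltW HM).
  have := ler_norm (- a); have := ler_norm b; rewrite normrN => ? ?.
  have := normr_ge0 a; have := normr_ge0 b => ? ?.
  by rewrite ler_norml; apply/andP; split; lra.
have [f incf cu] := bolzano_weierstrass bu.
have fge n : (n <= f n)%N.
  elim: n => // n IH; apply: leq_ltn_trans IH _.
  by have := incf n.+1 n; rewrite !leEnat => h; rewrite ltnNge h -ltnNge.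
pose l : R := lim ((fun n => (u n).1) \o f @ \oo).
have c1 : (u (f n)).1 @[n --> \oo] --> l by exact: cu.
have c0 : (u (f n)).2 - (u (f n)).1 @[n --> \oo] --> 0.
  apply: norm_cvg0; apply: (squeeze_cvgr _ (cvg_cst 0) (@cvg_harmonic R)).
  near=> n; rewrite normr_ge0/= distrC.
  have [_ _ h _] := hu (f n); apply: (le_trans (ltW h)).
  by rewrite /harmonic lef_pV2 ?posrE// ler_nat ltnS.
have c2 : (u (f n)).2 @[n --> \oo] --> l.
  rewrite (_ : (fun n => _) = fun n => ((u (f n)).2 - (u (f n)).1) + (u (f n)).1).
    by rewrite -[l]add0r; exact: cvgD.
  by apply/funext => n; rewrite subrK.
have g1 : G (u (f n)).1 - G (u (f n)).2 @[n --> \oo] --> G l - G l.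
  by apply: cvgB; apply: (continuous_cvg _ (cG l)).
rewrite subrr in g1.
have /cvgrPdist_lt/(_ _ e0) [n _ /(_ n (leqnn n)) /=] := g1.
rewrite sub0r normrN => h.
by have [_ _ _] := hu (f n); rewrite leNgt h.
Unshelve. all: by end_near. Qed.

(** * Weierstrass approximation by Bernstein polynomials *)

Section Bernstein.
Variable R : realType.
Implicit Types (f g : nat -> R) (x : R).

(* [(bernstein n f).[x]] is the expectation of [f] under the binomial law (n, x),
   defined by conditioning on the first trial. *)
Fixpoint bernstein n f : {poly R} :=
  if n is m.+1 then
    (1 - 'X) * bernstein m f + 'X * bernstein m (fun k => f k.+1)
  else (f 0%N)%:P.

Let bernsteinS n f x : (bernstein n.+1 f).[x] =
  (1 - x) * (bernstein n f).[x] + x * (bernstein n (fun k => f k.+1)).[x].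
Proof. by rewrite /= hornerD !hornerM hornerD hornerN hornerX hornerC. Qed.

Lemma le_bernstein n f g x : 0 <= x <= 1 ->
  (forall k, (k <= n)%N -> f k <= g k) -> (bernstein n f).[x] <= (bernstein n g).[x].
Proof.
move=> /andP[x0 x1]; elim: n f g => [|n IH] f g fg.
  by rewrite /= !hornerC; exact: fg.
rewrite !bernsteinS; apply: lerD.
  by rewrite ler_wpM2l ?subr_ge0//; apply: IH => k kn; apply: fg; exact: ltnW.
by rewrite ler_wpM2l//; apply: IH => k kn; exact: fg.
Qed.

Lemma bernstein_lin n f g (a b x : R) : (bernstein n (fun k => a * f k + b * g k)).[x] =
  a * (bernstein n f).[x] + b * (bernstein n g).[x].
Proof.
elim: n f g => [|n IH] f g; first by rewrite /= !hornerC.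
by rewrite !bernsteinS !IH; ring.
Qed.

Lemma bernstein_cst n (c x : R) : (bernstein n (fun=> c)).[x] = c.
Proof.
by elim: n => [|n IH]; rewrite ?bernsteinS ?IH ?hornerC//; ring.
Qed.

Lemma bernstein_id n x : (bernstein n (fun k => k%:R)).[x] = n%:R * x.
Proof.
elim: n => [|n IH]; first by rewrite /= hornerC mul0r.
rewrite bernsteinS IH.
have -> : (fun k => k.+1%:R) = (fun k => 1 * k%:R + 1 * 1) :> (nat -> R).
  by apply/funext => k; rewrite mul1r mulr1 natr1.
by rewrite bernstein_lin IH bernstein_cst -natr1; ring.
Qed.

Lemma bernstein_sqr n x : (bernstein n (fun k => k%:R ^+ 2)).[x] =
  n%:R * x * (1 - x) + n%:R ^+ 2 * x ^+ 2.
Proof.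
elim: n => [|n IH]; first by rewrite /= hornerC; ring.
rewrite bernsteinS IH.
have -> : (fun k => k.+1%:R ^+ 2) =
    (fun k => 1 * k%:R ^+ 2 + 1 * (2 * k%:R + 1 * 1)) :> (nat -> R).
  by apply/funext => k; rewrite -natr1; ring.
by rewrite !bernstein_lin IH bernstein_id bernstein_cst -natr1; ring.
Qed.

Lemma bernstein_variance n x : (0 < n)%N ->
  (bernstein n (fun k => (k%:R / n%:R - x) ^+ 2)).[x] = x * (1 - x) / n%:R.
Proof.
move=> n0; have n0' : n%:R != 0 :> R by rewrite pnatr_eq0 -lt0n.
have -> : (fun k => (k%:R / n%:R - x) ^+ 2) = (fun k => n%:R ^- 2 * k%:R ^+ 2 +
    1 * ((- (2 * x / n%:R)) * k%:R + x ^+ 2 * 1)).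
  by apply/funext => k; field.
by rewrite !bernstein_lin bernstein_sqr bernstein_id bernstein_cst; field.
Qed.

Lemma weierstrass_approximation (G : R -> R) (e : R) : continuous G -> 0 < e ->
  exists p : {poly R}, forall x, 0 <= x <= 1 -> `|G x - p.[x]| <= e.
Proof.
move=> cG e0; have e2 : 0 < e / 2 by rewrite divr_gt0.
have [d d0 hd] := segment_unif_continuous 0 1 cG e2.
have [M M0 hM] : exists2 M : R, 0 < M & forall x, 0 <= x <= 1 -> `|G x| <= M.
  have cnG : {within `[0, 1], continuous (fun x => `|G x|)}.
    by apply: continuous_subspaceT => x; apply: cvg_norm; exact: cG.
  have [c _ hc] := EVT_max (@ler01 R) cnG.
  exists (`|G c| + 1); first by rewrite ltr_wpDl.
  by move=> x x01; apply: (le_trans (hc x _)); rewrite ?in_itv// lerDl.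
(* With this constant [C * (y - x) ^+ 2] exceeds [2 * M] once [y] is at distance [d] from [x]. One
   quadratic majorant then covers near and far points, and its binomial expectation is a variance of
   order [1 / n]. *)
pose C := 2 * M / d ^+ 2.
have C0 : 0 < C by rewrite divr_gt0 ?exprn_gt0// mulr_gt0.
have key x y : 0 <= x <= 1 -> 0 <= y <= 1 -> `|G x - G y| <= e / 2 + C * (y - x) ^+ 2.
  move=> x01 y01; have [xy|xy] := ltP `|x - y| d.
    apply: (le_trans (ltW (hd _ _ x01 y01 xy))).
    by rewrite lerDl mulr_ge0 ?sqr_ge0// ltW.
  apply: (@le_trans _ _ (2 * M)).
    apply: (le_trans (ler_normB _ _)).
    by have := hM _ x01; have := hM _ y01; lra.
  have : d ^+ 2 <= (y - x) ^+ 2.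
    rewrite -(real_normK (num_real (y - x))) distrC lerXn2r ?nnegrE ?normr_ge0 ?(ltW d0)//.
  move=> h; have := ler_wpM2l (ltW C0) h.
  by rewrite {1}/C divfK ?expf_neq0 ?gt_eqF//; lra.
have [n n0 hn] : exists2 n, (0 < n)%N & C / n%:R <= e / 2.
  exists (Num.truncn (C / (e / 2))).+1 => //.
  rewrite ler_pdivrMr// mulrC -ler_pdivrMr// ltW//.
  have C2 : 0 <= C / (e / 2) by rewrite divr_ge0 ?ltW.
  by have /andP[] := truncn_itv C2.
exists (bernstein n (fun k => G (k%:R / n%:R))) => x x01.
have kn01 k : (k <= n)%N -> 0 <= (k%:R / n%:R : R) <= 1.
  by move=> kn; rewrite divr_ge0//= ler_pdivrMr ?ltr0n// mul1r ler_nat.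
have up : (bernstein n (fun k => e / 2 * 1 + C * (k%:R / n%:R - x) ^+ 2)).[x] <= e.
  rewrite bernstein_lin bernstein_cst bernstein_variance// mulr1 mulrA.
  have xx : x * (1 - x) <= 1 by move: x01 => /andP[? ?]; nra.
  have : C * (x * (1 - x)) / n%:R <= C / n%:R.
    by rewrite ler_wpM2r ?invr_ge0// ler_piMr// ltW.
  by rewrite mulrA; lra.
set B := (bernstein n _).[x]; rewrite ler_norml; apply/andP; split.
  suff : B <= G x + e by lra.
  apply: (@le_trans _ _ ((bernstein n
      (fun k => G x * 1 + 1 * (e / 2 * 1 + C * (k%:R / n%:R - x) ^+ 2))).[x])).
    apply: le_bernstein => // k kn; have := key _ _ x01 (kn01 _ kn).
    by rewrite ler_norml => /andP[? ?]; lra.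
  by rewrite bernstein_lin bernstein_cst; lra.
suff : G x <= B + e by lra.
apply: (@le_trans _ _ ((bernstein n
    (fun k => 1 * G (k%:R / n%:R) + 1 * (e / 2 * 1 + C * (k%:R / n%:R - x) ^+ 2))).[x])).
  rewrite -[leLHS](bernstein_cst n (G x) x).
  apply: le_bernstein => // k kn; have := key _ _ x01 (kn01 _ kn).
  by rewrite ler_norml => /andP[? ?]; lra.
by rewrite bernstein_lin -/B; lra.
Qed.
End Bernstein.

Lemma ge0_of_derive_ge0 (R : realType) (F dF : R -> R) (x : R) : 0 <= x ->
  (forall y : R, is_derive y 1 F (dF y)) -> (forall y : R, 0 < y -> 0 <= dF y) ->
  0 <= F 0 -> 0 <= F x.
Proof.
rewrite le_eqVlt => /predU1P[<-//|x0] FdF dF0 F0.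
have cF : continuous F by move=> y; exact: is_derive_continuous (FdF y).
have [c] := @MVT R F dF 0 x x0 (fun y _ => FdF y) (continuous_subspaceT cF).
rewrite in_itv/= subr0 => /andP[c0 _] E.
by apply: (le_trans F0); rewrite -subr_ge0 E mulr_ge0 ?dF0// ltW.
Qed.

(** The signed remainders [h] satisfy [h K.+1' = h K] and, from order 1 on, vanish at 0, so
    integrating [0 <= h K <= x^K / K!] raises the order by one. The absence of an exponential factor
    lets a single moment control the error after integration. *)
Lemma expRN_taylor (R : realType) (K : nat) (x : R) : 0 <= x ->
  `|expR (- x) - \sum_(k < K) (- x) ^+ k / k`!%:R| <= x ^+ K / K`!%:R.
Proof.
pose T K (y : R) : R := \sum_(k < K) (- y) ^+ k / k`!%:R.
have fn0 k : k`!%:R != 0 :> R by rewrite pnatr_eq0 -lt0n fact_gt0.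
have fS k : k.+1%:R / k.+1`!%:R = k`!%:R^-1 :> R.
  by rewrite factS natrM invfM mulrA mulfV ?mul1r// pnatr_eq0.
have dc k (c y : R) :
    is_derive y 1 (fun y => y ^+ k.+1 * c) (k.+1%:R * c * y ^+ k).
  have dX : is_derive y 1 (@GRing.exp R ^~ k.+1) (k.+1%:R * y ^+ k).
    apply: DeriveDef; first exact: exprn_derivable.
    by rewrite exp_derive /GRing.scale/= mulr1.
  have := is_deriveM dX (is_derive_cst c y 1).
  by rewrite /GRing.scale/= mulr0 add0r mulrA [c * _]mulrC.
have dp k (y : R) : is_derive y 1 (fun y => (- y) ^+ k.+1 / k.+1`!%:R) (- ((- y) ^+ k / k`!%:R)).
  have dN : is_derive y 1 (fun y : R => - y) (-1) by apply: is_derive_eq.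
  have := is_derive1_comp (dc k k.+1`!%:R^-1 (- y)) dN.
  by rewrite fS mulrN1 mulrC.
have dq k (y : R) : is_derive y 1 (fun y => y ^+ k.+1 / k.+1`!%:R) (y ^+ k / k`!%:R).
  by have := dc k k.+1`!%:R^-1 y; rewrite fS mulrC.
have dT k (y : R) : is_derive y 1 (T k.+1) (- T k y).
  elim: k => [|k IH].
    rewrite /T big_ord0 oppr0.
    rewrite (_ : (fun y => _) = cst 1); first exact: is_derive_cst.
    by apply/funext => z; rewrite big_ord_recl big_ord0 expr0 fact0 divr1 addr0.
  rewrite (_ : T k.+2 = T k.+1 \+ (fun y => (- y) ^+ k.+1 / k.+1`!%:R)); last first.
    by apply/funext => z; rewrite /T big_ord_recr.
  by rewrite {2}/T big_ord_recr/= opprD; apply: is_deriveD.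
have de (y : R) : is_derive y 1 (fun y => expR (- y)) (- expR (- y)).
  by apply: is_derive_eq; rewrite /GRing.scale/=; ring.
pose h k (y : R) : R := (-1) ^+ k * (expR (- y) - T k y).
have dh k (y : R) : is_derive y 1 (h k.+1) (h k y).
  rewrite /h; apply: is_derive_eq; rewrite /GRing.scale/= exprS; ring.
have T0 k : T k.+1 0 = 1.
  by rewrite /T big_ord_recl big1 ?addr0 ?expr0 ?fact0 ?divr1// => i _; rewrite oppr0 expr0n mul0r.
have h0 k : h k.+1 0 = 0 by rewrite /h T0 oppr0 expR0 subrr mulr0.
suff H : forall k (y : R), 0 <= y -> 0 <= h k y <= y ^+ k / k`!%:R.
  move=> x0; have /andP[h1 h2] := H K x x0.
  have -> : `|expR (- x) - \sum_(k < K) (- x) ^+ k / k`!%:R| = `|h K x|.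
    by rewrite /h normrM normrX normrN1 expr1n mul1r.
  by rewrite ger0_norm.
elim=> [|k IH] y y0.
  by rewrite /h /T big_ord0 expr0 mul1r subr0 expR_ge0 expr0 fact0 divr1 expR_le1 oppr_le0.
apply/andP; split.
  apply: (ge0_of_derive_ge0 y0 (dh k)) => [z z0|]; last by rewrite h0.
  by have /andP[] := IH z (ltW z0).
rewrite -subr_ge0.
apply: (@ge0_of_derive_ge0 _ (fun y => y ^+ k.+1 / k.+1`!%:R - h k.+1 y)
  (fun y => y ^+ k / k`!%:R - h k y)) => [|z z0|].
- exact: y0.
- by rewrite subr_ge0; have /andP[] := IH z (ltW z0).
- by rewrite h0 expr0n/= mul0r subr0.
Qed.

Section WeightedExpectation.
Variables (R : realType) (d : measure_display) (T : measurableType d).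
Variables (mu : {measure set T -> \bar R}) (D : set T) (g w : T -> R).
Hypotheses (mD : measurable D) (mg : measurable_fun D g) (mw : measurable_fun D w).
Hypotheses (g0 : forall x, D x -> 0 <= g x) (w0 : forall x, D x -> 0 <= w x).
Hypothesis g1 : (\int[mu]_(x in D) (g x)%:E = 1)%E.

(** Expectation under the law of density [g]. This form covers both the probability [P] with density
    1 and Lebesgue measure on the half-line with the density of a mixture. *)
Let Ex (f : T -> R) : R := (\int[mu]_(x in D) (f x * g x))%R.
Let In (f : T -> R) := mu.-integrable D (EFin \o (fun x => f x * g x)).

Let integrable_g : mu.-integrable D (EFin \o g).
Proof.
apply/integrableP; split; first exact/measurable_EFinP.
rewrite (eq_integral (EFin \o g)); first by rewrite /= g1 ltry.
by move=> x xD /=; rewrite ger0_norm// g0// -inE.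
Qed.

Lemma weighted_integrable_bounded (f : T -> R) (C : R) :
  measurable_fun D f -> (forall x, D x -> `|f x| <= C) -> In f.
Proof.
move=> mf fC; apply: (@le_integrable _ _ _ mu D mD _ (fun x => (C * g x)%:E)).
- by apply/measurable_EFinP; exact: measurable_funM.
- move=> x Dx /=; rewrite lee_fin !normrM ler_wpM2r//.
  by apply: (le_trans (fC x Dx)); exact: ler_norm.
- have := integrableZl mD C integrable_g.
  by apply: eq_integrable => // x _ /=; rewrite EFinM.
Qed.

Lemma weighted_norm_le (f : T -> R) (C : R) : measurable_fun D f ->
  (forall x, D x -> `|f x| <= C) -> `|Ex f| <= C.
Proof.
move=> mf fC; have fI := weighted_integrable_bounded mf fC.
apply: (le_trans (le_normr_Rintegral mD fI)).
have CI : mu.-integrable D (EFin \o (fun x => C * g x)).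
  have := integrableZl mD C integrable_g.
  by apply: eq_integrable => // x _ /=; rewrite EFinM.
apply: (@le_trans _ _ (\int[mu]_(x in D) (C * g x))%R).
  apply: le_Rintegral => //; first exact: integrable_norm.
  move=> x Dx; rewrite normrM (ger0_norm (g0 Dx)) ler_wpM2r ?g0//.
  exact: fC.
by rewrite RintegralZl// /Rintegral g1/= mulr1.
Qed.

Lemma weightedB (f1 f2 : T -> R) : In f1 -> In f2 ->
  Ex (fun x => f1 x - f2 x) = Ex f1 - Ex f2.
Proof.
move=> i1 i2; rewrite /Ex -RintegralB//.
by apply: eq_Rintegral => x _; rewrite mulrBl.
Qed.

Lemma weighted_sum (K : nat) (c : nat -> R) (f : nat -> T -> R) :
  (forall k, In (f k)) ->
  In (fun x => \sum_(k < K) c k * f k x) /\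
  Ex (fun x => \sum_(k < K) c k * f k x) = \sum_(k < K) c k * Ex (f k).
Proof.
move=> If; elim: K => [|K [IHi IHE]].
  have -> : (fun x => \sum_(k < 0) c k * f k x) = cst 0.
    by apply/funext => x; rewrite big_ord0.
  rewrite big_ord0; split.
    by apply: (@weighted_integrable_bounded _ 0) => // x _; rewrite normr0.
  rewrite /Ex (@eq_Rintegral _ _ _ _ _ (cst 0)) => [|x _]; last by rewrite /= mul0r.
  by rewrite Rintegral_cst// mul0r.
have cI : mu.-integrable D (EFin \o (fun x => c K * (f K x * g x))).
  have := integrableZl mD (c K) (If K).
  by apply: eq_integrable => // x _ /=; rewrite EFinM.
split.
  have := integrableD mD IHi cI; apply: eq_integrable => // x _ /=.
  by rewrite big_ord_recr/= mulrDl EFinD mulrA.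
rewrite big_ord_recr/= -IHE /Ex -RintegralZl; [|by []|exact: If].
rewrite -RintegralD//; apply: eq_Rintegral => x _.
by rewrite big_ord_recr/= mulrDl mulrA.
Qed.

Lemma weighted_taylor (u : R) (K : nat) : 0 <= u ->
  (forall k, In (fun x => w x ^+ k)) ->
  `|Ex (fun x => expR (- (u * w x))) -
    \sum_(k < K) (- u) ^+ k / k`!%:R * Ex (fun x => w x ^+ k)|
  <= u ^+ K / K`!%:R * Ex (fun x => w x ^+ K).
Proof.
move=> u0 Iw.
have me : measurable_fun D (fun x => expR (- (u * w x))).
  by apply: measurableT_comp => //; apply: measurableT_comp => //; exact: measurable_funM.
have Ie : In (fun x => expR (- (u * w x))).
  apply: (@weighted_integrable_bounded _ 1 me) => x Dx.
  by rewrite ger0_norm ?expR_ge0// expR_le1 oppr_le0 mulr_ge0// w0.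
have [Is Es] := weighted_sum K (fun k => (- u) ^+ k / k`!%:R) Iw.
rewrite -Es -weightedB//.
have Id : mu.-integrable D (EFin \o (fun x => (expR (- (u * w x)) -
    \sum_(k < K) (- u) ^+ k / k`!%:R * w x ^+ k) * g x)).
  have := integrableB mD Ie Is; apply: eq_integrable => // x _ /=.
  by rewrite mulrBl.
apply: (le_trans (le_normr_Rintegral mD Id)).
rewrite /Ex -(RintegralZl (u ^+ K / K`!%:R) mD (Iw K)); apply: le_Rintegral => //.
- exact: integrable_norm.
- have := integrableZl mD (u ^+ K / K`!%:R) (Iw K).
  by apply: eq_integrable => // x _ /=; rewrite EFinM.
move=> x Dx; rewrite normrM (ger0_norm (g0 Dx)) mulrA ler_wpM2r ?g0//.
have := expRN_taylor K (mulr_ge0 u0 (w0 Dx)).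
rewrite exprMn mulrAC.
by under eq_bigr do rewrite -mulNr exprMn mulrAC.
Qed.
End WeightedExpectation.

Section MethodOfMoments.
Variables (R : realType) (d d' : measure_display).
Variables (T : measurableType d) (T' : measurableType d').
Variables (mu : {measure set T -> \bar R}) (D : set T) (g w : T -> R).
Variables (nu : {measure set T' -> \bar R}) (E : set T') (h : nat -> T' -> R) (v : T' -> R).
Hypotheses (mD : measurable D) (mg : measurable_fun D g) (mw : measurable_fun D w).
Hypotheses (g0 : forall x, D x -> 0 <= g x) (w0 : forall x, D x -> 0 <= w x).
Hypothesis g1 : (\int[mu]_(x in D) (g x)%:E = 1)%E.
Hypotheses (mE : measurable E) (mh : forall n, measurable_fun E (h n)) (mv : measurable_fun E v).
Hypotheses (h0 : forall n x, E x -> 0 <= h n x) (v0 : forall x, E x -> 0 <= v x).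
Hypothesis h1 : forall n, (\int[nu]_(x in E) (h n x)%:E = 1)%E.
Hypothesis Iw : forall k, mu.-integrable D (EFin \o (fun x => w x ^+ k * g x)).
Hypothesis Iv : forall n k, nu.-integrable E (EFin \o (fun x => v x ^+ k * h n x)).

Let M k : R := (\int[mu]_(x in D) (w x ^+ k * g x))%R.
Let N n k : R := (\int[nu]_(x in E) (v x ^+ k * h n x))%R.
Hypothesis cvg_mom : forall k, N n k @[n --> \oo] --> M k.
Hypothesis smallM : forall u : R, 0 <= u -> u ^+ k / k`!%:R * M k @[k --> \oo] --> 0.

Let cvg_sum (K : nat) (c : nat -> R) (a : nat -> nat -> R) (l : nat -> R) :
  (forall k, a n k @[n --> \oo] --> l k) ->
  \sum_(k < K) c k * a n k @[n --> \oo] --> \sum_(k < K) c k * l k.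
Proof.
move=> al; elim: K => [|K IH].
  by under eq_fun do rewrite big_ord0; rewrite big_ord0; exact: cvg_cst.
under eq_fun do rewrite big_ord_recr/=; rewrite big_ord_recr/=.
by apply: cvgD => //; apply: cvgM; [exact: cvg_cst|exact: al].
Qed.

(** The order [K] is fixed by the moment growth of the limit law alone; the remainder of the
    approximating laws is governed by their moment of the same order, which converges. There remains
    a finite sum of moments. *)
Let cvg_laplace (u : R) : 0 <= u ->
  (\int[nu]_(x in E) (expR (- (u * v x)) * h n x))%R @[n --> \oo] -->
  (\int[mu]_(x in D) (expR (- (u * w x)) * g x))%R.
Proof.
move=> u0; apply/cvgrPdist_le => e e0; have e4 : 0 < e / 4 by rewrite divr_gt0.
have [K _ /(_ K (leqnn K)) /=] : \forall K \near \oo, u ^+ K / K`!%:R * M K <= e / 4.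
  have /cvgrPdist_le/(_ _ e4) := smallM u0; apply: filterS => K.
  by rewrite sub0r normrN; apply: le_trans; exact: ler_norm.
move=> hK.
have c : u ^+ K / K`!%:R * N n K @[n --> \oo] --> u ^+ K / K`!%:R * M K.
  by apply: cvgM; [exact: cvg_cst|exact: cvg_mom].
near=> n.
have t1 := weighted_taylor mD mg mw g0 w0 g1 K u0 Iw.
have t2 := weighted_taylor mE (mh n) mv (@h0 n) v0 (h1 n) K u0 (Iv n).
have t3 : u ^+ K / K`!%:R * N n K <= e / 2.
  near: n; have /cvgrPdist_le/(_ _ e4) := c; apply: filterS => m.
  by rewrite ler_norml => /andP[]; lra.
have t4 : `|\sum_(k < K) (- u) ^+ k / k`!%:R * M k -
            \sum_(k < K) (- u) ^+ k / k`!%:R * N n k| <= e / 4.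
  near: n; have /cvgrPdist_le := @cvg_sum K (fun k => (- u) ^+ k / k`!%:R) _ _ cvg_mom.
  exact.
move: t1 t2 t3 t4 (hK); rewrite -/(M _) -/(N _ _) !ler_norml.
rewrite -/(M K).
move=> /andP[a1 a2] /andP[b1 b2] c1 /andP[d1 d2] e1; apply/andP; split; lra.
Unshelve. all: by end_near. Qed.

Let bounded_horner (p : {poly R}) : exists C : R, forall x, 0 <= x <= 1 -> `|p.[x]| <= C.
Proof.
have cp : {within `[0, 1], continuous (fun x => `|p.[x]|)}.
  by apply: continuous_subspaceT => x; apply: cvg_norm; exact: continuous_horner.
have [c _ hc] := EVT_max (@ler01 R) cp.
by exists `|p.[c]| => x x01; apply: hc; rewrite in_itv.
Qed.

(** [expR (- v)] takes values in [[0, 1]], where [G] is uniformly close to a polynomial; a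
    polynomial in [expR (- v)] is a combination of Laplace kernels at integers. *)
Lemma method_of_moments (G : R -> R) : continuous G ->
  (\int[nu]_(x in E) (G (expR (- v x)) * h n x))%R @[n --> \oo] -->
  (\int[mu]_(x in D) (G (expR (- w x)) * g x))%R.
Proof.
move=> cG; apply/cvgrPdist_le => e e0; have e3 : 0 < e / 3 by rewrite divr_gt0.
have [p hp] := weierstrass_approximation cG e3.
have mG : measurable_fun setT G by exact: continuous_measurable_fun.
have mp : measurable_fun setT (horner p).
  by apply: continuous_measurable_fun => x; exact: continuous_horner.
have [Cp hCp] := bounded_horner p.
have hCG x : 0 <= x <= 1 -> `|G x| <= Cp + e / 3.
  move=> x01; have := hp x x01; have := hCp x x01.
  have := ler_normD (p.[x]) (G x - p.[x]); rewrite addrC subrK; lra.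
have gen (dd : measure_display) (TT : measurableType dd) (m : {measure set TT -> \bar R})
   (F : set TT) (k y : TT -> R) : measurable F -> measurable_fun F k -> measurable_fun F y ->
   (forall x, F x -> 0 <= k x) -> (forall x, F x -> 0 <= y x) ->
   (\int[m]_(x in F) (k x)%:E = 1)%E ->
   `|(\int[m]_(x in F) (G (expR (- y x)) * k x))%R - (\int[m]_(x in F) (p.[expR (- y x)] * k x))%R|
     <= e / 3 /\
   (\int[m]_(x in F) (p.[expR (- y x)] * k x))%R =
   \sum_(i < size p) p`_i * (\int[m]_(x in F) (expR (- (i%:R * y x)) * k x))%R.
  move=> mF mk my k0 y0 k1.
  have mey : measurable_fun F (fun x => expR (- y x)).
    by apply: measurableT_comp => //; exact: measurableT_comp.
  have ey x : F x -> 0 <= expR (- y x) <= 1.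
    by move=> Fx; rewrite expR_ge0 expR_le1 oppr_le0 y0.
  have mGe : measurable_fun F (fun x => G (expR (- y x))) by exact: measurableT_comp.
  have mpe : measurable_fun F (fun x => p.[expR (- y x)]) by exact: measurableT_comp.
  have IG : m.-integrable F (EFin \o (fun x => G (expR (- y x)) * k x)).
    by apply: (weighted_integrable_bounded mF mk k0 k1 mGe) => x Fx; exact: hCG (ey x Fx).
  have Ip : m.-integrable F (EFin \o (fun x => p.[expR (- y x)] * k x)).
    by apply: (weighted_integrable_bounded mF mk k0 k1 mpe) => x Fx; exact: hCp (ey x Fx).
  split.
    rewrite -weightedB//; apply: (weighted_norm_le mF mk k0 k1).
      exact: measurable_funB.
    by move=> x Fx; exact: hp (ey x Fx).
  have Ik i : m.-integrable F (EFin \o (fun x => expR (- (i%:R * y x)) * k x)).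
    apply: (weighted_integrable_bounded mF mk k0 k1 (C := 1)).
      by apply: measurableT_comp => //; apply: measurableT_comp => //; exact: measurable_funM.
    by move=> x Fx; rewrite ger0_norm ?expR_ge0// expR_le1 oppr_le0 mulr_ge0// y0.
  have [_ <-] := weighted_sum mF mk k0 k1 (size p) (fun i => p`_i) Ik.
  apply: eq_Rintegral => x _; congr (_ * _); rewrite horner_coef.
  by apply: eq_bigr => i _; rewrite -expRM_natl -mulrN.
have [a1 a2] := gen _ _ mu D g w mD mg mw g0 w0 g1.
near=> n.
have [b1 b2] := gen _ _ nu E (h n) v mE (mh n) mv (@h0 n) v0 (h1 n).
have c1 : `|\sum_(i < size p) p`_i * (\int[mu]_(x in D) (expR (- (i%:R * w x)) * g x))%R -
  \sum_(i < size p) p`_i * (\int[nu]_(x in E) (expR (- (i%:R * v x)) * h n x))%R| <= e / 3.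
  near: n.
  have /cvgrPdist_le := @cvg_sum (size p) (fun i => p`_i) _ _ (fun i => cvg_laplace (ler0n R i)).
  exact.
move: a1 b1 c1; rewrite -a2 -b2 !ler_norml.
by move=> /andP[? ?] /andP[? ?] /andP[? ?]; apply/andP; split; lra.
Unshelve. all: by end_near. Qed.
End MethodOfMoments.

(** * Negative powers of a stable variable *)

Section StableMoments.
Variables (R : realType) (d : measure_display) (T : measurableType d).
Variables (P : probability T R) (alpha : R) (Z : T -> R).
Hypotheses (alpha0 : 0 < alpha) (Zst : positive_stable P alpha Z).

Let mZ : measurable_fun [set: T] Z. Proof. by have [[]] := Zst. Qed.

Let mpow (s : R) : measurable_fun [set: T] (fun x => Z x `^ s).
Proof. exact: (measurableT_comp (@measurable_powR R s) mZ). Qed.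

(** The kernel [(s + 1) * v ^ s * expR (- (v ^ (1 / alpha) * Z))] is integrated over [v] and the
    probability space in both orders. Taking the expectation first leaves [expR (- v)], by the
    normalization of [Z]; integrating in [v] first gives a Gamma value times the power of [Z]. *)
Lemma stable_moment (s : R) : 0 <= s ->
  (\int[P]_x (Z x `^ (- (alpha * (s + 1))))%:E =
   (gamma_succ (s + 1) / gamma_succ (alpha * (s + 1)))%:E)%E.
Proof.
move=> s0; have [[_ Z0] ZL] := Zst.
have s1 : 0 < s + 1 by rewrite ltr_wpDl.
have a0 : 0 < alpha^-1 by rewrite invr_gt0.
pose mu := @lebesgue_measure R.
pose f (z : T * R) : \bar R := ((s + 1) * z.2 `^ s * expR (- (z.2 `^ alpha^-1 * Z z.1)))%:E.
have mf (D : set (T * R)) : @measurable_fun _ _ (T * R)%type (\bar R) D f.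
  apply: measurable_funTS; apply/measurable_EFinP; apply: measurable_funM.
    apply: measurable_funM => //.
    by apply: (measurableT_comp (@measurable_powR R s)).
  apply: measurableT_comp => //; apply: measurableT_comp => //.
  apply: measurable_funM.
    by apply: (measurableT_comp (@measurable_powR R alpha^-1)).
  exact: (measurableT_comp mZ).
(* The integral in [v] has its closed form for [0 < Z] only; the complement is negligible. *)
pose D1 := [set x | 0 < Z x].
have mD1 : measurable D1.
  have := mZ measurableT (measurable_itv `]0, +oo[); rewrite setTI.
  by congr measurable; apply/seteqP; split=> x; rewrite /= in_itv/= andbT.
have PD1 : P (~` D1) = 0%E by apply/negligibleP => //; exact: measurableC.
have intD1 (k : T -> R) : measurable_fun setT k -> (forall x, 0 <= k x) ->
    (\int[P]_(x in D1) (k x)%:E = \int[P]_x (k x)%:E)%E.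
  move=> mk k0; rewrite [RHS](@ge0_negligible_integral _ _ _ P setT (~` D1)) ?setTD ?setCK//.
  - exact: measurableC.
  - exact/measurable_EFinP.
  - by move=> x _; rewrite lee_fin.
have f0 x v : D1 x -> `]0%R, +oo[%classic v -> (0 <= f (x, v))%E.
  by move=> _ _; rewrite lee_fin !mulr_ge0 ?powR_ge0 ?expR_ge0// ltW.
have FT := @fubini_tonelli_on _ _ _ _ _ P mu _ _ f mD1 (measurable_itv _) (mf _) f0.
have RHS : (\int[mu]_(v in `]0%R, +oo[) \int[P]_(x in D1) f (x, v) = (gamma_succ (s + 1))%:E)%E.
  rewrite gamma_succS// EFinM -gamma_succE// -ge0_integralZl_EFin ?(ltW s1)//; last 2 first.
    by move=> v _; rewrite lee_fin mulr_ge0 ?powR_ge0 ?expR_ge0.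
    apply/measurable_EFinP; apply: measurable_funTS; apply: measurable_funM.
      exact: (@measurable_powR R s).
    by apply: measurableT_comp => //; apply: measurableT_comp.
  apply: eq_integral => v; rewrite inE/= in_itv/= andbT => v0.
  have va0 : 0 <= v `^ alpha^-1 by exact: powR_ge0.
  have := ZL _ va0; rewrite unlock -powRrM mulVf ?gt_eqF// powRr1 ?(ltW v0)// => E.
  have mE : measurable_fun [set: T] (fun x => expR (- (v `^ alpha^-1 * Z x))).
    apply: measurableT_comp => //; apply: measurableT_comp => //.
    exact: measurable_funM.
  rewrite /f /= (intD1 (fun x => (s + 1) * v `^ s * expR (- (v `^ alpha^-1 * Z x)))); last 2 first.
  - exact: measurable_funM.
  - by move=> x; rewrite !mulr_ge0 ?powR_ge0 ?expR_ge0// ltW.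
  rewrite (eq_integral (fun x => ((s + 1) * v `^ s)%:E * (expR (- v `^ alpha^-1 * Z x))%:E)%E);
    last by move=> x _; rewrite -EFinM mulNr.
  rewrite ge0_integralZl_EFin ?mulr_ge0 ?powR_ge0 ?(ltW s1)//; last first.
    apply/measurable_EFinP; apply: measurableT_comp => //.
    exact: measurable_funM.
  by rewrite E -!EFinM mulrA.
have G0 : 0 < gamma_succ (alpha * (s + 1)) by rewrite gamma_succ_gt0// mulr_ge0// ltW.
have LHS : (\int[P]_(x in D1) \int[mu]_(v in `]0%R, +oo[) f (x, v) =
   (gamma_succ (alpha * (s + 1)))%:E * \int[P]_x (Z x `^ (- (alpha * (s + 1))))%:E)%E.
  rewrite -intD1 => [||x]; [|exact: mpow|exact: powR_ge0].
  rewrite -ge0_integralZl_EFin ?(ltW G0)//; last 2 first.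
    by move=> x _; rewrite lee_fin powR_ge0.
    by apply/measurable_EFinP; apply: measurable_funTS; exact: mpow.
  apply: eq_integral => x; rewrite inE => Zx.
  rewrite /f/= integral_powR_expRN// -gamma_succE ?mulr_ge0 ?(ltW alpha0) ?(ltW s1)//.
  rewrite muleC -ge0_integralZl_EFin ?powR_ge0//; last 2 first.
    by move=> l _; rewrite lee_fin mulr_ge0 ?powR_ge0 ?expR_ge0.
    apply/measurable_EFinP; apply: measurable_funTS; apply: measurable_funM.
      exact: (@measurable_powR R (alpha * (s + 1))).
    by apply: measurableT_comp => //; apply: measurableT_comp.
  apply: eq_integral => l; rewrite inE/= in_itv/= andbT => l0.
  rewrite invrK mulrC [(s + 1) * alpha]mulrC powRM ?invr_ge0 ?(ltW l0) ?(ltW Zx)//.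
  rewrite -EFinM; congr EFin.
  have /powR_inv1 <- : 0 <= Z x by exact: ltW.
  by rewrite -powRrM mulN1r; ring.
have Gn0 := lt0r_neq0 G0.
move: FT; rewrite RHS LHS => FT.
(* Finiteness of the moment is read off the identity: its product with a positive real is finite. *)
have mI : (0 <= \int[P]_x (Z x `^ (- (alpha * (s + 1))))%:E)%E.
  by apply: integral_ge0 => x _; rewrite lee_fin powR_ge0.
move: FT mI; case: (\int[P]_x _)%E => [r||]//.
- by rewrite -EFinM => -[<-] _; congr EFin; field.
- by rewrite gt0_muley ?lte_fin.
Qed.
End StableMoments.

(** * Laplace transforms of mixtures and their convergence *)

Section ExponentialMixture.
Variables (R : realType) (N : nat) (p t : nat -> R).
Hypotheses (p0 : forall i, (i < N)%N -> 0 <= p i) (t0 : forall i, 0 < t i).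

Let mu := @lebesgue_measure R.

Definition exp_mixture (x : R) := \sum_(i < N) p i * (t i * expR (- (x * t i))).

Lemma measurable_exp_mixture (D : set R) : measurable_fun D exp_mixture.
Proof.
apply: measurable_funTS; apply: measurable_sum => i; apply: measurable_funM => //.
apply: measurable_funM => //; apply: measurableT_comp => //.
by apply: measurableT_comp => //; exact: measurable_funM.
Qed.

Lemma exp_mixture_ge0 x : 0 <= exp_mixture x.
Proof.
by apply: sumr_ge0 => i _; rewrite mulr_ge0 ?p0// mulr_ge0 ?expR_ge0// ltW.
Qed.

Let integral_exp_mixture (k c : R -> R) : measurable_fun setT k -> (forall x, 0 <= k x) ->
  (forall s : R, 0 < s ->
    (\int[mu]_(x in `]0%R, +oo[) (k x * (s * expR (- (x * s))))%:E = (c s)%:E)%E) ->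
  (\int[mu]_(x in `]0%R, +oo[) (k x * exp_mixture x)%:E = (\sum_(i < N) p i * c (t i))%:E)%E.
Proof.
move=> mk k0 kc.
have mE i : measurable_fun (`]0%R, +oo[%classic : set R)
    (fun x => (k x * (t i * expR (- (x * t i))))%:E).
  apply/measurable_EFinP; apply: measurable_funTS; apply: measurable_funM => //.
  apply: measurable_funM => //; apply: measurableT_comp => //.
  by apply: measurableT_comp => //; exact: measurable_funM.
have E0 i x : (0 <= (k x * (t i * expR (- (x * t i))))%:E)%E.
  by rewrite lee_fin mulr_ge0// mulr_ge0 ?expR_ge0// ltW.
transitivity (\int[mu]_(x in `]0%R, +oo[)
    (\sum_(i < N) (p i)%:E * (k x * (t i * expR (- (x * t i))))%:E))%E.
  apply: eq_integral => x _; rewrite mulr_sumr -sumEFin; apply: eq_bigr => i _.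
  by rewrite -EFinM mulrCA.
rewrite ge0_integral_sum//; last 2 first.
- by move=> i; apply: measurable_funeM; exact: mE.
- by move=> i x _; rewrite mule_ge0 ?lee_fin ?p0//; exact: E0.
rewrite -sumEFin; apply: eq_bigr => i _.
rewrite ge0_integralZl_EFin ?p0//.
- by rewrite kc// -EFinM.
- exact: mE.
Qed.

(** For one rate [u], the layer cake identity with [a = 1] and [z = u] does the work of the
    substitution scaling the rate to 1, at the price of a common factor [(s + 1) / u]. *)
Lemma exp_mixture_moment s : 0 <= s ->
  (\int[mu]_(x in `]0%R, +oo[) (x `^ s * exp_mixture x)%:E =
   (gamma_succ s * \sum_(i < N) p i * t i `^ (- s))%:E)%E.
Proof.
move=> s0; rewrite mulr_sumr; under eq_bigr do rewrite mulrCA.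
apply: (integral_exp_mixture (c := fun u => gamma_succ s * u `^ (- s))).
- exact: measurable_powR.
- by move=> x; exact: powR_ge0.
move=> u u0.
have s1 : 0 < s + 1 by rewrite ltr_wpDl.
have G := integral_powR_expRN s0 (ltr01 : 0 < (1 : R)) u0.
rewrite divr1 in G.
have mE : measurable_fun (`]0%R, +oo[%classic : set R) (fun x => (x `^ s * (u * expR (- (x * u))))%:E).
  apply/measurable_EFinP; apply: measurable_funTS; apply: measurable_funM => //.
  apply: measurable_funM => //; apply: measurableT_comp => //.
  by apply: measurableT_comp => //; exact: measurable_funM.
have L : (\int[mu]_(v in `]0%R, +oo[) ((s + 1) * v `^ s * expR (- (v `^ 1 * u)))%:E =
   ((s + 1) / u)%:E * \int[mu]_(x in `]0%R, +oo[) (x `^ s * (u * expR (- (x * u))))%:E)%E.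
  rewrite -ge0_integralZl_EFin//; last 2 first.
  - by move=> x _; rewrite lee_fin mulr_ge0 ?powR_ge0// mulr_ge0 ?expR_ge0// ltW.
  - by rewrite divr_ge0// ltW.
  apply: eq_integral => v; rewrite inE/= in_itv/= andbT => v0.
  rewrite -EFinM powRr1 ?(ltW v0)//; congr EFin; field.
  by rewrite gt_eqF.
have Rr : (\int[mu]_(l in `]0%R, +oo[) ((l / u) `^ (s + 1) * expR (- l))%:E =
   (u `^ (- (s + 1)) * gamma_succ (s + 1))%:E)%E.
  rewrite EFinM -gamma_succE ?(ltW s1)// -ge0_integralZl_EFin ?powR_ge0//; last 2 first.
  - by move=> x _; rewrite lee_fin mulr_ge0 ?powR_ge0// expR_ge0.
  - apply/measurable_EFinP; apply: measurable_funTS; apply: measurable_funM => //.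
    by apply: measurableT_comp => //; apply: measurableT_comp.
  apply: eq_integral => l; rewrite inE/= in_itv/= andbT => l0.
  rewrite powRM ?(ltW l0) ?invr_ge0 ?(ltW u0)//.
  have /powR_inv1 <- : 0 <= u by exact: ltW.
  by rewrite -powRrM mulN1r -EFinM; congr EFin; ring.
rewrite L Rr in G; move: G.
have I0 : (0 <= \int[mu]_(x in `]0%R, +oo[) (x `^ s * (u * expR (- (x * u))))%:E)%E.
  by apply: integral_ge0 => x _; rewrite lee_fin mulr_ge0 ?powR_ge0// mulr_ge0 ?expR_ge0// ltW.
have su : 0 < (s + 1) / u by rewrite divr_gt0.
move: I0; case: (\int[mu]_(x in _) _)%E => [r||]// _.
- rewrite -EFinM => -[E]; congr EFin.
  apply: (mulfI (lt0r_neq0 su)); rewrite E gamma_succS// opprD powRD; last first.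
    by rewrite (gt_eqF u0) implybT.
  rewrite powR_inv1 ?(ltW u0)//; field.
  by rewrite gt_eqF.
- by rewrite gt0_muley ?lte_fin.
Qed.

Lemma exp_mixture_laplace l : 0 <= l ->
  (\int[mu]_(x in `]0%R, +oo[) (expR (- (l * x)) * exp_mixture x)%:E =
   (\sum_(i < N) p i * (t i / (t i + l)))%:E)%E.
Proof.
move=> l0; apply: (integral_exp_mixture (c := fun u => u / (u + l))).
- by apply: measurableT_comp => //; apply: measurableT_comp => //; exact: measurable_funM.
- by move=> x; exact: expR_ge0.
move=> u u0; have ul : 0 < u + l by rewrite ltr_wpDr.
rewrite EFinM -integral_expRN// -ge0_integralZl_EFin ?(ltW u0)//; last first.
  apply/measurable_EFinP; apply: measurable_funTS.
  by apply: measurableT_comp => //; apply: measurableT_comp => //; exact: measurable_funM.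
apply: eq_integral => x _; rewrite -EFinM mulrCA -expRD; congr (_ * expR _)%:E.
ring.
Qed.
End ExponentialMixture.

(** The Weibull survival function [expR (- (l * y ^ q))] in the variable [s = expR (- y)], extended
    by its limits 0 and 1 outside [[0, 1]] so as to be continuous on the line. At [y = x ^ (1 / q)]
    it is the Laplace kernel in [x]. *)
Definition weibull_test (R : realType) (q l s : R) : R :=
  if s <= 0 then 0 else expR (- (l * Num.max 0 (- ln s) `^ q)).

Lemma weibull_testE (R : realType) (q l y : R) : 0 <= y ->
  weibull_test q l (expR (- y)) = expR (- (l * y `^ q)).
Proof.
by move=> y0; rewrite /weibull_test leNgt expR_gt0/= expRK opprK max_r.
Qed.

Lemma continuous_max0_powR (R : realType) (q : R) : 0 < q ->
  continuous (fun y : R => Num.max 0 y `^ q).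
Proof.
move=> q0 y; have [y0|y0|->] := ltgtP y 0.
- apply/cvgrPdist_le => e e0; near=> z.
  have z0 : z < 0 by near: z; exact: lt_nbhsl.
  by rewrite !max_l ?(ltW z0) ?(ltW y0)// subrr normr0 ltW.
- have := @continuous_powR_gt0 R q y y0; rewrite /continuous_at.
  rewrite (max_r (ltW y0)); apply: cvg_trans; apply: near_eq_cvg.
  by near=> z; rewrite max_r// ltW//; near: z; exact: lt_nbhsr.
apply/cvgrPdist_le => e e0.
have N : \forall z \near (0 : R), `|z| <= e `^ q^-1 by apply: nbhs0_le; exact: powR_gt0.
near=> z.
rewrite maxxx [0 `^ q]powR0 ?gt_eqF// sub0r normrN ger0_norm ?powR_ge0//.
case: (lerP z 0) => z0; first by rewrite ?max_l// powR0 ?gt_eqF// ltW.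
rewrite ?max_r ?(ltW z0)//.
have -> : e = (e `^ q^-1) `^ q by rewrite -powRrM mulVf ?gt_eqF// powRr1// ltW.
rewrite ge0_ler_powR ?nnegrE ?powR_ge0 ?(ltW q0) ?(ltW z0)//.
apply: (le_trans (ler_norm _)); near: z; exact: N.
Unshelve. all: by end_near. Qed.

Lemma continuous_weibull_test (R : realType) (q l : R) : 0 < q -> 0 < l ->
  continuous (weibull_test q l).
Proof.
move=> q0 l0 s; have [s0|s0|->] := ltgtP s 0.
- apply/cvgrPdist_le => e e0; near=> z.
  have z0 : z < 0 by near: z; exact: lt_nbhsl.
  by rewrite /weibull_test (ltW z0) (ltW s0) subrr normr0 ltW.
- have cl : - ln x @[x --> s] --> - ln s by apply: cvgN; exact: continuous_ln.
  have c1 : Num.max 0 (- ln x) `^ q @[x --> s] --> Num.max 0 (- ln s) `^ q.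
    exact: (cvg_comp _ _ cl (@continuous_max0_powR R q q0 (- ln s))).
  have c2 : - (l * Num.max 0 (- ln x) `^ q) @[x --> s] --> - (l * Num.max 0 (- ln s) `^ q).
    by apply: cvgN; apply: cvgM => //; exact: cvg_cst.
  have c := cvg_comp _ _ c2 (@continuous_expR R _).
  rewrite /continuous_at {2}/weibull_test leNgt s0/=.
  apply: cvg_trans c; apply: near_eq_cvg.
  near=> z; rewrite /weibull_test leNgt (_ : 0 < z)//.
  by near: z; exact: lt_nbhsr.
rewrite /continuous_at {2}/weibull_test lexx; apply/cvgrPdist_le => e e0.
(* Chosen so that [l * Y ^ q = 1 / e]; then [expR (- (1 / e)) <= e] bounds the values near 0. *)
pose Y := (l^-1 / e) `^ q^-1.
have Yq : l * Y `^ q = e^-1.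
  by rewrite /Y -powRrM mulVf ?gt_eqF// powRr1 ?divr_ge0 ?invr_ge0 ?ltW// mulVKf// gt_eqF.
have N : \forall z \near (0 : R), `|z| <= expR (- Y) by apply: nbhs0_le; exact: expR_gt0.
near=> z; rewrite sub0r normrN /weibull_test.
case: (leP z 0) => z0; first by rewrite normr0 ltW.
rewrite ger0_norm ?expR_ge0//.
have zY : z <= expR (- Y).
  apply: (le_trans (ler_norm _)); near: z; exact: N.
have Yz : Y <= - ln z.
  by rewrite lerNr -(expRK (- Y)) ler_ln ?posrE// expR_gt0.
have h : e^-1 <= l * Num.max 0 (- ln z) `^ q.
  rewrite -Yq ler_pM2l// ge0_ler_powR ?nnegrE ?powR_ge0 ?(ltW q0)//.
    by rewrite le_max lexx.
  by rewrite le_max Yz orbT.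
apply: (@le_trans _ _ (expR (- e^-1))); first by rewrite ler_expR lerN2.
rewrite expRN -[leRHS]invrK lef_pV2 ?posrE ?expR_gt0 ?invr_gt0//.
by have := expR_ge1Dx e^-1; lra.
Unshelve. all: by end_near. Qed.

(** The factorials cancel and [u ^ k / Gamma (1 + k alpha)] remains, the general term of a
    Mittag-Leffler series. Evaluating [gamma_succ_ge] at the [a] with [a ^ alpha = 2 u + 1] makes it
    smaller than a geometric sequence of ratio [u / (2 u + 1)]. *)
Lemma expr_gamma_succ_cvg0 (R : realType) (alpha u : R) : 0 < alpha -> 0 <= u ->
  u ^+ k / k`!%:R * (gamma_succ k%:R / gamma_succ (k%:R * alpha)) @[k --> \oo] --> 0.
Proof.
move=> a0 u0; have u1 : 0 < 2 * u + 1 by lra.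
pose a := (2 * u + 1) `^ alpha^-1.
have c : expR a * (u / (2 * u + 1)) ^+ k @[k --> \oo] --> 0.
  rewrite -[X in _ --> X](mulr0 (expR a)); apply: cvgM; first exact: cvg_cst.
  by apply: cvg_expr; rewrite ger0_norm ?divr_ge0 ?(ltW u1)// ltr_pdivrMr//; lra.
apply: (@squeeze_cvgr _ _ _ _ (fun=> 0) (fun k => expR a * (u / (2 * u + 1)) ^+ k)); last 2 first.
- exact: cvg_cst.
- exact: c.
near=> k; have G0 : 0 < gamma_succ (k%:R * alpha) by rewrite gamma_succ_gt0// mulr_ge0// ltW.
rewrite gamma_succ_fact mulrA divfK ?pnatr_eq0 -?lt0n ?fact_gt0//.
rewrite divr_ge0 ?exprn_ge0 ?(ltW G0)//=.
have h := @gamma_succ_ge R (k%:R * alpha) a.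
rewrite ler_pdivrMr// expr_div_n.
have ak : a `^ (k%:R * alpha) = (2 * u + 1) ^+ k.
  by rewrite -powRrM mulrCA mulVf ?gt_eqF// mulr1 powR_mulrn// ltW.
have := h _ _; rewrite ak => H.
have {}H : (2 * u + 1) ^+ k * expR (- a) <= gamma_succ (k%:R * alpha).
  by apply: H; [rewrite mulr_ge0// ltW|rewrite powR_gt0].
apply: (@le_trans _ _ (expR a * (u ^+ k / (2 * u + 1) ^+ k) * ((2 * u + 1) ^+ k * expR (- a)))).
  rewrite [leRHS](_ : _ = u ^+ k)// expRN; field.
  by rewrite expf_neq0 ?gt_eqF//= expR_gt0.
by rewrite ler_wpM2l// mulr_ge0 ?expR_ge0// divr_ge0 ?exprn_ge0// ltW.
Unshelve. all: by end_near. Qed.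

Lemma ge0_integral_fin_integrable (R : realType) (d : measure_display) (T : measurableType d)
    (mu : {measure set T -> \bar R}) (D : set T) (f : T -> R) (c : R) :
  measurable D -> measurable_fun D f -> (forall x, D x -> 0 <= f x) ->
  (\int[mu]_(x in D) (f x)%:E = c%:E)%E -> mu.-integrable D (EFin \o f).
Proof.
move=> mD mf f0 fc; apply/integrableP; split; first exact/measurable_EFinP.
rewrite (eq_integral (fun x => (f x)%:E)) ?fc ?ltry//.
by move=> x; rewrite inE => Dx /=; rewrite ger0_norm// f0.
Qed.

Section StableLaplace.
Variables (R : realType) (d : measure_display) (T : measurableType d).
Variables (P : probability T R) (alpha gamma : R) (Z : T -> R).
Hypotheses (alpha0 : 0 < alpha) (alpha4 : alpha <= 1 / 4) (gamma4 : 4 * alpha <= gamma).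
Hypothesis Zst : positive_stable P alpha Z.

Let mZ : measurable_fun [set: T] Z. Proof. by have [[]] := Zst. Qed.

Let mpow (s : R) : measurable_fun [set: T] (fun x => Z x `^ s).
Proof. exact: (measurableT_comp (@measurable_powR R s) mZ). Qed.

Lemma stable_moment_nat k :
  (\int[P]_x ((Z x `^ (- alpha)) ^+ k)%:E = (gamma_succ k%:R / gamma_succ (k%:R * alpha))%:E)%E.
Proof.
case: k => [|k].
  (* [stable_moment] starts at the exponent [- alpha], so order 0 is treated apart. *)
  rewrite mul0r gamma_succ0 divr1; under eq_integral do rewrite expr0.
  by rewrite integral_cst// mul1e; exact: probability_setT.
rewrite -natr1 [_ * alpha]mulrC -(stable_moment alpha0 Zst (ler0n R k)).
apply: eq_integral => x _; congr EFin.
by rewrite natr1 -powR_mulrn ?powR_ge0// -powRrM mulNr.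
Qed.

Notation q := (gamma / alpha).

Let q0 : 0 < q.
Proof. by rewrite divr_gt0// (lt_le_trans _ gamma4)// mulr_gt0. Qed.

Let mu := @lebesgue_measure R.

(** The method of moments compares [x ^ (1 / q)] under the normalized mixtures with [Z ^ (- alpha)]
    under [P], and [weibull_test] turns the outcome into Laplace transforms at [l]. *)
Lemma stable_laplace_limit : exists (N : nat -> nat) (p : nat -> nat -> R) (c E : nat -> R),
  [/\ forall n, 0 < c n, forall n, 1 < E n,
      forall n i, (i <= N n)%N -> 0 < p n i &
      forall n a b, (a <= b)%N -> (b < N n)%N -> p n a * p n b.+1 <= p n a.+1 * p n b] /\
  ln (E n) @[n --> \oo] --> 0 /\
  forall l : R, 0 < l ->
    (\sum_(i < (N n).+1) p n i * (c n * E n ^+ i) / (c n * E n ^+ i + l)) /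
      \sum_(i < (N n).+1) p n i @[n --> \oo] -->
    (\int[P]_x expR (- (l * Z x `^ (- gamma))))%R.
Proof.
have [N [p [c [E [[c0 E1 p0 tp2] [E0 mom]]]]]] := lattice_moments alpha0 alpha4 gamma4
  (@cvg_gauss_product R) (fun s s0 => lt0r_neq0 (gamma_succ_gt0 s0)).
exists N, p, c, E; split=> //; split=> // l l0.
pose S n := \sum_(i < (N n).+1) p n i.
have S0 n : 0 < S n.
  rewrite /S big_ord_recr/= ltr_wpDl ?p0//; apply: sumr_ge0 => i _.
  by rewrite ltW// p0// ltnW.
pose ph n i := p n i / S n; pose t n i := c n * E n ^+ i.
have ph0 n i : (i < (N n).+1)%N -> 0 <= ph n i.
  by move=> iN; rewrite divr_ge0 ?(ltW (S0 n))// ltW// p0.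
have t0 n i : 0 < t n i by rewrite mulr_gt0// exprn_gt0// (lt_trans ltr01).
have Sph (f : nat -> nat -> R) n : \sum_(i < (N n).+1) ph n i * f n i =
    (\sum_(i < (N n).+1) p n i * f n i) / S n.
  by rewrite mulr_suml; apply: eq_bigr => i _; rewrite mulrAC.
pose h n := exp_mixture (N n).+1 (ph n) (t n).
pose v (x : R) := x `^ q^-1.
have mE : measurable (`]0%R, +oo[%classic : set R) by exact: measurable_itv.
have mh n (D : set R) : measurable_fun D (h n) by exact: measurable_exp_mixture.
have mv (D : set R) : measurable_fun D v by apply: measurable_funTS; exact: measurable_powR.
have h0 n x : 0 <= h n x by exact: (exp_mixture_ge0 (@ph0 n) (t0 n)).
have h1 n : (\int[mu]_(x in `]0%R, +oo[) (h n x)%:E = 1)%E.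
  have := exp_mixture_laplace (@ph0 n) (t0 n) (lexx (0 : R)).
  under eq_integral do rewrite mul0r oppr0 expR0 mul1r.
  move=> ->; congr EFin; rewrite (eq_bigr (fun i : 'I_(N n).+1 => ph n i * 1)).
    rewrite (Sph (fun _ _ => 1)) (eq_bigr (fun i : 'I_(N n).+1 => p n i)) ?divff ?gt_eqF ?S0//.
    by move=> i _; rewrite mulr1.
  by move=> i _; rewrite addr0 divff// gt_eqF.
have hk n k : (\int[mu]_(x in `]0%R, +oo[) (v x ^+ k * h n x)%:E =
    (gamma_succ (k%:R / q) * ((\sum_(i < (N n).+1) p n i * t n i `^ (- (k%:R / q))) / S n))%:E)%E.
  have kq0 : 0 <= k%:R / q by exact: divr_ge0 (ler0n R k) (ltW q0).
  rewrite -(Sph (fun n i => t n i `^ (- (k%:R / q)))) -(exp_mixture_moment (@ph0 n) (t0 n) kq0).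
  apply: eq_integral => x _; congr (_ * _)%:E.
  by rewrite /v -powR_mulrn ?powR_ge0// -powRrM mulrC.
have Mk k : (\int[P]_(x in setT) ((Z x `^ (- alpha)) ^+ k * cst 1 x))%R =
   gamma_succ k%:R / gamma_succ (k%:R * alpha).
  by rewrite /Rintegral; under eq_integral do rewrite /= mulr1; rewrite stable_moment_nat.
have mg : measurable_fun [set: T] (cst 1 : T -> R) by exact: measurable_cst.
have g0 x : [set: T] x -> 0 <= cst 1 x :> R by [].
have w0 x : [set: T] x -> 0 <= Z x `^ (- alpha) by move=> _; exact: powR_ge0.
have g1 : (\int[P]_(x in setT) (cst 1 x : R)%:E = 1)%E.
  by rewrite (eq_integral (cst 1%E))// integral_cst// mul1e; exact: probability_setT.
have Iw k : P.-integrable [set: T] (EFin \o (fun x => (Z x `^ (- alpha)) ^+ k * cst 1 x)).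
  apply: (@ge0_integral_fin_integrable _ _ _ _ _ _ (gamma_succ k%:R / gamma_succ (k%:R * alpha))) => //.
  - by apply: measurable_funM => //; exact: measurable_funX.
  - by move=> x _; rewrite mulr1 exprn_ge0// powR_ge0.
  - by under eq_integral do rewrite /= mulr1; exact: stable_moment_nat.
have Iv n k : mu.-integrable `]0%R, +oo[ (EFin \o (fun x : R => v x ^+ k * h n x)).
  apply: (ge0_integral_fin_integrable _ _ _ (hk n k)) => //.
  - apply: measurable_funM; last exact: mh.
    by apply: measurable_funX; exact: mv.
  - by move=> x _; apply: mulr_ge0 => //; apply: exprn_ge0; exact: powR_ge0.
have cvg_mom k : (\int[mu]_(x in `]0%R, +oo[) (v x ^+ k * h n x))%R @[n --> \oo] -->
    (\int[P]_(x in setT) ((Z x `^ (- alpha)) ^+ k * cst 1 x))%R.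
  (* The Gamma value at [k / q] contributed by the exponential law cancels the one in the
     denominator of the lattice moments. *)
  rewrite Mk [X in _ --> X](_ : _ = gamma_succ (k%:R / q) *
    (gamma_succ k%:R / (gamma_succ (k%:R / q) * gamma_succ (k%:R * alpha)))); last first.
    have a0 : gamma_succ (k%:R / q) != 0.
      by apply: lt0r_neq0; apply: gamma_succ_gt0; exact: divr_ge0 (ler0n R k) (ltW q0).
    have b0 : gamma_succ (k%:R * alpha) != 0.
      by apply: lt0r_neq0; apply: gamma_succ_gt0; exact: mulr_ge0 (ler0n R k) (ltW alpha0).
    move: a0 b0; move: (gamma_succ k%:R) (gamma_succ (_ / _)) (gamma_succ (_ * _)).
    by move=> x a b a0 b0; field; rewrite b0 a0.
  have cc : gamma_succ (k%:R / q) * ((\sum_(i < (N n).+1) p n i * t n i `^ (- (k%:R / q))) / S n)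
      @[n --> \oo] --> gamma_succ (k%:R / q) *
      (gamma_succ k%:R / (gamma_succ (k%:R / q) * gamma_succ (k%:R * alpha))).
    by apply: cvgM; [exact: cvg_cst|exact: mom].
  by apply: cvg_trans cc; apply: near_eq_cvg; near=> m; rewrite /Rintegral hk.
have small u : 0 <= u -> u ^+ k / k`!%:R *
    (\int[P]_(x in setT) ((Z x `^ (- alpha)) ^+ k * cst 1 x))%R @[k --> \oo] --> 0.
  by move=> u0; move: (expr_gamma_succ_cvg0 alpha0 u0); apply: cvg_trans;
    apply: near_eq_cvg; near=> k; rewrite Mk.
have := @method_of_moments R _ _ _ _ P setT (cst 1) (fun x => Z x `^ (- alpha))
  mu `]0%R, +oo[%classic h v measurableT mg (mpow _) g0 w0 g1 mE
  (fun n => mh n _) (mv _) (fun n x _ => h0 n x) (fun x _ => powR_ge0 _ _) h1 Iw Iv cvg_mom small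
  (weibull_test q l) (@continuous_weibull_test R q l q0 l0).
rewrite (_ : (\int[P]_(x in setT) _)%R = (\int[P]_x expR (- (l * Z x `^ (- gamma))))%R); last first.
  apply: eq_Rintegral => x _; rewrite mulr1 weibull_testE ?powR_ge0// -powRrM mulNr.
  by rewrite mulrCA divff ?gt_eqF// mulr1.
apply: cvg_trans; apply: near_eq_cvg; near=> n.
have := exp_mixture_laplace (@ph0 n) (t0 n) (ltW l0).
rewrite (Sph (fun n i => t n i / (t n i + l))) => H.
transitivity (fine ((\sum_(i < (N n).+1) p n i * (t n i / (t n i + l))) / S n)%:E).
  rewrite -H /Rintegral; congr fine; apply: eq_integral => x.
  rewrite inE/= in_itv/= andbT => x0; congr (_ * _)%:E.
  by rewrite weibull_testE ?powR_ge0// -powRrM mulVf ?gt_eqF// powRr1// ltW.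
by congr (_ / _); apply: eq_bigr => i _; rewrite mulrA.
Unshelve. all: by end_near. Qed.
End StableLaplace.

Section LaplaceTransform.
Variables (R : realType) (d : measure_display) (T : measurableType d).
Variables (P : probability T R) (X : T -> R).
Hypotheses (mX : measurable_fun [set: T] X) (X0 : forall x, 0 <= X x).

Let L l := (\int[P]_x expR (- (l * X x)))%R.

Let mL l : measurable_fun [set: T] (fun x => (expR (- (l * X x)))%:E).
Proof.
apply/measurable_EFinP; apply: measurableT_comp => //; apply: measurableT_comp => //.
exact: measurable_funM.
Qed.

Let laplace_le1 l x : 0 <= l -> expR (- (l * X x)) <= 1.
Proof. by move=> l0; rewrite expR_le1 oppr_le0 mulr_ge0. Qed.

Let integrable_cst1 : P.-integrable [set: T] (cst 1%E).
Proof. exact: finite_measure_integrable_cst. Qed.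

Lemma integral_laplaceE l : 0 <= l -> (\int[P]_x (expR (- (l * X x)))%:E = (L l)%:E)%E.
Proof.
move=> l0; rewrite /L /Rintegral fineK//; apply: integrable_fin_num => //.
apply: (@le_integrable _ _ _ P setT measurableT _ (cst 1%E)) => //.
by move=> x _; rewrite /= lee_fin normr1 ger0_norm ?expR_ge0// laplace_le1.
Qed.

Lemma laplace_gt0 l : 0 <= l -> 0 < L l.
Proof.
move=> l0; have := integral_laplaceE l0.
have L0 : 0 <= L l by apply: fine_ge0; apply: integral_ge0 => x _; rewrite lee_fin expR_ge0.
move: L0; rewrite le_eqVlt => /orP[/eqP <-|//] I0.
have I1 : (\int[P]_(x in setT) `|(expR (- (l * X x)))%:E| = 0)%E.
  by apply: etrans I0; apply: eq_integral => x _; rewrite /= ger0_norm// expR_ge0.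
have /negligibleP : P.-negligible [set: T].
  have := (ae_eq_integral_abs P measurableT (mL l)).1 I1.
  apply: negligibleS => x _ /=; apply/not_implyP; split=> // -[] /eqP.
  by rewrite gt_eqF// expR_gt0.
have PT : P [set: T] = 1%E by exact: probability_setT.
by move=> /(_ measurableT) P0; have /eqP := etrans (esym PT) P0; rewrite onee_eq0.
Qed.

(** [X] has finite values, so no mass sits at infinity; this provides the condition at 0 of
    [levy_density_limit]. *)
Lemma cvg_laplace_at0 : L l @[l --> 0^'+] --> (1 : R).
Proof.
apply/cvg_at_rightP => u [u0 cu].
have cf : {ae P, forall x, [set: T] x -> (expR (- (u n * X x)))%:E @[n --> \oo] --> cst 1%E x}.
  apply: aeW => x _; apply: cvg_EFin; first exact: nearW.
  rewrite /= -[X in _ --> X](@expR0 R) -[in X in _ --> X](oppr0) -[in X in _ --> X](mul0r (X x)).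
  have c1 : - (u n * X x) @[n --> \oo] --> - (0 * X x).
    by apply: cvgN; apply: cvgM => //; exact: cvg_cst.
  exact: (cvg_comp _ _ c1 (@continuous_expR R _)).
have dom : {ae P, forall x n, [set: T] x -> (`|(expR (- (u n * X x)))%:E| <= cst 1%E x)%E}.
  by apply: aeW => x n _; rewrite /= lee_fin ger0_norm ?expR_ge0// laplace_le1// ltW.
have [_ _ H] := @dominated_convergence _ _ _ P setT measurableT _ _ _
  (fun n => mL (u n)) (@measurable_cst _ _ _ _ _ _) cf integrable_cst1 dom.
have L1 : (\int[P]_(x in setT) cst 1 x = 1)%E.
  by rewrite integral_cst// mul1e; exact: probability_setT.
rewrite L1 in H.
have H2 : (L (u n))%:E @[n --> \oo] --> 1%:E.
  by apply: cvg_trans H; apply: near_eq_cvg; near=> n; rewrite -integral_laplaceE// ltW.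
exact: (fine_cvg H2).
Unshelve. all: by end_near. Qed.
End LaplaceTransform.

Theorem theorem2p1 (R : realType) (d : measure_display) (T : measurableType d)
    (P : probability T R) (alpha gamma : R) (Z : T -> R) :
  0 < alpha -> alpha <= 1 / 4 -> 4 * alpha <= gamma ->
  positive_stable P alpha Z ->
  GGC P (fun w => Z w `^ (- gamma)).
Proof.
move=> alpha0 alpha4 gamma4 Zst; have [[mZ Z0] _] := Zst.
set X := fun w => _.
have mX : measurable_fun [set: T] X by exact: (measurableT_comp (@measurable_powR R _) mZ).
have X0 w : 0 <= X w by exact: powR_ge0.
split; first by split=> //; apply: filterS Z0 => w; exact: powR_gt0.
have [N [p [c [E [[c0 E1 p0 tp2] [E0 lap]]]]]] := stable_laplace_limit alpha0 alpha4 gamma4 Zst.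
(* The error [ln (E n)] tends to 0, so the exponents of these gamma convolutions have the same limit
   as those of the mixtures. *)
have /choice[w w_spec] : forall n, exists w : nat -> R, [/\ forall i, 0 <= w i,
    \sum_(i < (N n).+1) w i = 1 & forall l, 0 < l ->
    `|- ln ((\sum_(i < (N n).+1) p n i * (c n * E n ^+ i) / (c n * E n ^+ i + l)) /
       \sum_(i < (N n).+1) p n i) -
     \sum_(i < (N n).+1) w i * ln (1 + l / (c n * E n ^+ i))| <= ln (E n)].
  by move=> n; exact: (thorin_approximation (c0 n) (E1 n) (p0 n) (tp2 n)).
pose A l := - ln (\int[P]_x expR (- (l * X x)))%R.
have cA l : 0 < l -> \sum_(i < (N n).+1) w n i * ln (1 + l / (c n * E n ^+ i)) @[n --> \oo] --> A l.
  move=> l0.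
  have c1 := cvg_comp _ _ (lap l l0) (continuous_ln (laplace_gt0 P mX X0 (ltW l0))).
  have c2 : - ln ((\sum_(i < (N n).+1) p n i * (c n * E n ^+ i) / (c n * E n ^+ i + l)) /
       \sum_(i < (N n).+1) p n i) @[n --> \oo] --> A l by exact: cvgN c1.
  apply/cvgrPdist_le => e e0; near=> n.
  have h1 : ln (E n) <= e / 2.
    near: n; move/cvgrPdist_le: E0 => /(_ (e / 2)).
    rewrite divr_gt0// => /(_ isT); apply: filterS => n.
    by rewrite sub0r normrN; apply: le_trans; exact: ler_norm.
  have h2 : `|A l - - ln ((\sum_(i < (N n).+1) p n i * (c n * E n ^+ i) / (c n * E n ^+ i + l)) /
       \sum_(i < (N n).+1) p n i)| <= e / 2.
    by near: n; move/cvgrPdist_le: c2; apply; rewrite divr_gt0.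
  have [_ _ /(_ _ l0)] := w_spec n.
  move: h2; rewrite !ler_norml => /andP[? ?] /andP[? ?]; apply/andP; split; lra.
have A0 : A l @[l --> 0^'+] --> 0.
  rewrite -[X in _ --> X]oppr0 -[in X in _ --> X](@ln1 R); apply: cvgN.
  exact: (cvg_comp _ _ (cvg_laplace_at0 P mX X0) (continuous_ln ltr01)).
have [|||phi [cm H]] := @levy_density_limit R (fun n => (N n).+1) w
  (fun n i => c n * E n ^+ i) _ _ _ A cA A0.
- by move=> n i; have [] := w_spec n.
- by move=> n i; rewrite mulr_gt0// exprn_gt0// (lt_trans ltr01).
- by move=> n; have [] := w_spec n.
(* The Lévy integral accounts for the whole exponent [A], so the drift is 0. The value at 0 is
   checked apart, the limits being taken for [0 < l]. *)
exists 0, phi; split=> // l; rewrite unlock mul0r add0e le_eqVlt => /orP[/eqP <-|l0].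
  rewrite [in RHS]integral0_eq; last by move=> x _; rewrite oppr0 mul0r expR0 subrr mul0r.
  rewrite oppe0 expeR0 (eq_integral (cst 1%E)); last by move=> x _; rewrite oppr0 mul0r expR0.
  by rewrite integral_cst// mul1e; exact: probability_setT.
rewrite H//= opprK lnK ?posrE ?laplace_gt0 ?(ltW l0)// -integral_laplaceE ?(ltW l0)//.
by apply: eq_integral => x _; rewrite mulNr.
Unshelve. all: by end_near. Qed.
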